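(* Let $H$ be a Hopf algebra over a field $k$ with a bijective antipode and let $(V,\nu)$ be a finite-dimensional involutive (i.e. $\nu^2=\mathrm{id}$) Hom-Yetter-Drinfeld module over $(H,\mathrm{id}_H)$. Assume that the braiding $C$ is symmetric on $V$. Then the Radford Hom-biproduct $(U(\mathrm{End}(V))^{\times}_{\sharp}H,\ \delta\otimes\mathrm{id})$ is a monoidal Hom-Hopf algebra, where the multiplication is defined by $$(f\times h)(f'\times h')=f(h_1\cdot\delta^{-1}(f'))\times h_2h',$$ the coproduct is defined by $$\Delta(f\times h)=(f_1\times f_{2(-1)}h_1)\otimes(\delta(f_{2(0)})\times h_2),$$ and the antipode is defined by $$S(f\times h)=(1\times S(f_{(-1)}h))(S(f_0)\times1),$$ for all $f\times h,\ f'\times h'\in U(\mathrm{End}(V))^{\times}_{\sharp}H$.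
   Context: Sweedler-type notation (summation suppressed) is used. $H$ is an ordinary Hopf algebra, viewed as a monoidal Hom-Hopf algebra with structure map $\alpha=\mathrm{id}_H$. Basic objects are pairs of a $k$-vector space and a linear automorphism; $(X,\alpha_X)\otimes(Y,\alpha_Y)=(X\otimes Y,\alpha_X\otimes\alpha_Y)$. Monoidal Hom-algebra $(A,\beta)$: $\beta(a)(bc)=(ab)\beta(c)$, $\beta(ab)=\beta(a)\beta(b)$, $a1=1a=\beta(a)$, $\beta(1)=1$. Monoidal Hom-coalgebra $(A,\beta)$: $\beta^{-1}(a_1)\otimes\Delta(a_2)=\Delta(a_1)\otimes\beta^{-1}(a_2)$, $\Delta(\beta(a))=\beta(a_1)\otimes\beta(a_2)$, $a_1\epsilon(a_2)=\epsilon(a_1)a_2=\beta^{-1}(a)$, $\epsilon\beta=\epsilon$. Monoidal Hom-Hopf algebra: both with the same $\beta$, $\Delta$ and $\epsilon$ multiplicative and unital, with antipode $S$ commuting with $\beta$ and $S(a_1)a_2=\epsilon(a)1=a_1S(a_2)$. An object $(M,\mu)$ of ${}^{H}_{H}\mathcal{HYD}$ (Hom-Yetter-Drinfeld module over $(H,\mathrm{id})$) has a left action with $h\cdot(g\cdot m)=(hg)\cdot\mu(m)$, $1_H\cdot m=\mu(m)$, $\mu(h\cdot m)=h\cdot\mu(m)$, and a left coaction $\rho(m)=m_{(-1)}\otimes m_0$ with $\Delta(m_{(-1)})\otimes\mu^{-1}(m_0)=m_{(-1)}\otimes(m_{0(-1)}\otimes m_{00})$, $\rho(\mu(m))=m_{(-1)}\otimes\mu(m_0)$,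 $\epsilon(m_{(-1)})m_0=\mu^{-1}(m)$, and $\rho(h\cdot m)=h_1m_{(-1)}S(h_3)\otimes h_2\cdot m_0$. Tensor products have $h\cdot(m\otimes n)=h_1\cdot m\otimes h_2\cdot n$, $\rho(m\otimes n)=m_{(-1)}n_{(-1)}\otimes(m_0\otimes n_0)$. The braiding is $C_{M,N}(m\otimes n)=m_{(-1)}\cdot\nu^{-1}(n)\otimes\mu(m_0)$ for $(M,\mu),(N,\nu)$; it is symmetric on $(V,\nu)$ if $a_{(-1)}\cdot\nu^{-1}(b)\otimes\nu(a_0)=\nu(b_0)\otimes S^{-1}(b_{(-1)})\cdot\nu^{-1}(a)$ for all $a,b\in V$. $\mathrm{End}(V)$ is the endomorphism algebra of $V$ (composition as product), equipped with the action $(h\cdot f)(v)=h_1\cdot f(S(h_2)\cdot v)$, the structure map $\delta(f)(v)=f(\nu^2(v))$, the coaction $\rho(f)=f_{(-1)}\otimes f_0$ determined by $f_{(-1)}\otimes f_0(v)=(f(v_0))_{(-1)}S^{-1}(v_{(-1)})\otimes(f(v_0))_0$, and the bracket $[f,g]=fg-(f_{(-1)}\cdot\delta^{-1}(g))\delta(f_0)$; with these it is taken as a braided Hom-Lie algebra $L=\mathrm{End}(V)$ (a Lie algebra object in ${}^{H}_{H}\mathcal{HYD}$ satisfying the braided Hom-skew-symmetry $[l,l']=-[l_{(-1)}\cdot\delta^{-1}(l'),\delta(l_0)]$ and the braided Hom-Jacobi identity $\{l\otimes l'\otimes l''\}+\{(C\otimes1)(1\otimes C)(l\otimes l'\otimes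 l'')\}+\{(1\otimes C)(C\otimes1)(l\otimes l'\otimes l'')\}=0$ with $\{l\otimes l'\otimes l''\}=[\delta(l),[l',l'']]$). $U(L)=T(L)/I$ is its universal enveloping algebra, where $T(L)=\bigoplus_{i\geq0}L^{\otimes i}$ with $L^{\otimes0}=k$, structure automorphism $\delta^{\otimes i}$ on $L^{\otimes i}$ (again denoted $\delta$), product $x\odot(y_1\otimes\cdots\otimes y_j)=\delta^{j-1}(x)\otimes y_1\otimes\delta(y_2\otimes\cdots\otimes y_j)$ for $x\in L^{\otimes i}$, $i,j\ge1$, and $1\odot x=x\odot1=\delta(x)$; $I$ is the smallest subspace containing all $x\otimes y-(x_{(-1)}\cdot\delta(y))\otimes\delta(x_0)-[x,y]$ ($x,y\in L$) that is stable under the action, coaction and $\delta$ and satisfies $(T(L)I)T(L)=T(L)(IT(L))\subseteq I$. The induced automorphism of $U(L)$ is also denoted $\delta$. $U(L)$ carries the Hom-Hopf algebra structure in ${}^{H}_{H}\mathcal{HYD}$ whose comultiplication (written $f\mapsto f_1\otimes f_2$) and counit are multiplicative for the braided product $(a\otimes b)(a'\otimes b')=a(b_{(-1)}\cdot\delta^{-1}(a'))\otimes\delta(b_0)b'$ on $U(L)\otimes U(L)$, with $\Delta(1)=1\otimes1$, $\epsilon(1)=1$, $\Delta(\overline l)=\delta(\overline l)\otimes1+1\otimes\delta(\overline l)$, $\epsilon(\overline l)=0$, $S(\overline l)=-\overline l$ for $l\in L$ with image $\overline l$, and $S(\overline x\,\overline y)=(\overline x_{(-1)}\cdot S(\delta^{-1}(\overline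 y)))S(\delta(\overline x_0))$. $U(\mathrm{End}(V))^{\times}_{\sharp}H$ has underlying space $U(\mathrm{End}(V))\otimes H$, with $f\times h$ denoting $f\otimes h$, unit $1\times1$ and counit $\epsilon(f)\epsilon(h)$; in the antipode formula, $S$ on the first bracket is the antipode of $H$ and on the second the antipode of $U(\mathrm{End}(V))$; $f_{(-1)}\otimes f_{0}$ is the $H$-coaction of $f\in U(\mathrm{End}(V))$ and $f_{(0)}=f_0$.
   Formalization: End(V) is taken to be the linear endomorphisms of V that commute with ν; for arbitrary linear maps the action gives 1·f = νfν, which differs from δ(f) = f unless f commutes with ν, so End(V) would not be an object of the category and the unit axiom would fail. *)

(* Defs.v *)
From HB Require Import structures.
From mathcomp Require Import all_boot all_order all_algebra.
From mathcomp Require Import boolp.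

Set Implicit Arguments.
Unset Strict Implicit.
Unset Printing Implicit Defensive.

Import GRing.Theory.
Local Open Scope quotient_scope.
Local Open Scope ring_scope.

(* MathComp has no tensor products of infinite-dimensional spaces. [pres Adm]
   is the vector space generated by X in which two formal linear combinations
   are equal exactly when every admissible map X -> P (P any k-vector space)
   gives them the same value, that is, the space through which admissible maps
   factor universally. Taking "admissible" to be "bilinear" on X = M * N gives
   the tensor product, taking it to be "multilinear on words of each length" on
   X = seq L gives the direct sum of the tensor powers of L. *)
Section Presentation.
Variables (k : fieldType) (X : choiceType).
Variable Adm : forall P : lmodType k, (X -> P) -> Prop.

Definition fsum (P : lmodType k) (f : X -> P) (s : seq (k * X)) : P :=
  \sum_(p <- s) p.1 *: f p.2.

Definition pres_rel (s t : seq (k * X)) : bool :=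
  `[< forall (P : lmodType k) (f : X -> P), Adm f -> fsum f s = fsum f t >].

Lemma pres_rel_equiv : equiv_class_of pres_rel.
Proof.
split=> [s|s t|t s u].
- by apply/asboolP.
- by apply/asboolP/asboolP => h P f hf; rewrite h.
- move=> /asboolP h1 /asboolP h2; apply/asboolP => P f hf.
  by rewrite h1 // h2.
Qed.

Canonical pres_rel_canonical := EquivRelPack pres_rel_equiv.
Canonical pres_rel_encModRel := defaultEncModRel pres_rel.

Definition pres := {eq_quot pres_rel}.
HB.instance Definition _ : EqQuotient _ pres_rel pres := EqQuotient.on pres.
HB.instance Definition _ := Choice.on pres.

Definition pclass (s : seq (k * X)) : pres := \pi_pres s.

Lemma pclassK (x : pres) : pclass (repr x) = x.
Proof. exact: reprK. Qed.

Lemma presP (s t : seq (k * X)) :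
  reflect (forall (P : lmodType k) (f : X -> P), Adm f -> fsum f s = fsum f t)
          (pclass s == pclass t).
Proof. by rewrite /pclass eqmodE; apply: asboolP. Qed.

Definition scale_fs (a : k) (s : seq (k * X)) := [seq (a * p.1, p.2) | p <- s].

Lemma fsum_cat (P : lmodType k) (f : X -> P) s t :
  fsum f (s ++ t) = fsum f s + fsum f t.
Proof. by rewrite /fsum big_cat. Qed.

Lemma fsum_scale (P : lmodType k) (f : X -> P) a s :
  fsum f (scale_fs a s) = a *: fsum f s.
Proof.
rewrite /fsum big_map scaler_sumr; apply: eq_bigr => p _ /=.
by rewrite scalerA.
Qed.

Lemma fsum_nil (P : lmodType k) (f : X -> P) : fsum f [::] = 0.
Proof. by rewrite /fsum big_nil. Qed.

Lemma fsum_cons (P : lmodType k) (f : X -> P) p s :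
  fsum f (p :: s) = p.1 *: f p.2 + fsum f s.
Proof. by rewrite /fsum big_cons. Qed.

Lemma fsum_repr (P : lmodType k) (f : X -> P) s :
  Adm f -> fsum f (repr (pclass s)) = fsum f s.
Proof. by move=> hf; apply: (presP _ _ _) => //; rewrite pclassK. Qed.

Let pzero : pres := pclass [::].
Let padd (x y : pres) : pres := pclass (repr x ++ repr y).
Let popp (x : pres) : pres := pclass (scale_fs (-1) (repr x)).
Let pscale (a : k) (x : pres) : pres := pclass (scale_fs a (repr x)).

Let fs_simp := (fsum_cat, fsum_scale, fsum_nil).

Let pres_ext (x : pres) s :
  (forall (P : lmodType k) (f : X -> P), Adm f -> fsum f s = fsum f (repr x)) ->
  pclass s = x.
Proof. by move=> h; rewrite -[x]pclassK; apply/eqP/presP. Qed.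

Let paddA : associative padd.
Proof.
move=> x y z; apply/eqP/presP => P f hf.
by rewrite !(fs_simp, fsum_repr _ hf) addrA.
Qed.
Let paddC : commutative padd.
Proof.
by move=> x y; apply/eqP/presP => P f hf; rewrite !fs_simp addrC.
Qed.
Let padd0 : left_id pzero padd.
Proof.
move=> x; apply: pres_ext => P f hf.
by rewrite !(fs_simp, fsum_repr _ hf) add0r.
Qed.
Let paddN : left_inverse pzero popp padd.
Proof.
move=> x; apply/eqP/presP => P f hf.
by rewrite !(fs_simp, fsum_repr _ hf) scaleN1r addNr.
Qed.

HB.instance Definition _ := GRing.isZmodule.Build pres paddA paddC padd0 paddN.

Let pscaleA a b x : pscale a (pscale b x) = pscale (a * b) x.
Proof.
apply/eqP/presP => P f hf.
by rewrite !(fs_simp, fsum_repr _ hf) scalerA.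
Qed.
Let pscale1 : left_id 1 pscale.
Proof.
by move=> x; apply: pres_ext => P f hf; rewrite !fs_simp scale1r.
Qed.
Let pscaleDr : right_distributive pscale +%R.
Proof.
move=> a x y; apply/eqP/presP => P f hf.
by rewrite !(fs_simp, fsum_repr _ hf) scalerDr.
Qed.
Let pscaleDl x : {morph pscale^~ x : a b / a + b}.
Proof.
move=> a b; apply/eqP/presP => P f hf.
by rewrite !(fs_simp, fsum_repr _ hf) scalerDl.
Qed.

HB.instance Definition _ :=
  GRing.Zmodule_isLmodule.Build k pres pscaleA pscale1 pscaleDr pscaleDl.

Definition pgen (x : X) : pres := pclass [:: (1, x)].

(* Evaluation of f on a chosen expression of t as a linear combination of
   generators; independent of that choice when f is admissible. *)
Definition pfold (P : lmodType k) (f : X -> P) (t : pres) : P := fsum f (repr t).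

Lemma pfold_linear (P : lmodType k) (f : X -> P) : Adm f -> linear (pfold f).
Proof.
by move=> hf a x y; rewrite /pfold !(fsum_repr _ hf, fs_simp).
Qed.

Lemma pfold_gen (P : lmodType k) (f : X -> P) x : Adm f -> pfold f (pgen x) = f x.
Proof.
by move=> hf; rewrite /pfold fsum_repr // /fsum big_seq1 scale1r.
Qed.

Lemma pclass_fsum (s : seq (k * X)) : pclass s = fsum pgen s.
Proof.
elim: s => [|[a x] s IH]; first by rewrite fsum_nil.
rewrite -cat1s fsum_cat -IH; apply/eqP/presP => P f hf.
rewrite !(fs_simp, fsum_repr _ hf); congr (_ + _).
have -> : fsum pgen [:: (a, x)] = a *: pgen x by rewrite /fsum big_seq1.
by rewrite !(fs_simp, fsum_repr _ hf) /fsum !big_seq1 scale1r.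
Qed.

Lemma pres_gen (t : pres) : t = fsum pgen (repr t).
Proof. by rewrite -pclass_fsum pclassK. Qed.

Lemma fsum_gen_eq (s t : seq (k * X)) :
  (forall (P : lmodType k) (f : X -> P), Adm f -> fsum f s = fsum f t) ->
  fsum pgen s = fsum pgen t.
Proof. by move=> h; rewrite -!pclass_fsum; apply/eqP/presP. Qed.

End Presentation.

Section Tensor.
Variable k : fieldType.

Definition bilinear_map (M N P : lmodType k) (b : M -> N -> P) : Prop :=
  (forall m, linear (b m)) /\ (forall n, linear (b^~ n)).

Definition tensor_adm (M N : lmodType k) (P : lmodType k) (f : M * N -> P) :=
  bilinear_map (fun m n => f (m, n)).

Definition tensor (M N : lmodType k) := pres (@tensor_adm M N).
HB.instance Definition _ (M N : lmodType k) := GRing.Lmodule.on (tensor M N).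

Definition tns (M N : lmodType k) (m : M) (n : N) : tensor M N :=
  pgen (@tensor_adm M N) (m, n).

(* Sweedler notation: b t_(1) t_(2), summed over a chosen expression of t as a
   combination of pure tensors; the choice is immaterial when b is bilinear. *)
Definition sweedler (M N P : lmodType k) (t : tensor M N) (b : M -> N -> P) : P :=
  pfold (fun p => b p.1 p.2) t.
Arguments sweedler {M N P} t b.

Lemma sweedler_linear (M N P : lmodType k) (b : M -> N -> P) :
  bilinear_map b -> linear (sweedler^~ b).
Proof. by move=> hb; apply: pfold_linear. Qed.

End Tensor.

Notation "m ⊗ n" := (tns m n) (at level 40, left associativity) : ring_scope.
Notation "\sw_ ( a , b <- t ) E" := (sweedler t (fun a b => E))
  (at level 41, right associativity, E at level 41, a name, b name, t at level 200,
   format "'[' \sw_ ( a ,  b  <-  t ) '/  '  E ']'") : ring_scope.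

Section TensorTheory.
Variable k : fieldType.

Lemma tns_bilinear (M N : lmodType k) : bilinear_map (@tns k M N).
Proof.
have E a m n m' n' m'' n'' :
  (forall (P : lmodType k) (f : M * N -> P), tensor_adm f ->
    f (m'', n'') = a *: f (m, n) + f (m', n')) ->
  tns m'' n'' = a *: tns m n + tns m' n'.
  move=> h.
  have := @fsum_gen_eq k _ (@tensor_adm k M N)
    [:: (1, (m'', n''))] [:: (a, (m, n)); (1, (m', n'))].
  rewrite !fsum_cons !fsum_nil !addr0 !scale1r; apply=> P f hf.
  by rewrite !fsum_cons !fsum_nil !addr0 !scale1r h.
split=> [m a n n'|n a m m']; apply: E => P f [h1 h2].
  exact: h1.
exact: h2.
Qed.

Lemma sweedler_tns (M N P : lmodType k) (b : M -> N -> P) m n :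
  bilinear_map b -> \sw_(x, y <- m ⊗ n) b x y = b m n.
Proof. by move=> hb; rewrite /sweedler pfold_gen. Qed.

Lemma tensor_tns (M N : lmodType k) (t : tensor M N) :
  t = \sw_(m, n <- t) m ⊗ n.
Proof.
rewrite {1}[t]pres_gen /sweedler /pfold /fsum.
by apply: eq_bigr => -[a [m n]].
Qed.

Lemma eq_sweedler (M N P : lmodType k) (t : tensor M N) (b c : M -> N -> P) :
  b =2 c -> sweedler t b = sweedler t c.
Proof. by move=> h; apply: eq_bigr => p _; rewrite h. Qed.

Lemma sweedler_map (M N P Q : lmodType k) (t : tensor M N) (b : M -> N -> P)
    (f : P -> Q) :
  linear f -> f (sweedler t b) = \sw_(m, n <- t) f (b m n).
Proof.
move=> hf; pose lf := GRing.isLinear.Build k P Q *:%R f hf.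
pose g : {linear P -> Q} := HB.pack f lf.
rewrite -[f]/(g : P -> Q) /sweedler /pfold /fsum linear_sum.
by apply: eq_bigr => p _; rewrite linearZ.
Qed.

Lemma sweedler_param_linear (M N P Q : lmodType k) (t : tensor M N)
    (F : Q -> M -> N -> P) :
  (forall m n, linear (fun v => F v m n)) -> linear (fun v => sweedler t (F v)).
Proof.
move=> hF a u v; rewrite /sweedler /pfold /fsum scaler_sumr -big_split.
by apply: eq_bigr => p _; rewrite /= hF scalerDr !scalerA mulrC.
Qed.

End TensorTheory.

Section Quotient.
Variables (k : fieldType) (T : lmodType k).

Definition lspan (X : T -> Prop) (x : T) : Prop :=
  exists2 s : seq (k * T), (forall p, p \in s -> X p.2)
    & x = \sum_(p <- s) p.1 *: p.2.

Definition subspace (J : T -> Prop) : Prop :=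
  J 0 /\ forall a x y, J x -> J y -> J (a *: x + y).

Lemma lspan_subspace X : subspace (lspan X).
Proof.
split; first by exists [::]; rewrite ?big_nil.
move=> a x y [s hs ->] [t ht ->].
exists ([seq (a * p.1, p.2) | p <- s] ++ t).
  move=> p; rewrite mem_cat => /orP[/mapP[q qs ->]|]; last exact: ht.
  exact: hs qs.
rewrite big_cat big_map scaler_sumr; congr (_ + _).
by apply: eq_bigr => p _; rewrite scalerA.
Qed.

Lemma lspan_id (J : T -> Prop) x : subspace J -> lspan J x <-> J x.
Proof.
move=> [J0 JD]; split=> [[s hs ->]|hx]; last first.
  exists [:: (1, x)]; last by rewrite big_seq1 scale1r.
  by move=> p; rewrite inE => /eqP ->.
elim: s hs => [|p s IH] hs; first by rewrite big_nil.
rewrite big_cons; apply: JD.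
  by apply: hs; rewrite mem_head.
by apply: IH => q qs; apply: hs; rewrite in_cons qs orbT.
Qed.

Variable I : T -> Prop.

Definition vquot_rel (x y : T) : bool := `[< lspan I (x - y) >].

Lemma vquot_rel_equiv : equiv_class_of vquot_rel.
Proof.
have [S0 SD] := lspan_subspace I.
have SN x : lspan I x -> lspan I (- x).
  by move=> hx; rewrite -scaleN1r -[_ *: _]addr0; apply: SD.
split=> [x|x y|y x z].
- by apply/asboolP; rewrite subrr.
- by apply/asboolP/asboolP => /SN; rewrite opprB.
- move=> /asboolP h1 /asboolP h2; apply/asboolP.
  have -> : x - z = 1 *: (x - y) + (y - z) by rewrite scale1r addrA subrK.
  exact: SD.
Qed.

Canonical vquot_rel_canonical := EquivRelPack vquot_rel_equiv.
Canonical vquot_rel_encModRel := defaultEncModRel vquot_rel.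

(* The quotient space of T by (the span of) I. *)
Definition vquot := {eq_quot vquot_rel}.
HB.instance Definition _ : EqQuotient _ vquot_rel vquot := EqQuotient.on vquot.
HB.instance Definition _ := Choice.on vquot.

Definition vproj (x : T) : vquot := \pi x.

Lemma vprojP (x y : T) : vproj x = vproj y <-> lspan I (x - y).
Proof.
split=> [/eqP|h]; first by rewrite /vproj eqmodE => /asboolP.
by apply/eqP; rewrite /vproj eqmodE; apply/asboolP.
Qed.

Let qadd (x y : vquot) := vproj (repr x + repr y).
Let qopp (x : vquot) := vproj (- repr x).
Let qscale (a : k) (x : vquot) := vproj (a *: repr x).

Let vproj_repr x : lspan I (repr (vproj x) - x).
Proof. by apply/vprojP; rewrite /vproj reprK. Qed.

Let SD a x y : lspan I x -> lspan I y -> lspan I (a *: x + y).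
Proof. exact: (lspan_subspace I).2. Qed.

Let S0 : lspan I 0. Proof. exact: (lspan_subspace I).1. Qed.

Let qaddE x y : qadd (vproj x) (vproj y) = vproj (x + y).
Proof.
apply/vprojP; rewrite opprD addrACA.
by rewrite -[X in X + _]scale1r; apply: SD.
Qed.
Let qscaleE a x : qscale a (vproj x) = vproj (a *: x).
Proof. by apply/vprojP; rewrite -scalerBr -[_ *: _]addr0; apply: SD. Qed.
Let qoppE x : qopp (vproj x) = vproj (- x).
Proof.
by rewrite -[in RHS]scaleN1r -qscaleE /qopp /qscale scaleN1r.
Qed.

Let qW (Q : vquot -> Prop) : (forall x, Q (vproj x)) -> forall u, Q u.
Proof. by move=> h u; rewrite -[u]reprK; apply: h. Qed.

Let qaddA : associative qadd.
Proof. by do 3![elim/qW=> ?]; rewrite !qaddE addrA. Qed.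
Let qaddC : commutative qadd.
Proof. by move=> x y; rewrite /qadd addrC. Qed.
Let qadd0 : left_id (vproj 0) qadd.
Proof. by elim/qW=> x; rewrite qaddE add0r. Qed.
Let qaddN : left_inverse (vproj 0) qopp qadd.
Proof. by elim/qW=> x; rewrite qoppE qaddE addNr. Qed.

HB.instance Definition _ := GRing.isZmodule.Build vquot qaddA qaddC qadd0 qaddN.

Let qscaleA a b x : qscale a (qscale b x) = qscale (a * b) x.
Proof. by elim/qW: x => x; rewrite !qscaleE scalerA. Qed.
Let qscale1 : left_id 1 qscale.
Proof. by elim/qW=> x; rewrite qscaleE scale1r. Qed.
Let qscaleDr : right_distributive qscale +%R.
Proof.
move=> a; elim/qW=> x; elim/qW=> y.
by rewrite -[_ + _]/(qadd _ _) -[_ + _ in RHS]/(qadd _ _)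
  qaddE !qscaleE qaddE scalerDr.
Qed.
Let qscaleDl x : {morph qscale^~ x : a b / a + b}.
Proof.
elim/qW: x => x a b; rewrite -[_ + _ in RHS]/(qadd _ _).
by rewrite !qscaleE qaddE scalerDl.
Qed.

HB.instance Definition _ :=
  GRing.Zmodule_isLmodule.Build k vquot qscaleA qscale1 qscaleDr qscaleDl.

Lemma vproj_linear : linear vproj.
Proof. by move=> a x y; rewrite -qaddE -qscaleE. Qed.

Lemma vproj_surj (u : vquot) : vproj (repr u) = u.
Proof. exact: reprK. Qed.

End Quotient.

(* [algType] asks for 1 != 0, which the counit forces anyway. *)
Record hopfAlg (k : fieldType) := HopfAlg {
  hopf_sort :> algType k;
  comul : {linear hopf_sort -> tensor hopf_sort hopf_sort};
  counit : {scalar hopf_sort};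
  antipode : {linear hopf_sort -> hopf_sort};
  comulA : forall h,
    \sw_(a, b <- comul h) \sw_(a1, a2 <- comul a) (a1 ⊗ (a2 ⊗ b)) =
    \sw_(a, b <- comul h) \sw_(b1, b2 <- comul b) (a ⊗ (b1 ⊗ b2));
  counitl : forall h, \sw_(a, b <- comul h) (counit a *: b) = h;
  counitr : forall h, \sw_(a, b <- comul h) (counit b *: a) = h;
  comul1 : comul 1 = 1 ⊗ 1;
  comulM : forall g h : hopf_sort, comul (g * h) =
    \sw_(g1, g2 <- comul g) \sw_(h1, h2 <- comul h) ((g1 * h1) ⊗ (g2 * h2));
  counit1 : counit 1 = 1;
  counitM : forall g h : hopf_sort, counit (g * h) = counit g * counit h;
  antipodel : forall h,
    \sw_(a, b <- comul h) (antipode a * b) = (counit h)%:A;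
  antipoder : forall h,
    \sw_(a, b <- comul h) (a * antipode b) = (counit h)%:A
}.

Section HomStructures.
Variables (k : fieldType) (A : lmodType k).

Definition lin_autom (mu muV : A -> A) : Prop :=
  [/\ linear mu, cancel mu muV & cancel muV mu].

Record is_hom_alg (beta betaV : A -> A) (mul : A -> A -> A) (one : A) : Prop :=
  IsHomAlg {
  homalg_autom : lin_autom beta betaV;
  homalg_bilin : bilinear_map mul;
  homalg_assoc : forall a b c,
    mul (beta a) (mul b c) = mul (mul a b) (beta c);
  homalg_betaM : forall a b, beta (mul a b) = mul (beta a) (beta b);
  homalg_mulr1 : forall a, mul a one = beta a;
  homalg_mul1r : forall a, mul one a = beta a;
  homalg_beta1 : beta one = one
}.

Record is_hom_coalg (beta betaV : A -> A) (Delta : A -> tensor A A)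
    (eps : A -> k) : Prop := IsHomCoalg {
  homcoalg_autom : lin_autom beta betaV;
  homcoalg_lin : linear Delta;
  homcoalg_eps_lin : scalar eps;
  homcoalg_coassoc : forall a,
    \sw_(a1, a2 <- Delta a) \sw_(b1, b2 <- Delta a2) (betaV a1 ⊗ (b1 ⊗ b2)) =
    \sw_(a1, a2 <- Delta a) \sw_(b1, b2 <- Delta a1) (b1 ⊗ (b2 ⊗ betaV a2));
  homcoalg_beta : forall a,
    Delta (beta a) = \sw_(a1, a2 <- Delta a) (beta a1 ⊗ beta a2);
  homcoalg_counitr : forall a,
    \sw_(a1, a2 <- Delta a) (eps a2 *: a1) = betaV a;
  homcoalg_counitl : forall a,
    \sw_(a1, a2 <- Delta a) (eps a1 *: a2) = betaV a;
  homcoalg_eps_beta : forall a, eps (beta a) = eps a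
}.

Record is_hom_hopf (beta betaV : A -> A) (mul : A -> A -> A) (one : A)
    (Delta : A -> tensor A A) (eps : A -> k) (S : A -> A) : Prop := IsHomHopf {
  homhopf_alg : is_hom_alg beta betaV mul one;
  homhopf_coalg : is_hom_coalg beta betaV Delta eps;
  homhopf_comulM : forall a b, Delta (mul a b) =
    \sw_(a1, a2 <- Delta a) \sw_(b1, b2 <- Delta b) (mul a1 b1 ⊗ mul a2 b2);
  homhopf_comul1 : Delta one = one ⊗ one;
  homhopf_epsM : forall a b, eps (mul a b) = eps a * eps b;
  homhopf_eps1 : eps one = 1;
  homhopf_S_lin : linear S;
  homhopf_S_beta : forall a, S (beta a) = beta (S a);
  homhopf_Sl : forall a, \sw_(a1, a2 <- Delta a) (mul (S a1) a2) = eps a *: one;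
  homhopf_Sr : forall a, \sw_(a1, a2 <- Delta a) (mul a1 (S a2)) = eps a *: one
}.

End HomStructures.

Section HomYetterDrinfeld.
Variables (k : fieldType) (H : hopfAlg k).

Record hydData (M : lmodType k) := HydData {
  hmap : M -> M;
  hinv : M -> M;
  hact : H -> M -> M;
  hcoact : M -> tensor H M
}.

Record is_hyd (M : lmodType k) (D : hydData M) : Prop := IsHyd {
  hyd_autom : lin_autom (hmap D) (hinv D);
  hyd_act_bilin : bilinear_map (hact D);
  hyd_actM : forall h g m, hact D h (hact D g m) = hact D (h * g) (hmap D m);
  hyd_act1 : forall m, hact D 1 m = hmap D m;
  hyd_act_map : forall h m, hmap D (hact D h m) = hact D h (hmap D m);
  hyd_coact_lin : linear (hcoact D);
  hyd_coact_coassoc : forall m,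
    \sw_(a, m0 <- hcoact D m) \sw_(a1, a2 <- comul H a)
      (a1 ⊗ (a2 ⊗ hinv D m0)) =
    \sw_(a, m0 <- hcoact D m) \sw_(b, m00 <- hcoact D m0) (a ⊗ (b ⊗ m00));
  hyd_coact_map : forall m,
    hcoact D (hmap D m) = \sw_(a, m0 <- hcoact D m) (a ⊗ hmap D m0);
  hyd_coact_counit : forall m,
    \sw_(a, m0 <- hcoact D m) (counit H a *: m0) = hinv D m;
  hyd_compat : forall h m, hcoact D (hact D h m) =
    \sw_(h1, h' <- comul H h) \sw_(h2, h3 <- comul H h')
    \sw_(a, m0 <- hcoact D m) ((h1 * a * antipode H h3) ⊗ hact D h2 m0)
}.

Record hyd (M : lmodType k) := Hyd {
  hyd_data :> hydData M;
  hydP : is_hyd hyd_data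
}.

Definition symmetric_braiding (Sinv : H -> H) (M : lmodType k) (D : hydData M)
    : Prop :=
  forall m n : M,
    \sw_(a, m0 <- hcoact D m) (hact D a (hinv D n) ⊗ hmap D m0) =
    \sw_(b, n0 <- hcoact D n) (hmap D n0 ⊗ hact D (Sinv b) (hinv D m)).

(* Hom-Hopf algebras in the category: mul, one, Delta, eps and S are morphisms of
   Hom-Yetter-Drinfeld modules (the base field having action counit and coaction
   1 ⊗ -), and Delta is multiplicative for the braided product
   (a ⊗ b)(a' ⊗ b') = a (b_(-1) . hinv a') ⊗ hmap b_0 b'. *)
Record is_hyd_hopf (B : lmodType k) (D : hydData B) (mul : B -> B -> B) (one : B)
    (Delta : B -> tensor B B) (eps : B -> k) (S : B -> B) : Prop := IsHydHopf {
  hh_hyd : is_hyd D;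
  hh_alg : is_hom_alg (hmap D) (hinv D) mul one;
  hh_coalg : is_hom_coalg (hmap D) (hinv D) Delta eps;
  hh_mul_act : forall h a b, hact D h (mul a b) =
    \sw_(h1, h2 <- comul H h) mul (hact D h1 a) (hact D h2 b);
  hh_one_act : forall h, hact D h one = counit H h *: one;
  hh_mul_coact : forall a b, hcoact D (mul a b) =
    \sw_(x, a0 <- hcoact D a) \sw_(y, b0 <- hcoact D b)
      ((x * y) ⊗ mul a0 b0);
  hh_one_coact : hcoact D one = 1 ⊗ one;
  hh_comul_act : forall h a, Delta (hact D h a) =
    \sw_(h1, h2 <- comul H h) \sw_(a1, a2 <- Delta a)
      (hact D h1 a1 ⊗ hact D h2 a2);
  hh_eps_act : forall h a, eps (hact D h a) = counit H h * eps a;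
  hh_comul_coact : forall a,
    \sw_(x, a0 <- hcoact D a) (x ⊗ Delta a0) =
    \sw_(a1, a2 <- Delta a) \sw_(x, a10 <- hcoact D a1)
    \sw_(y, a20 <- hcoact D a2) ((x * y) ⊗ (a10 ⊗ a20));
  hh_eps_coact : forall a,
    \sw_(x, a0 <- hcoact D a) (eps a0 *: x) = (eps a)%:A;
  hh_comulM : forall a b, Delta (mul a b) =
    \sw_(a1, a2 <- Delta a) \sw_(b1, b2 <- Delta b) \sw_(x, a20 <- hcoact D a2)
      (mul a1 (hact D x (hinv D b1)) ⊗ mul (hmap D a20) b2);
  hh_comul1 : Delta one = one ⊗ one;
  hh_epsM : forall a b, eps (mul a b) = eps a * eps b;
  hh_eps1 : eps one = 1;
  hh_S_lin : linear S;
  hh_S_map : forall a, S (hmap D a) = hmap D (S a);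
  hh_S_act : forall h a, S (hact D h a) = hact D h (S a);
  hh_S_coact : forall a,
    hcoact D (S a) = \sw_(x, a0 <- hcoact D a) (x ⊗ S a0);
  hh_Sl : forall a, \sw_(a1, a2 <- Delta a) mul (S a1) a2 = eps a *: one;
  hh_Sr : forall a, \sw_(a1, a2 <- Delta a) mul a1 (S a2) = eps a *: one
}.

End HomYetterDrinfeld.

Definition the (T : Type) (x0 : T) (P : T -> Prop) : T :=
  if pselect (exists x, P x) is left ex then projT1 (cid ex) else x0.

Lemma theP (T : Type) (x0 : T) (P : T -> Prop) :
  (exists x, P x) -> P (the x0 P).
Proof. by rewrite /the; case: pselect => // ex _; case: cid. Qed.

Section TensorAlgebraSpace.
Variables (k : fieldType) (L : lmodType k).

Definition multilinear_map (P : lmodType k) (f : seq L -> P) : Prop :=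
  forall s1 s2 : seq L, linear (fun x => f (s1 ++ x :: s2)).

(* The direct sum of the tensor powers of L; [tword [:: x1; ...; xi]] is
   x1 ⊗ ... ⊗ xi. *)
Definition tensalg := pres multilinear_map.
HB.instance Definition _ := GRing.Lmodule.on tensalg.

Definition tword (s : seq L) : tensalg := pgen multilinear_map s.

Definition tfold (P : lmodType k) (f : seq L -> P) (t : tensalg) : P := pfold f t.

Lemma tfold_tword (P : lmodType k) (f : seq L -> P) s :
  multilinear_map f -> tfold f (tword s) = f s.
Proof. exact: pfold_gen. Qed.

Lemma tfold_linear (P : lmodType k) (f : seq L -> P) :
  multilinear_map f -> linear (tfold f).
Proof. exact: pfold_linear. Qed.

Lemma tensalg_tword (t : tensalg) : t = tfold tword t.
Proof. exact: pres_gen. Qed.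

Lemma tword_multilinear : multilinear_map tword.
Proof.
move=> s1 s2 a x y.
have := @fsum_gen_eq k _ multilinear_map
  [:: (1, s1 ++ (a *: x + y) :: s2)]
  [:: (a, s1 ++ x :: s2); (1, s1 ++ y :: s2)].
rewrite !fsum_cons !fsum_nil !addr0 !scale1r; apply=> P f hf.
by rewrite !fsum_cons !fsum_nil !addr0 !scale1r /= hf.
Qed.

End TensorAlgebraSpace.

Section EnvelopingAlgebra.
Variables (k : fieldType) (H : hopfAlg k).

(* The structure maps of a Lie algebra object of the category: structure
   automorphism, action, coaction and bracket. *)
Record lieData := LieData {
  lie_sort :> lmodType k;
  lie_hyd : hydData H lie_sort;
  lie_br : lie_sort -> lie_sort -> lie_sort
}.

Variable L : lieData.
Local Notation δ := (hmap (lie_hyd L)).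
Local Notation δinv := (hinv (lie_hyd L)).
Local Notation actL := (hact (lie_hyd L)).
Local Notation ρL := (hcoact (lie_hyd L)).
Local Notation T := (tensalg L).

Definition tmap (t : T) : T := tfold (fun s => tword (map δ s)) t.
Definition tinv (t : T) : T := tfold (fun s => tword (map δinv s)) t.

(* s ⊙ t = δ^(j-1)(s) ⊗ t_1 ⊗ δ(t_2 ⊗ ... ⊗ t_j) for t of length j >= 1 *)
Definition wmul (s t : seq L) : seq L :=
  match s, t with
  | [::], _ => map δ t
  | _, [::] => map δ s
  | _, y :: t' => map (iter (size t') δ) s ++ y :: map δ t'
  end.

Definition tmul (x y : T) : T :=
  tfold (fun s => tfold (fun t => tword (wmul s t)) y) x.

Definition tcons (x : L) (t : T) : T := tfold (fun s => tword (x :: s)) t.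

Fixpoint wact (h : H) (s : seq L) : T :=
  match s with
  | [::] => counit H h *: tword [::]
  | x :: s' => \sw_(h1, h2 <- comul H h) tcons (actL h1 x) (wact h2 s')
  end.

Definition tact (h : H) (t : T) : T := tfold (wact h) t.

Fixpoint wcoact (s : seq L) : tensor H T :=
  match s with
  | [::] => 1 ⊗ tword [::]
  | x :: s' => \sw_(a, x0 <- ρL x) \sw_(b, t0 <- wcoact s')
                 ((a * b) ⊗ tcons x0 t0)
  end.

Definition tcoact (t : T) : tensor H T := tfold wcoact t.

Definition lie_rel (x y : L) : T :=
  tword [:: x; y]
  - \sw_(a, x0 <- ρL x) tword [:: actL a (δ y); δ x0]
  - tword [:: lie_br x y].

Definition prod_span (A B : T -> Prop) : T -> Prop :=
  lspan (fun t => exists a b, [/\ A a, B b & t = tmul a b]).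

(* [ideal_map]: J is a subobject, so the automorphism of T(L) restricts to an
   automorphism of J. [ideal_coact]: the coaction sends J into H ⊗ J. *)
Record admissible_ideal (J : T -> Prop) : Prop := AdmissibleIdeal {
  ideal_subspace : subspace J;
  ideal_rel : forall x y, J (lie_rel x y);
  ideal_act : forall h t, J t -> J (tact h t);
  ideal_coact : forall t, J t ->
    lspan (fun u => exists h t', J t' /\ u = h ⊗ t') (tcoact t);
  ideal_map : forall t, J t -> J (tmap t) /\ J (tinv t);
  ideal_assoc : forall t,
    prod_span (prod_span (fun=> True) J) (fun=> True) t <->
    prod_span (fun=> True) (prod_span J (fun=> True)) t;
  ideal_mul : forall t, prod_span (prod_span (fun=> True) J) (fun=> True) t -> J t
}.

(* The smallest such subspace, as an intersection. *)
Definition lie_ideal (t : T) : Prop :=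
  forall J : T -> Prop, admissible_ideal J -> J t.

Definition envalg := vquot lie_ideal.
HB.instance Definition _ := GRing.Lmodule.on envalg.

Definition uproj (t : T) : envalg := vproj lie_ideal t.
Definition urepr (u : envalg) : T := repr (u : vquot lie_ideal).
Definition ulie (l : L) : envalg := uproj (tword [:: l]).

(* The structure maps induced by those of T(L), computed on representatives. *)
Definition umul (u v : envalg) : envalg := uproj (tmul (urepr u) (urepr v)).
Definition uone : envalg := uproj (tword [::]).
Definition uhyd : hydData H envalg := {|
  hmap := fun u => uproj (tmap (urepr u));
  hinv := fun u => uproj (tinv (urepr u));
  hact := fun h u => uproj (tact h (urepr u));
  hcoact := fun u => \sw_(a, t <- tcoact (urepr u)) (a ⊗ uproj t)
|}.

Record uhopfMaps := UHopfMaps {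
  ucomul : envalg -> tensor envalg envalg;
  ucounit : envalg -> k;
  uantipode : envalg -> envalg
}.

Record is_uhopf (D : uhopfMaps) : Prop := IsUHopf {
  uhopf_hopf : is_hyd_hopf uhyd umul uone (ucomul D) (ucounit D) (uantipode D);
  uhopf_comul : forall l,
    ucomul D (ulie l) = hmap uhyd (ulie l) ⊗ uone + uone ⊗ hmap uhyd (ulie l);
  uhopf_counit : forall l, ucounit D (ulie l) = 0;
  uhopf_antipode : forall l, uantipode D (ulie l) = - ulie l;
  uhopf_antipodeM : forall u v, uantipode D (umul u v) =
    \sw_(a, u0 <- hcoact uhyd u)
      umul (hact uhyd a (uantipode D (hinv uhyd v))) (uantipode D (hmap uhyd u0))
}.

(* The Hom-Hopf structure of U(L): since 1 and L generate U(L), at most one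
   triple of maps satisfies [is_uhopf]. *)
Definition uhopf : uhopfMaps :=
  the (UHopfMaps (fun=> 0) (fun=> 0) (fun=> 0)) is_uhopf.

End EnvelopingAlgebra.

Section HomEndomorphisms.
Variables (k : fieldType) (H : hopfAlg k) (V : vectType k) (Y : hyd H V).
Local Notation ν := (hmap Y).
Local Notation νinv := (hinv Y).

(* End(V) consists of the endomorphisms of the object (V, ν), that is, of the
   linear maps commuting with ν. This is forced by the unit axiom
   1 . f = δ(f), as (1 . f)(v) = ν(f(ν(v))) while δ(f)(v) = f(ν^2(v)). *)
Definition hom_endo : {pred 'End(V)} := fun f => `[< forall v, f (ν v) = ν (f v) >].

Lemma hmap_linear : linear ν. Proof. by case: (hyd_autom (hydP Y)). Qed.

HB.instance Definition _ := GRing.isLinear.Build k V V *:%R ν hmap_linear.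

Lemma hom_endo_submod : submod_closed hom_endo.
Proof.
split=> [|a f g /asboolP hf /asboolP hg]; apply/asboolP => v.
  by rewrite !lfunE /= linear0.
by rewrite !lfunE /= !lfunE /= hf hg linearP.
Qed.

HB.instance Definition _ :=
  GRing.isSubmodClosed.Build k 'End(V) hom_endo hom_endo_submod.

Record endo := Endo { endo_val :> 'End(V); _ : endo_val \in hom_endo }.

HB.instance Definition _ := [isSub for endo_val].
HB.instance Definition _ := [Choice of endo by <:].
HB.instance Definition _ := [SubChoice_isSubLmodule of endo by <:].


Lemma endo_eqP (f g : endo) : (forall v, f v = g v) -> f = g.
Proof. by move=> h; apply/val_inj/lfunP. Qed.

Lemma endo_comm (f : endo) v : f (ν v) = ν (f v).
Proof. by case: f => f /= /asboolP. Qed.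

Definition endo_pred (f : V -> V) : Prop :=
  linear f /\ forall v, f (ν v) = ν (f v).

Lemma linfunE_linear (f : V -> V) : linear f -> linfun f =1 f.
Proof.
move=> hf v.
pose lf := GRing.isLinear.Build k V V *:%R f hf.
pose g : {linear V -> V} := HB.pack f lf.
exact: (lfunE g v).
Qed.

Lemma endo_subproof (f : V -> V) : endo_pred f -> linfun f \in hom_endo.
Proof.
by move=> [hf hc]; apply/asboolP => v; rewrite !linfunE_linear.
Qed.

Definition endo_of (f : V -> V) (hf : endo_pred f) : endo :=
  Endo (endo_subproof hf).

Lemma endo_ofE (f : V -> V) (hf : endo_pred f) v : endo_of hf v = f v.
Proof. by rewrite /= linfunE_linear //; case: hf. Qed.

Lemma hinv_linear : linear νinv.
Proof.
case: (hyd_autom (hydP Y)) => _ K1 K2 a u v.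
by apply: (can_inj K1); rewrite hmap_linear !K2.
Qed.

Lemma endo_mul_subproof (f g : endo) : endo_pred (fun v => f (g v)).
Proof. by split=> [a u v|v]; rewrite ?linearP // !endo_comm. Qed.
Definition endo_mul (f g : endo) : endo := endo_of (endo_mul_subproof f g).

Lemma endo_map_subproof (f : endo) : endo_pred (fun v => f (ν (ν v))).
Proof. by split=> [a u v|v]; rewrite ?linearP // !endo_comm. Qed.
Definition endo_map (f : endo) : endo := endo_of (endo_map_subproof f).

Lemma endo_inv_subproof (f : endo) : endo_pred (fun v => f (νinv (νinv v))).
Proof.
case: (hyd_autom (hydP Y)) => _ K1 K2.
split=> [a u v|v]; first by rewrite !hinv_linear linearP.
by rewrite -endo_comm K1 K2.
Qed.
Definition endo_inv (f : endo) : endo := endo_of (endo_inv_subproof f).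

Lemma endo_act_subproof (h : H) (f : endo) : endo_pred
  (fun v => \sw_(h1, h2 <- comul H h) hact Y h1 (f (hact Y (antipode H h2) v))).
Proof.
have [actl _] := hyd_act_bilin (hydP Y).
split=> [|v].
  by apply: sweedler_param_linear => h1 h2 a u v; rewrite actl linearP actl.
rewrite (sweedler_map _ _ hmap_linear); apply: eq_sweedler => h1 h2.
by rewrite (hyd_act_map (hydP Y)) -endo_comm (hyd_act_map (hydP Y)).
Qed.
Definition endo_act (h : H) (f : endo) : endo := endo_of (endo_act_subproof h f).

(* The element f_(-1) ⊗ f_0 of H ⊗ End(V) determined by
   f_(-1) ⊗ f_0(v) = (f(v_0))_(-1) S^-1(v_(-1)) ⊗ (f(v_0))_0 for all v. *)
Definition endo_coact (Sinv : H -> H) (f : endo) : tensor H endo :=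
  the 0 (fun t : tensor H endo => forall v : V,
    \sw_(a, g <- t) (a ⊗ g v) =
    \sw_(a, v0 <- hcoact Y v) \sw_(b, w <- hcoact Y (f v0)) ((b * Sinv a) ⊗ w)).

Definition endo_hyd (Sinv : H -> H) : hydData H endo := {|
  hmap := endo_map;
  hinv := endo_inv;
  hact := endo_act;
  hcoact := endo_coact Sinv
|}.

Definition endo_br (Sinv : H -> H) (f g : endo) : endo :=
  endo_mul f g
  - \sw_(a, f0 <- endo_coact Sinv f) endo_mul (endo_act a (endo_inv g)) (endo_map f0).

Definition endo_lie (Sinv : H -> H) : lieData H :=
  LieData (endo_hyd Sinv) (endo_br Sinv).

End HomEndomorphisms.

Section Biproduct.
Variables (k : fieldType) (H : hopfAlg k) (B : lmodType k) (D : hydData H B).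
Variables (mul : B -> B -> B) (one : B) (Delta : B -> tensor B B).
Variables (eps : B -> k) (S : B -> B).

Definition bi_map (x : tensor B H) : tensor B H :=
  \sw_(f, h <- x) (hmap D f ⊗ h).
Definition bi_inv (x : tensor B H) : tensor B H :=
  \sw_(f, h <- x) (hinv D f ⊗ h).

Definition bi_mul (x y : tensor B H) : tensor B H :=
  \sw_(f, h <- x) \sw_(f', h' <- y) \sw_(h1, h2 <- comul H h)
    (mul f (hact D h1 (hinv D f')) ⊗ (h2 * h')).

Definition bi_one : tensor B H := one ⊗ 1.

Definition bi_comul (x : tensor B H) : tensor (tensor B H) (tensor B H) :=
  \sw_(f, h <- x) \sw_(f1, f2 <- Delta f) \sw_(a, f20 <- hcoact D f2)
  \sw_(h1, h2 <- comul H h) ((f1 ⊗ (a * h1)) ⊗ (hmap D f20 ⊗ h2)).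

Definition bi_counit (x : tensor B H) : k :=
  sweedler x (fun f h => eps f * counit H h : k^o).

Definition bi_antipode (x : tensor B H) : tensor B H :=
  \sw_(f, h <- x) \sw_(a, f0 <- hcoact D f)
    bi_mul (one ⊗ antipode H (a * h)) (S f0 ⊗ 1).

Definition is_biproduct_hom_hopf : Prop :=
  is_hom_hopf bi_map bi_inv bi_mul bi_one bi_comul bi_counit bi_antipode.

End Biproduct.

(* Main.v *)
Require Import Defs.
From mathcomp Require Import all_boot all_order all_algebra.
From mathcomp Require Import boolp ring.

Set Implicit Arguments.
Unset Strict Implicit.
Unset Printing Implicit Defensive.

Import GRing.Theory.
Local Open Scope ring_scope.

(* Since ν is an involution, δ(f) = f(ν^2(-)) = f, so End(V), T(L) and U(L) are
   ordinary (untwisted) Yetter-Drinfeld modules, and h * v := h . ν(v) with the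
   coaction v_(-1) ⊗ ν(v_0) makes V itself an ordinary one. Evaluation on V carries
   the symmetry of the braiding from (V, V) to (End(V), V), and applying the same
   argument to (V, End(V)) gives it on L = End(V).
   The ideal of relations is then spanned by the elements a r b, with r a defining
   relation. As U(L) is generated by L, its comultiplication, counit and antipode
   are determined by their behaviour under left multiplication by x in L,
     Δ(x u) = x u_1 ⊗ u_2 + x_(-1).u_1 ⊗ x_0 u_2,  ε(x u) = 0,
     S(x u) = - (x_(-1).S(u)) x_0;
   these operators satisfy the relations of U(L) because the braiding of L is
   symmetric, and every axiom follows by induction on u. The biproduct with H is
   Radford's: each axiom reduces to an identity between iterated Sweedler sums. *)

(** * Linear maps and Sweedler sums *)

(** A Sweedler sum ranges over a chosen expression of a tensor, so an identity between tensors can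
    be used under a sum only after the summand is known to be multilinear. This obligation
    accompanies nearly every step: it is why coassociativity and its relatives are restated for an
    arbitrary bilinear or trilinear [F], why linearity is found by search ([lin]), and why
    identities are settled by normalizing both sides ([swn], [sw_match]). Two objects are given only
    by a choice, the coaction of End(V) and the Hopf maps of U(L), so their existence has to be
    proved. For the coaction, finite dimension supplies a basis of V, but the elementary operators
    on it need not commute with ν, and a projection repairs this. For U(L), maps are built from
    operators attached to letters, so that the braided square of U(L) is never set up as an algebra.
    Beyond the bracket relation, these operators require C^2 = id on L ⊗ L: it exchanges the mixed
    terms of two letters in the coproduct and restores their order in the antipode. *)

Definition lin (k : fieldType) (M N : lmodType k) (f : M -> N) : Prop := linear f.
Definition bilin (k : fieldType) (M N P : lmodType k) (F : M -> N -> P) :=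
  (forall m, lin (F m)) /\ (forall n, lin (F^~ n)).
Definition trilin (k : fieldType) (M N Q P : lmodType k) (F : M -> N -> Q -> P) :=
  [/\ forall b c, lin (fun a => F a b c), forall a c, lin (fun b => F a b c)
    & forall a b, lin (F a b)].

Section Lin.
Variable k : fieldType.
Implicit Types (M N P Q R : lmodType k) (A : algType k).

Lemma lin_ext M N (f g : M -> N) : f =1 g -> lin g -> lin f.
Proof. by move=> h lg a x y; rewrite !h lg. Qed.

Lemma lin_add M N (f : M -> N) : lin f -> {morph f : x y / x + y}.
Proof. by move=> lf x y; have := lf 1 x y; rewrite !scale1r. Qed.
Lemma lin_0 M N (f : M -> N) : lin f -> f 0 = 0.
Proof. by move=> lf; apply: (addrI (f 0)); rewrite -(lin_add lf) !addr0. Qed.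
Lemma lin_Z M N (f : M -> N) a : lin f -> {morph f : x / a *: x}.
Proof. by move=> lf x; have := lf a x 0; rewrite (lin_0 lf) !addr0. Qed.
Lemma lin_N M N (f : M -> N) : lin f -> {morph f : x / - x}.
Proof. by move=> lf x; rewrite -scaleN1r (lin_Z _ lf) scaleN1r. Qed.
Lemma lin_B M N (f : M -> N) : lin f -> {morph f : x y / x - y}.
Proof. by move=> lf x y; rewrite lin_add // lin_N. Qed.
Lemma lin_sum M N (f : M -> N) (I : Type) (r : seq I) (E : I -> M) : lin f ->
  f (\sum_(i <- r) E i) = \sum_(i <- r) f (E i).
Proof.
by move=> lf; rewrite (big_morph f (lin_add lf) (lin_0 lf)).
Qed.

Lemma linI_id M : lin (fun x : M => x). Proof. by []. Qed.
Lemma linI_0 M N : lin (fun _ : M => 0 : N).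
Proof. by move=> a x y; rewrite scaler0 addr0. Qed.
Lemma linI_add M N (f g : M -> N) : lin f -> lin g -> lin (fun x => f x + g x).
Proof. by move=> lf lg a x y; rewrite lf lg scalerDr addrACA. Qed.
Lemma linI_opp M N (f : M -> N) : lin f -> lin (fun x => - f x).
Proof. by move=> lf a x y; rewrite lf opprD scalerN. Qed.
Lemma linI_scale M N (f : M -> N) c : lin f -> lin (fun x => c *: f x).
Proof. by move=> lf a x y; rewrite lf scalerDr !scalerA mulrC. Qed.
Lemma linI_scalel M N (f : M -> k^o) (v : N) : lin f -> lin (fun x => f x *: v).
Proof. by move=> lf a x y; rewrite lf scalerDl scalerA. Qed.
Lemma linI_comp M N P (f : N -> P) (E : M -> N) :
  lin f -> lin E -> lin (fun x => f (E x)).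
Proof. by move=> lf lE a x y; rewrite lE lf. Qed.
Lemma linI_bil M N P Q (F : N -> P -> Q) (E : M -> N) c :
  bilin F -> lin E -> lin (fun x => F (E x) c).
Proof. by move=> bF lE a x y; rewrite lE bF.2. Qed.
Lemma linI_bir M N P Q (F : P -> N -> Q) (E : M -> N) c :
  bilin F -> lin E -> lin (fun x => F c (E x)).
Proof. by move=> bF lE a x y; rewrite lE bF.1. Qed.
Lemma linI_tri1 M N P Q R (F : N -> P -> Q -> R) (E : M -> N) c d :
  trilin F -> lin E -> lin (fun x => F (E x) c d).
Proof. by case=> h _ _ lE a x y; rewrite lE h. Qed.
Lemma linI_tri2 M N P Q R (F : P -> N -> Q -> R) (E : M -> N) c d :
  trilin F -> lin E -> lin (fun x => F c (E x) d).
Proof. by case=> _ h _ lE a x y; rewrite lE h. Qed.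
Lemma linI_tri3 M N P Q R (F : P -> Q -> N -> R) (E : M -> N) c d :
  trilin F -> lin E -> lin (fun x => F c d (E x)).
Proof. by case=> _ _ h lE a x y; rewrite lE h. Qed.
Lemma linI_app M N P (f : {linear N -> P}) (E : M -> N) :
  lin E -> lin (fun x => f (E x)).
Proof. by move=> lE a x y; rewrite lE linearP. Qed.
Lemma linI_scalar M N (f : {scalar N}) (E : M -> N) :
  lin E -> @lin k M k^o (fun x => f (E x)).
Proof. by move=> lE a x y; rewrite lE linearP. Qed.
Lemma linI_mull M A (E : M -> A) c : lin E -> lin (fun x => E x * c).
Proof. by move=> lE a x y; rewrite lE mulrDl scalerAl. Qed.
Lemma linI_mulr M A (E : M -> A) c : lin E -> lin (fun x => c * E x).
Proof. by move=> lE a x y; rewrite lE mulrDr scalerAr. Qed.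
Lemma linI_tnsl M N P (E : M -> N) (c : P) : lin E -> lin (fun x => E x ⊗ c).
Proof. by move=> lE a x y; rewrite lE (tns_bilinear _ _).2. Qed.
Lemma linI_tnsr M N P (E : M -> N) (c : P) : lin E -> lin (fun x => c ⊗ E x).
Proof. by move=> lE a x y; rewrite lE (tns_bilinear _ _).1. Qed.
Lemma linI_sw M N P Q (t : tensor N P) (F : M -> N -> P -> Q) :
  (forall a b, lin (fun x => F x a b)) -> lin (fun x => sweedler t (F x)).
Proof. exact: sweedler_param_linear. Qed.
Lemma linI_sweedler M N P Q (T : M -> tensor N P) (F : N -> P -> Q) :
  lin T -> bilin F -> lin (fun x => sweedler (T x) F).
Proof. by move=> lT bF a x y; rewrite lT sweedler_linear. Qed.

End Lin.

(** * Automatic proofs of linearity *)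

Ltac lin_db := fail.
(** A pattern variable such as [?c] matches only terms free of the bound variable, whereas [_] is
    unrestricted; each clause thereby detects which argument carries the dependence. [lin_db] is the
    hook through which later sections add their own maps. *)
Ltac lin1 := match goal with
  | |- bilin _ => assumption
  | |- trilin _ => assumption
  | |- bilin _ => split; intros; cbv beta
  | |- trilin _ => split; intros; cbv beta
  | |- forall _, _ => intro; cbv beta
  | |- lin (fun z_ => z_) => apply linI_id
  | |- lin _ => assumption
  | |- lin (fun z_ => 0) => apply linI_0
  | |- lin (fun z_ => _ + _) => apply linI_add
  | |- lin (fun z_ => - _) => apply linI_opp
  | |- lin (fun z_ => ?c *: _) => apply linI_scale
  | |- lin (fun z_ => _ *: ?v) => apply linI_scalel
  | |- lin (fun z_ => ?c * _) => apply linI_mulr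
  | |- lin (fun z_ => _ * ?c) => apply linI_mull
  | |- lin (fun z_ => ?c ⊗ _) => apply linI_tnsr
  | |- lin (fun z_ => _ ⊗ ?c) => apply linI_tnsl
  | |- lin (fun z_ => sweedler ?t _) => apply linI_sw
  | |- lin (fun z_ => sweedler _ ?F) => apply linI_sweedler
  | |- lin (fun z_ => GRing.Linear.sort _ _) => first [ apply linI_app | apply linI_scalar ]
  | |- lin (fun z_ => _) => lin_db
  | h : lin ?f |- lin (fun z_ => ?f _) => apply (linI_comp h)
  | h : bilin ?f |- lin (fun z_ => ?f _ ?c) => apply (linI_bil c h)
  | h : bilin ?f |- lin (fun z_ => ?f ?c _) => apply (linI_bir c h)
  | h : trilin ?f |- lin (fun z_ => ?f _ ?c ?d) => apply (linI_tri1 c d h)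
  | h : trilin ?f |- lin (fun z_ => ?f ?c _ ?d) => apply (linI_tri2 c d h)
  | h : trilin ?f |- lin (fun z_ => ?f ?c ?d _) => apply (linI_tri3 c d h)
  | |- @lin ?k ?M ?N ?f =>
      lazymatch f with fun x => _ => fail | _ => change (@lin k M N (fun x => f x)) end
  end.
Ltac lin := solve [repeat lin1].

Section Sweedler.
Variable k : fieldType.
Implicit Types (M N P Q R S T : lmodType k).

Lemma eq_sw M N P (t : tensor M N) (F G : M -> N -> P) :
  (forall a b, F a b = G a b) -> sweedler t F = sweedler t G.
Proof. exact: eq_sweedler. Qed.

Lemma sw_tns M N P (F : M -> N -> P) m n : bilin F -> sweedler (m ⊗ n) F = F m n.
Proof. by move=> bF; rewrite sweedler_tns. Qed.

Lemma sw_map M N P Q (t : tensor M N) (F : M -> N -> P) (f : P -> Q) :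
  lin f -> f (sweedler t F) = \sw_(a, b <- t) f (F a b).
Proof. exact: sweedler_map. Qed.

Lemma sw_bind M N P Q R (t : tensor M N) (G : M -> N -> tensor P Q)
    (F : P -> Q -> R) : bilin F ->
  sweedler (sweedler t G) F = \sw_(a, b <- t) sweedler (G a b) F.
Proof. by move=> bF; rewrite (sw_map t G (f := fun t => sweedler t F)) //; lin. Qed.

(** No linearity is involved: once both expressions are chosen, the two sides are the same finite
    double sum. *)
Lemma sw_swap M N P Q R (s : tensor M N) (t : tensor P Q)
    (F : M -> N -> P -> Q -> R) :
  (\sw_(a, b <- s) \sw_(c, d <- t) F a b c d) =
  \sw_(c, d <- t) \sw_(a, b <- s) F a b c d.
Proof.
rewrite /sweedler /pfold /fsum.
under eq_bigr do rewrite scaler_sumr.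
rewrite exchange_big; apply: eq_bigr => q _ /=; rewrite scaler_sumr.
by apply: eq_bigr => p _; rewrite !scalerA mulrC.
Qed.

Lemma sw_addl M N P (s t : tensor M N) (F : M -> N -> P) :
  bilin F -> sweedler (s + t) F = sweedler s F + sweedler t F.
Proof. by move=> bF; rewrite (lin_add (f := fun t => sweedler t F)) //; lin. Qed.
Lemma sw_oppl M N P (t : tensor M N) (F : M -> N -> P) :
  bilin F -> sweedler (- t) F = - sweedler t F.
Proof. by move=> bF; rewrite (lin_N (f := fun t => sweedler t F)) //; lin. Qed.
Lemma sw_scalel M N P c (t : tensor M N) (F : M -> N -> P) :
  bilin F -> sweedler (c *: t) F = c *: sweedler t F.
Proof. by move=> bF; rewrite (lin_Z _ (f := fun t => sweedler t F)) //; lin. Qed.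

Lemma sw_add M N P (t : tensor M N) (F G : M -> N -> P) :
  \sw_(a, b <- t) (F a b + G a b) = sweedler t F + sweedler t G.
Proof.
rewrite /sweedler /pfold /fsum -big_split; apply: eq_bigr => p _ /=.
by rewrite scalerDr.
Qed.
Lemma sw_opp M N P (t : tensor M N) (F : M -> N -> P) :
  \sw_(a, b <- t) (- F a b) = - sweedler t F.
Proof. by rewrite (sw_map t F (f := -%R)) //; lin. Qed.
Lemma sw_scale M N P c (t : tensor M N) (F : M -> N -> P) :
  \sw_(a, b <- t) (c *: F a b) = c *: sweedler t F.
Proof. by rewrite (sw_map t F (f := *:%R c)) //; lin. Qed.
Lemma sw_0 M N P (t : tensor M N) : \sw_(a, b <- t) (0 : P) = 0.
Proof. by rewrite /sweedler /pfold /fsum big1 // => p _; rewrite scaler0. Qed.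

Lemma tensor_ext M N P (f g : tensor M N -> P) : lin f -> lin g ->
  (forall a b, f (a ⊗ b) = g (a ⊗ b)) -> f =1 g.
Proof.
move=> lf lg E t; rewrite [t]tensor_tns !sw_map //.
by apply: eq_sw => a b; apply: E.
Qed.

(** Applied to both sides of an identity of threefold tensors, it yields the same identity under an
    arbitrary trilinear [F]. *)
Definition ev3 M N Q P (F : M -> N -> Q -> P) (t : tensor M (tensor N Q)) : P :=
  \sw_(a, u <- t) \sw_(b, c <- u) F a b c.

Lemma lin_ev3 M N Q P (F : M -> N -> Q -> P) : trilin F -> lin (ev3 F).
Proof. by move=> tF; rewrite /ev3; lin. Qed.

Lemma ev3_tns M N Q P (F : M -> N -> Q -> P) a b c :
  trilin F -> ev3 F (a ⊗ (b ⊗ c)) = F a b c.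
Proof. by move=> tF; rewrite /ev3 !sw_tns //; lin. Qed.

(** The spaces and the maps [p], [q] are kept distinct so that one statement covers the coproducts
    of H and B, coactions, and induction hypotheses of coassociativity type. *)
Lemma sw_assoc M N Q R S P (t : tensor R Q) (p : R -> tensor M N)
    (s : tensor M S) (q : S -> tensor N Q) (F : M -> N -> Q -> P) :
  \sw_(a, c <- t) \sw_(a1, a2 <- p a) (a1 ⊗ (a2 ⊗ c)) =
  \sw_(a, b <- s) \sw_(b1, b2 <- q b) (a ⊗ (b1 ⊗ b2)) ->
  trilin F ->
  \sw_(a, c <- t) \sw_(a1, a2 <- p a) F a1 a2 c =
  \sw_(a, b <- s) \sw_(b1, b2 <- q b) F a b1 b2.
Proof.
move=> /(congr1 (ev3 F)) + tF; have lF := lin_ev3 tF; rewrite !(sw_map _ _ lF).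
under eq_sw do rewrite (sw_map _ _ lF); under [RHS]eq_sw do rewrite (sw_map _ _ lF).
under eq_sw do under eq_sw do rewrite (ev3_tns _ _ _ tF).
by under [RHS]eq_sw do under eq_sw do rewrite (ev3_tns _ _ _ tF).
Qed.

Lemma sw_codiag M N Q R S M1 M2 T P (t : tensor M R) (p : R -> tensor N Q)
    (s : tensor S T) (f : S -> tensor M1 N) (g : T -> tensor M2 Q)
    (m : M1 -> M2 -> M) (F : M -> N -> Q -> P) :
  \sw_(x, c <- t) (x ⊗ p c) =
  \sw_(c1, c2 <- s) \sw_(x, b <- f c1) \sw_(y, d <- g c2) (m x y ⊗ (b ⊗ d)) ->
  trilin F ->
  \sw_(x, c <- t) \sw_(b, d <- p c) F x b d =
  \sw_(c1, c2 <- s) \sw_(x, b <- f c1) \sw_(y, d <- g c2) F (m x y) b d.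
Proof.
move=> /(congr1 (ev3 F)) + tF; have lF := lin_ev3 tF; rewrite !(sw_map _ _ lF).
under [in RHS]eq_sw do rewrite (sw_map _ _ lF).
under [in RHS]eq_sw do under eq_sw do rewrite (sw_map _ _ lF).
under [in RHS]eq_sw do under eq_sw do under eq_sw do rewrite (ev3_tns _ _ _ tF).
by move=> <-; apply: eq_sw => x c; rewrite /ev3 sw_tns //; lin.
Qed.

End Sweedler.

Lemma eq_left (A B C : Type) (f : A -> B -> C) y x x' : x = x' -> f x y = f x' y.
Proof. by move->. Qed.
Lemma eq_right (A B C : Type) (f : A -> B -> C) x y y' : y = y' -> f x y = f x y'.
Proof. by move->. Qed.

(* [sw tac] rewrites the left-hand side with [tac], which solves a goal
   [X = ?Y], at the outermost possible position under sums. *)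
Ltac sw_at tac :=
  first [ etransitivity; [ solve [tac] | cbv beta; reflexivity ]
        | lazymatch goal with
          | |- sweedler _ _ = _ => apply eq_sw; intros; cbv beta; sw_at tac
          | |- @GRing.add ?V ?x ?y = _ =>
              first [ apply (eq_left (@GRing.add V) y); sw_at tac
                    | apply (eq_right (@GRing.add V) x); sw_at tac ]
          | |- @GRing.opp ?V _ = _ => apply (f_equal (@GRing.opp V)); sw_at tac
          | |- @GRing.scale ?R ?V ?c _ = _ =>
              apply (eq_right (@GRing.scale R V) c); sw_at tac
          end ].
Tactic Notation "sw" tactic3(tac) := etransitivity; [ sw_at tac | cbv beta ].
Tactic Notation "swr" tactic3(tac) :=
  symmetry; etransitivity; [ sw_at tac | symmetry; cbv beta ].
Ltac use E := idtac; rewrite E; reflexivity.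

Ltac leaf_only tac :=
  idtac; lazymatch goal with |- sweedler _ _ = _ => fail | |- _ => tac end.

(* Brings to the front the first sum recognized by [m]. *)
Ltac bring_by m :=
  first [ m; reflexivity
        | lazymatch goal with |- sweedler _ _ = _ =>
            etransitivity; [ apply eq_sw; intros; cbv beta; bring_by m | apply sw_swap ]
          end ].
Ltac comul_of a := idtac;
  lazymatch goal with
  | |- @sweedler _ _ _ _ (@GRing.Linear.sort _ _ _ _ (comul _) a) _ = _ => idtac
  end.
Ltac sum_of t := idtac; lazymatch goal with |- sweedler t _ = _ => idtac end.

(* Closes equalities of sums that differ by the order of summation. *)
Ltac sw_match :=
  first [ reflexivity
        | lazymatch goal with
          | |- sweedler ?t _ = _ =>
             etransitivity;
               [| symmetry; bring_by ltac:(sum_of t)]; apply eq_sw; intros; cbv beta;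
               sw_match
          | |- @GRing.add ?V _ _ = @GRing.add _ _ _ =>
             apply (f_equal2 (@GRing.add V)); sw_match
          | |- @GRing.opp ?V _ = @GRing.opp _ _ =>
             apply (f_equal (@GRing.opp V)); sw_match
          | |- _ => idtac end ].

(* Makes the outermost sum innermost, then applies [tac] to it. *)
Ltac push_in tac :=
  first
  [ lazymatch goal with |- sweedler _ (fun a b => sweedler _ _) = _ =>
      etransitivity; [ apply sw_swap | apply eq_sw; intros; cbv beta; push_in tac ] end
  | etransitivity; [ tac | cbv beta; reflexivity ] ].

(** Finds the function in goals such as [G a b = ?F (antipode H a * b)]. The unknown was created
    before [a] and [b] were introduced, so unification fails precisely when one of them survives
    outside the abstracted product, that is, when the pair does not cancel. *)
Ltac abstract_term X :=
  lazymatch goal with |- ?l = ?f _ =>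
    let l' := eval pattern X in l in
    lazymatch l' with ?f' _ => unify f f'; reflexivity end
  end.

(** * Sweedler calculus in a Hopf algebra *)

Section HopfSweedler.
Variables (k : fieldType) (H : hopfAlg k).
Implicit Types (M N P Q : lmodType k) (h g : H).

Lemma sw_comulA P (F : H -> H -> H -> P) h : trilin F ->
  \sw_(a, b <- comul H h) \sw_(a1, a2 <- comul H a) F a1 a2 b =
  \sw_(a, b <- comul H h) \sw_(b1, b2 <- comul H b) F a b1 b2.
Proof. exact: sw_assoc (comulA h). Qed.

Lemma sw_counitl P (F : H -> P) h : lin F ->
  \sw_(a, b <- comul H h) (counit H a *: F b) = F h.
Proof.
move=> lF; rewrite -[in RHS](counitl h) (sw_map _ _ lF).
by apply: eq_sw => a b; rewrite (lin_Z _ lF).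
Qed.

Lemma sw_counitr P (F : H -> P) h : lin F ->
  \sw_(a, b <- comul H h) (counit H b *: F a) = F h.
Proof.
move=> lF; rewrite -[in RHS](counitr h) (sw_map _ _ lF).
by apply: eq_sw => a b; rewrite (lin_Z _ lF).
Qed.

Lemma sw_comul1 P (F : H -> H -> P) : bilin F ->
  \sw_(a, b <- comul H 1) F a b = F 1 1.
Proof. by move=> bF; rewrite comul1 sw_tns. Qed.

Lemma sw_comulM P (F : H -> H -> P) g h : bilin F ->
  \sw_(a, b <- comul H (g * h)) F a b =
  \sw_(g1, g2 <- comul H g) \sw_(h1, h2 <- comul H h) F (g1 * h1) (g2 * h2).
Proof.
move=> bF; rewrite comulM sw_bind //; apply: eq_sw => g1 g2.
by rewrite sw_bind //; apply: eq_sw => h1 h2; rewrite sw_tns.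
Qed.

Lemma sw_antipodel P (F : H -> P) h : lin F ->
  \sw_(a, b <- comul H h) F (antipode H a * b) = counit H h *: F 1.
Proof. by move=> lF; rewrite -(lin_Z _ lF) -antipodel (sw_map _ _ lF). Qed.

Lemma sw_antipoder P (F : H -> P) h : lin F ->
  \sw_(a, b <- comul H h) F (a * antipode H b) = counit H h *: F 1.
Proof. by move=> lF; rewrite -(lin_Z _ lF) -antipoder (sw_map _ _ lF). Qed.

(** Stating the shape of the summand as a premise lets [abstract_term] infer [F]. The variants with
    a parameter [r] serve right-associated products, where the cancelling pair is followed by a
    tail. *)
Lemma antipodel_by P (G : H -> H -> P) (F : H -> P) h :
  (forall a b, G a b = F (antipode H a * b)) -> lin F ->
  sweedler (comul H h) G = counit H h *: F 1.
Proof. by move=> E lF; rewrite -sw_antipodel //; apply: eq_sw. Qed.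
Lemma antipodelr_by P (G : H -> H -> P) (F : H -> P) r h :
  (forall a b, G a b = F (antipode H a * (b * r))) -> lin F ->
  sweedler (comul H h) G = counit H h *: F r.
Proof.
move=> E lF; rewrite -[in RHS](mul1r r) -(sw_antipodel (F := fun z => F (z * r))).
  by apply: eq_sw => a b; rewrite E mulrA.
by lin.
Qed.
Lemma antipoder_by P (G : H -> H -> P) (F : H -> P) h :
  (forall a b, G a b = F (a * antipode H b)) -> lin F ->
  sweedler (comul H h) G = counit H h *: F 1.
Proof. by move=> E lF; rewrite -sw_antipoder //; apply: eq_sw. Qed.
Lemma antipoderr_by P (G : H -> H -> P) (F : H -> P) r h :
  (forall a b, G a b = F (a * (antipode H b * r))) -> lin F ->
  sweedler (comul H h) G = counit H h *: F r.
Proof.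
move=> E lF; rewrite -[in RHS](mul1r r) -(sw_antipoder (F := fun z => F (z * r))).
  by apply: eq_sw => a b; rewrite E mulrA.
by lin.
Qed.
Lemma counitl_by P (G : H -> H -> P) (F : H -> P) h :
  (forall a b, G a b = counit H a *: F b) -> lin F ->
  sweedler (comul H h) G = F h.
Proof. by move=> E lF; rewrite -sw_counitl //; apply: eq_sw. Qed.
Lemma counitr_by P (G : H -> H -> P) (F : H -> P) h :
  (forall a b, G a b = counit H b *: F a) -> lin F ->
  sweedler (comul H h) G = F h.
Proof. by move=> E lF; rewrite -sw_counitr //; apply: eq_sw. Qed.

Lemma scaler_swap M a b (x : M) : a *: (b *: x) = b *: (a *: x).
Proof. by rewrite !scalerA mulrC. Qed.
End HopfSweedler.

Ltac comul_sum := lazymatch goal with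
  |- @sweedler _ _ _ _ (@GRing.Linear.sort _ _ _ _ (comul _) _) _ = _ => idtac end.

(** Iterated coproducts are oriented to right combs: the sum over the coproduct of a first leg is
    moved next to its parent and replaced by one over the second leg. *)
Ltac coassoc := idtac; comul_sum;
    etransitivity;
      [ apply eq_sw; let a := fresh "a" in let b := fresh "b" in
        intros a b; cbv beta; bring_by ltac:(comul_of a)
      | apply sw_comulA; lin ].

Ltac sinv_pairs := fail.
Ltac antip_pairs := first
  [ eapply antipodelr_by; [
      let a := fresh "a" in let b := fresh "b" in intros a b; cbv beta; rewrite -?mulrA;
      match goal with |- context
        [@GRing.mul ?R (@GRing.Linear.sort ?a1 ?a2 ?a3 ?a4 (antipode ?H) a)
          (@GRing.mul ?R2 b ?r)] =>
        abstract_term (@GRing.mul R (@GRing.Linear.sort a1 a2 a3 a4 (antipode H) a)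
          (@GRing.mul R2 b r)) end | lin ]
  | eapply antipodel_by; [
      let a := fresh "a" in let b := fresh "b" in intros a b; cbv beta; rewrite -?mulrA;
      match goal with |- context
        [@GRing.mul ?R (@GRing.Linear.sort ?a1 ?a2 ?a3 ?a4 (antipode ?H) a) b] =>
        abstract_term (@GRing.mul R (@GRing.Linear.sort a1 a2 a3 a4 (antipode H) a) b) end | lin ]
  | eapply antipoderr_by; [
      let a := fresh "a" in let b := fresh "b" in intros a b; cbv beta; rewrite -?mulrA;
      match goal with |- context
        [@GRing.mul ?R a
          (@GRing.mul ?R2 (@GRing.Linear.sort ?a1 ?a2 ?a3 ?a4 (antipode ?H) b) ?r)] =>
        abstract_term (@GRing.mul R a
          (@GRing.mul R2 (@GRing.Linear.sort a1 a2 a3 a4 (antipode H) b) r)) end | lin ]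
  | eapply antipoder_by; [
      let a := fresh "a" in let b := fresh "b" in intros a b; cbv beta; rewrite -?mulrA;
      match goal with |- context
        [@GRing.mul ?R a (@GRing.Linear.sort ?a1 ?a2 ?a3 ?a4 (antipode ?H) b)] =>
        abstract_term (@GRing.mul R a (@GRing.Linear.sort a1 a2 a3 a4 (antipode H) b)) end | lin ] ].
Ltac antip_here := first [ antip_pairs | sinv_pairs ].
(* The second case regroups the first two factors of a threefold coproduct. *)
Ltac antip := idtac; comul_sum; first
  [ push_in antip_here
  | etransitivity;
      [ etransitivity;
        [ apply eq_sw; let a := fresh "a" in let b := fresh "b" in
          intros a b; cbv beta; bring_by ltac:(comul_of b)
        | symmetry; apply sw_comulA; lin ]
      | cbv beta; apply eq_sw; intros; cbv beta; push_in antip_here ] ].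

Ltac counit_here := first
  [ eapply counitl_by; [ intros; cbv beta; first [ reflexivity | apply scaler_swap ] | lin ]
  | eapply counitr_by;
      [ intros; cbv beta; first [ reflexivity | apply scaler_swap ] | lin ] ].
Ltac counit := idtac; comul_sum; push_in counit_here.

(* Moves a sum, a scalar or a sign out of a linear context. *)
Ltac pull := leaf_only ltac:(idtac;
  lazymatch goal with |- @GRing.add _ _ _ = _ => fail | |- _ => idtac end;
  match goal with
  | |- ?l = _ => match l with
     | context [@sweedler ?k ?M ?N ?P ?t ?F] =>
       lazymatch l with @GRing.opp _ _ => fail | @GRing.scale _ _ _ _ => fail | _ =>
       let l' := eval pattern (@sweedler k M N P t F) in l in
       lazymatch l' with ?f _ => refine (sw_map t F (f := f) _); lin end end
     | context [@GRing.scale ?R ?V ?c ?x] =>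
       lazymatch l with @GRing.scale _ _ _ _ => fail | _ =>
       let l' := eval pattern (@GRing.scale R V c x) in l in
       lazymatch l' with ?f _ => refine (lin_Z (f := f) c _ x); lin end end
     | context [@GRing.opp ?V ?x] =>
       lazymatch l with @GRing.opp _ _ => fail | @GRing.scale _ _ _ _ => fail | _ =>
       let l' := eval pattern (@GRing.opp V x) in l in
       lazymatch l' with ?f _ => refine (lin_N (f := f) _ x); lin end end
     | context [@GRing.add ?V ?x ?y] =>
       lazymatch l with @GRing.add _ x y => fail | _ =>
       let l' := eval pattern (@GRing.add V x y) in l in
       lazymatch l' with ?f _ => refine (lin_add (f := f) _ x y); lin end end
     end end).

Ltac sw_rules := fail.
Ltac sw_basic := idtac; lazymatch goal with
  | |- sweedler (_ ⊗ _) _ = _ => apply sw_tns; lin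
  | |- sweedler (sweedler _ _) _ = _ => apply sw_bind; lin
  | |- sweedler (_ + _) _ = _ => apply sw_addl; lin
  | |- sweedler (- _) _ = _ => apply sw_oppl; lin
  | |- sweedler (_ *: _) _ = _ => apply sw_scalel; lin
  | |- sweedler _ (fun a b => _ + _) = _ => apply sw_add
  | |- sweedler _ (fun a b => - _) = _ => apply sw_opp
  | |- @sweedler _ _ _ _ (@GRing.Linear.sort _ _ _ _ (comul _) (@GRing.mul _ _ _)) _ = _ =>
      apply sw_comulM; lin
  | |- @sweedler _ _ _ _ (@GRing.Linear.sort _ _ _ _ (comul _) (@GRing.one _)) _ = _ =>
      apply sw_comul1; lin
  | |- _ => sw_rules
  end.
Ltac leaf_rules := rewrite ?counitM ?counit1 ?scale1r ?mul1r ?mulr1 -?scalerA.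
Ltac leaf_rw := leaf_only ltac:(idtac; progress leaf_rules; reflexivity).
Ltac scale_out := idtac; lazymatch goal with
  |- sweedler _ (fun a b => _ *: _) = _ => apply sw_scale end.
Ltac swn := repeat (sw (first
  [ sw_basic | scale_out | leaf_rw | pull | coassoc | antip | counit ])).
Ltac swnr := symmetry; swn; symmetry.

(** * The antipode and its inverse *)

Section Antipode.
Variables (k : fieldType) (H : hopfAlg k).
Notation S := (antipode H).
Implicit Types P : lmodType k.

(** The sum S(g_1 h_1) g_2 h_2 S(h_3) S(g_3) is evaluated in two ways: expanding the coproduct of
    the product cancels g_2 h_2 against S(h_3) S(g_3), while leaving it unexpanded cancels S(g_1
    h_1) against g_2 h_2. *)
Lemma antipodeM (g h : H) : S (g * h) = S h * S g.
Proof.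
transitivity (
  \sw_(g', g3 <- comul H g) \sw_(h', h3 <- comul H h)
  \sw_(a, b <- comul H (g' * h')) (S a * (b * (S h3 * S g3)))).
  by swnr.
by sw antip; swn.
Qed.

Lemma antipode1 : S 1 = 1.
Proof.
have := antipodel (1 : H); rewrite counit1 scale1r sw_comul1; last by lin.
by rewrite mulr1.
Qed.

Lemma counit_antipode (h : H) : counit H (S h) = counit H h.
Proof.
have lF : @lin k H k^o (fun x => counit H (S x)) by lin.
have lF' : @lin k H k^o (fun x => counit H x) by lin.
transitivity (\sw_(a, b <- comul H h) (counit H (S a * b) : k^o)).
  rewrite -[LHS](sw_counitr h lF).
  by apply: (@eq_sw k H H k^o) => a b; rewrite counitM mulrC.
by rewrite (sw_antipodel h lF') counit1 [_ *: _]mulr1.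
Qed.

(** Same device as for [antipodeM], one level up: Δ(S(h_1) h_2) is multiplied by S(h_4) ⊗ S(h_3).
    Expanding it leaves Δ(S(h)), and collapsing S(h_1) h_2 first leaves S(h_2) ⊗ S(h_1). *)
Lemma sw_comulS P (F : H -> H -> P) h : bilin F ->
  \sw_(a, b <- comul H (S h)) F a b = \sw_(a, b <- comul H h) F (S b) (S a).
Proof.
move=> bF.
transitivity (
  \sw_(a, b <- comul H h) \sw_(a1, a2 <- comul H a) \sw_(b1, b2 <- comul H b)
  \sw_(p, q <- comul H (S a1 * a2)) F (p * S b2) (q * S b1)).
  by symmetry; sw sw_basic; swn.
by sw antip; swn.
Qed.

Variables (Sinv : H -> H) (SK : cancel S Sinv) (SinvK : cancel Sinv S).

Lemma lin_Sinv : lin Sinv.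
Proof. by move=> a x y; apply: (can_inj SK); rewrite linearP !SinvK. Qed.

Lemma SinvM (g h : H) : Sinv (g * h) = Sinv h * Sinv g.
Proof. by apply: (can_inj SK); rewrite antipodeM !SinvK. Qed.

Lemma Sinv1 : Sinv 1 = 1.
Proof. by rewrite -{1}antipode1 SK. Qed.

Lemma counit_Sinv (h : H) : counit H (Sinv h) = counit H h.
Proof. by rewrite -[in RHS](SinvK h) counit_antipode. Qed.

Lemma sw_comulSinv P (F : H -> H -> P) h : bilin F ->
  \sw_(a, b <- comul H (Sinv h)) F a b = \sw_(a, b <- comul H h) F (Sinv b) (Sinv a).
Proof.
move=> bF; rewrite -[in RHS](SinvK h) sw_comulS.
  by apply: eq_sw => a b; rewrite !SK.
by have lS := lin_Sinv; lin.
Qed.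

(** Writing h = S(S^-1(h)), and using that S reverses coproducts, turns this into the antipode axiom
    for S^-1(h); hence the reversed legs. *)
Lemma sw_Sinvl P (F : H -> P) h : lin F ->
  \sw_(a, b <- comul H h) F (Sinv b * a) = counit H h *: F 1.
Proof.
move=> lF; have lS := lin_Sinv.
rewrite -{1}(SinvK h) -counit_Sinv sw_comulS; last by lin.
by rewrite -sw_antipoder //; apply: eq_sw => a b; rewrite !SK.
Qed.

Lemma sw_Sinvr P (F : H -> P) h : lin F ->
  \sw_(a, b <- comul H h) F (b * Sinv a) = counit H h *: F 1.
Proof.
move=> lF; have lS := lin_Sinv.
rewrite -{1}(SinvK h) -counit_Sinv sw_comulS; last by lin.
by rewrite -sw_antipodel //; apply: eq_sw => a b; rewrite !SK.
Qed.

Lemma Sinvl_by P (G : H -> H -> P) (F : H -> P) h :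
  (forall a b, G a b = F (Sinv b * a)) -> lin F ->
  sweedler (comul H h) G = counit H h *: F 1.
Proof. by move=> E lF; rewrite -sw_Sinvl //; apply: eq_sw. Qed.
Lemma Sinvlr_by P (G : H -> H -> P) (F : H -> P) r h :
  (forall a b, G a b = F (Sinv b * (a * r))) -> lin F ->
  sweedler (comul H h) G = counit H h *: F r.
Proof.
move=> E lF; rewrite -[in RHS](mul1r r) -(sw_Sinvl (F := fun z => F (z * r))).
  by apply: eq_sw => a b; rewrite E mulrA.
by lin.
Qed.
Lemma Sinvr_by P (G : H -> H -> P) (F : H -> P) h :
  (forall a b, G a b = F (b * Sinv a)) -> lin F ->
  sweedler (comul H h) G = counit H h *: F 1.
Proof. by move=> E lF; rewrite -sw_Sinvr //; apply: eq_sw. Qed.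
Lemma Sinvrr_by P (G : H -> H -> P) (F : H -> P) r h :
  (forall a b, G a b = F (b * (Sinv a * r))) -> lin F ->
  sweedler (comul H h) G = counit H h *: F r.
Proof.
move=> E lF; rewrite -[in RHS](mul1r r) -(sw_Sinvr (F := fun z => F (z * r))).
  by apply: eq_sw => a b; rewrite E mulrA.
by lin.
Qed.

End Antipode.

Ltac sinv_here := lazymatch goal with
  SK : cancel (@GRing.Linear.sort _ _ _ _ (antipode _)) ?Sinv,
  SinvK : cancel ?Sinv (@GRing.Linear.sort _ _ _ _ (antipode _)) |- _ => first
  [ eapply (Sinvlr_by SK SinvK); [
      let a := fresh "a" in let b := fresh "b" in intros a b; cbv beta; rewrite -?mulrA;
      match goal with |- context [@GRing.mul ?R (Sinv b) (@GRing.mul ?R2 a ?r)] =>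
        abstract_term (@GRing.mul R (Sinv b) (@GRing.mul R2 a r)) end | lin ]
  | eapply (Sinvl_by SK SinvK); [
      let a := fresh "a" in let b := fresh "b" in intros a b; cbv beta; rewrite -?mulrA;
      match goal with |- context [@GRing.mul ?R (Sinv b) a] =>
        abstract_term (@GRing.mul R (Sinv b) a) end | lin ]
  | eapply (Sinvrr_by SK SinvK); [
      let a := fresh "a" in let b := fresh "b" in intros a b; cbv beta; rewrite -?mulrA;
      match goal with |- context [@GRing.mul ?R b (@GRing.mul ?R2 (Sinv a) ?r)] =>
        abstract_term (@GRing.mul R b (@GRing.mul R2 (Sinv a) r)) end | lin ]
  | eapply (Sinvr_by SK SinvK); [
      let a := fresh "a" in let b := fresh "b" in intros a b; cbv beta; rewrite -?mulrA;
      match goal with |- context [@GRing.mul ?R b (Sinv a)] =>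
        abstract_term (@GRing.mul R b (Sinv a)) end | lin ] ]
  end.
Ltac sinv_pairs ::= sinv_here.

Ltac leaf_rules ::= rewrite ?counitM ?counit1 ?antipodeM ?antipode1 ?counit_antipode
  ?scale1r ?scale0r ?add0r ?addr0 ?sw_0 ?mul1r ?mulr1 -?scalerA.
Ltac leaf_sinv := lazymatch goal with
  SK : cancel (@GRing.Linear.sort _ _ _ _ (antipode _)) ?Sinv,
  SinvK : cancel ?Sinv (@GRing.Linear.sort _ _ _ _ (antipode _)) |- _ =>
    progress rewrite ?(SinvM SK SinvK) ?(Sinv1 SK) ?(counit_Sinv SinvK) ?SK ?SinvK
  end.
Ltac leaf_hyp := fail.
Ltac leaf_rw ::= idtac; first [ progress leaf_rules | leaf_sinv | leaf_hyp ]; reflexivity.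
Ltac sw_comul_antipode := lazymatch goal with
  | |- @sweedler _ _ _ _ (@GRing.Linear.sort _ _ _ _ (comul _)
        (@GRing.Linear.sort _ _ _ _ (antipode _) _)) _ = _ => apply sw_comulS; lin
  | SK : cancel (@GRing.Linear.sort _ _ _ _ (antipode _)) ?Sinv,
    SinvK : cancel ?Sinv (@GRing.Linear.sort _ _ _ _ (antipode _)) |-
    @sweedler _ _ _ _ (@GRing.Linear.sort _ _ _ _ (comul _) (?Sinv _)) _ = _ =>
      apply (sw_comulSinv SK SinvK); lin
  end.

(** * Yetter-Drinfeld modules *)

Section YetterDrinfeld.
Variables (k : fieldType) (H : hopfAlg k).
Implicit Types (M N P Q : lmodType k) (h g : H).

(* Yetter-Drinfeld modules whose structure automorphism is the identity. *)
Record is_yd M (D : hydData H M) : Prop := IsYD {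
  yd_act_bilin : bilin (hact D);
  yd_actM : forall h g m, hact D h (hact D g m) = hact D (h * g) m;
  yd_act1 : forall m, hact D 1 m = m;
  yd_coact_lin : lin (hcoact D);
  yd_coassoc : forall m,
    \sw_(a, m0 <- hcoact D m) \sw_(a1, a2 <- comul H a) (a1 ⊗ (a2 ⊗ m0)) =
    \sw_(a, m0 <- hcoact D m) \sw_(b, m00 <- hcoact D m0) (a ⊗ (b ⊗ m00));
  yd_counit : forall m, \sw_(a, m0 <- hcoact D m) (counit H a *: m0) = m;
  yd_compat : forall h m, hcoact D (hact D h m) =
    \sw_(h1, h' <- comul H h) \sw_(h2, h3 <- comul H h')
    \sw_(a, m0 <- hcoact D m) ((h1 * a * antipode H h3) ⊗ hact D h2 m0)
}.

Lemma hyd_of_yd M (D : hydData H M) :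
  (forall m, hmap D m = m) -> (forall m, hinv D m = m) -> is_yd D -> is_hyd D.
Proof.
move=> E Ei [? aM a1 ? cA cc cmp]; split=> //.
- by split=> m //; rewrite ?E ?Ei // => x y; rewrite !E.
- by move=> h g m; rewrite E aM.
- by move=> m; rewrite E a1.
- by move=> h m; rewrite !E.
- move=> m; rewrite -cA; apply: eq_sw => a m0; apply: eq_sw => a1' a2.
  by rewrite Ei.
- by move=> m; rewrite E {1}[hcoact D m]tensor_tns; apply: eq_sw => a m0; rewrite E.
- by move=> m; rewrite cc Ei.
Qed.

Lemma yd_of_hyd M (D : hydData H M) :
  (forall m, hmap D m = m) -> is_hyd D -> is_yd D.
Proof.
move=> E hD; case: (hD) => -[_ K1 K2] ? aM a1 _ ? cA _ cc cmp.
have Ei m : hinv D m = m by rewrite -[in LHS](E m) K1.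
split=> //.
- by move=> h g m; rewrite aM E.
- by move=> m; rewrite a1 E.
- move=> m; rewrite -cA; apply: eq_sw => a m0; apply: eq_sw => a1' a2.
  by rewrite Ei.
- by move=> m; rewrite cc Ei.
Qed.

Variables (M : lmodType k) (D : hydData H M) (yD : is_yd D).
Notation ρ := (hcoact D).
Local Notation "h ▹ m" := (hact D h m) (at level 38, right associativity).

Lemma lin_actl N (E : N -> H) m : lin E -> lin (fun x => E x ▹ m).
Proof. exact/linI_bil/yd_act_bilin. Qed.
Lemma lin_actr N (E : N -> M) h : lin E -> lin (fun x => h ▹ E x).
Proof. exact/linI_bir/yd_act_bilin. Qed.
Lemma lin_coact N (E : N -> M) : lin E -> lin (fun x => ρ (E x)).
Proof. exact/linI_comp/yd_coact_lin. Qed.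

Lemma sw_coactA P (F : H -> H -> M -> P) m : trilin F ->
  \sw_(a, m0 <- ρ m) \sw_(a1, a2 <- comul H a) F a1 a2 m0 =
  \sw_(a, m0 <- ρ m) \sw_(b, m00 <- ρ m0) F a b m00.
Proof. exact: sw_assoc (yd_coassoc yD m). Qed.

Lemma coact_counit_by P (G : H -> M -> P) (F : M -> P) m :
  (forall a b, G a b = counit H a *: F b) -> lin F -> sweedler (ρ m) G = F m.
Proof.
move=> E lF; rewrite -[in RHS](yd_counit yD m) (sw_map _ _ lF).
by apply: eq_sw => a b; rewrite E (lin_Z _ lF).
Qed.

Lemma sw_coact_act P (F : H -> M -> P) h m : bilin F ->
  sweedler (ρ (h ▹ m)) F =
  \sw_(h1, h' <- comul H h) \sw_(h2, h3 <- comul H h')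
  \sw_(a, m0 <- ρ m) F (h1 * a * antipode H h3) (h2 ▹ m0).
Proof.
move=> bF; rewrite (yd_compat yD); do 3![rewrite sw_bind //; apply: eq_sw => ? ?].
by rewrite sw_tns.
Qed.

End YetterDrinfeld.

Ltac lin_db ::= match goal with
  | h : is_yd ?D |- lin (fun z_ => hact ?D _ ?m) => apply (lin_actl h m)
  | h : is_yd ?D |- lin (fun z_ => hact ?D ?m _) => apply (lin_actr h m)
  | h : is_yd ?D |- lin (fun z_ => hcoact ?D _) => apply (lin_coact h)
  end.

Ltac coact_of m := idtac;
  lazymatch goal with |- sweedler (hcoact _ m) _ = _ => idtac end.

(** The coproduct of a coaction leg is traded for an iterated coaction, which is the normal form
    from here on. *)
Ltac coassoc ::= idtac; first
  [ comul_sum;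
    etransitivity;
      [ apply eq_sw; let a := fresh "a" in let b := fresh "b" in
        intros a b; cbv beta; bring_by ltac:(comul_of a)
      | apply sw_comulA; lin ]
  | match goal with h : is_yd ?D |- sweedler (hcoact ?D _) _ = _ =>
    etransitivity;
      [ apply eq_sw; let a := fresh "a" in let b := fresh "b" in
        intros a b; cbv beta; bring_by ltac:(comul_of a)
      | apply (sw_coactA h); lin ] end ].

(** Coassociativity in the opposite direction: two successive coaction legs are refolded into the
    coproduct of a single leg, where a factor such as m_(-1) S^-1(m_(-2)) can cancel. *)
Ltac antip_coact := idtac;
  match goal with h : is_yd ?D |- sweedler (hcoact ?D _) _ = _ =>
    etransitivity;
      [ etransitivity;
        [ apply eq_sw; let a := fresh "a" in let b := fresh "b" in
          intros a b; cbv beta; bring_by ltac:(coact_of b)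
        | symmetry; apply (sw_coactA h); lin ]
      | cbv beta; apply eq_sw; intros; cbv beta; push_in antip_here ] end.

Ltac counit_coact_here := match goal with h : is_yd ?D |- sweedler (hcoact ?D _) _ = _ =>
  eapply (coact_counit_by h);
    [ intros; cbv beta; first [ reflexivity | apply scaler_swap ] | lin ] end.
Ltac counit_coact := idtac;
  lazymatch goal with |- sweedler (hcoact _ _) _ = _ => push_in counit_coact_here end.

Ltac sw_rules ::= match goal with
  | h : is_yd ?D |- sweedler (hcoact ?D (hact ?D _ _)) _ = _ =>
    apply (sw_coact_act h); lin
  end.
Ltac leaf_hyp ::= match goal with
  | h : is_yd _ |- _ => progress rewrite ?(yd_actM h) ?(yd_act1 h)
  end.
(** Cancellations are tried only when nothing simpler applies, because they search through
    regroupings of iterated coproducts and coactions. *)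
Ltac swn ::= repeat first
  [ sw (first [ sw_basic | sw_comul_antipode | scale_out | leaf_rw | pull ])
  | sw coassoc
  | sw (first [ antip | counit | antip_coact | counit_coact ]) ].

Ltac sw_solve := swn; swnr; sw_match; rewrite ?mulrA; try reflexivity.

Ltac tensor_ind a :=
  revert a;
  lazymatch goal with |- forall a, @?f a = @?g a =>
    apply (@tensor_ext _ _ _ _ f g); [ lin | lin | intros; cbv beta ] end.

(** * Symmetric braidings *)

Section Symmetric.
Variables (k : fieldType) (H : hopfAlg k) (Sinv : H -> H).
Hypothesis (SK : cancel (antipode H) Sinv) (SinvK : cancel Sinv (antipode H)).
Implicit Types (M N P Q : lmodType k) (h g : H).

(* The braiding of M and N agrees with the inverse of the braiding of N and M. *)
Definition braid_sym M N (D : hydData H M) (E : hydData H N) : Prop :=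
  forall m n, \sw_(a, m0 <- hcoact D m) (hact E a n ⊗ m0) =
              \sw_(b, n0 <- hcoact E n) (n0 ⊗ hact D (Sinv b) m).

Variables (M N : lmodType k) (D : hydData H M) (E : hydData H N).
Hypothesis (yD : is_yd D) (yE : is_yd E).

Lemma sw_sym P (F : N -> M -> P) m n : braid_sym D E -> bilin F ->
  \sw_(a, m0 <- hcoact D m) F (hact E a n) m0 =
  \sw_(b, n0 <- hcoact E n) F n0 (hact D (Sinv b) m).
Proof.
move=> sDE bF; have := congr1 (fun t => sweedler t F) (sDE m n).
rewrite !sw_bind // => sE; transitivity (
    \sw_(a, m0 <- hcoact D m) \sw_(u, v <- hact E a n ⊗ m0) F u v).
  by apply: eq_sw => a b; rewrite sw_tns.
by rewrite sE; apply: eq_sw => a b; rewrite sw_tns.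
Qed.

(** This is C_{N,M} C_{M,N} = id under [F]. Symmetry replaces the inner braiding by the inverse of
    the outer one, after which two successive legs of the coaction of n meet as n_(-1) S^-1(n_(-2))
    and cancel. *)
Lemma braid_sym_inv P (F : M -> N -> P) m n : braid_sym D E -> bilin F ->
  \sw_(a, m0 <- hcoact D m) \sw_(c, n0 <- hcoact E (hact E a n)) F (hact D c m0) n0
  = F m n.
Proof.
move=> sDE bF; have lS := lin_Sinv SK SinvK.
etransitivity.
  apply: (@sw_sym P (fun u v => \sw_(c, n0 <- hcoact E u) F (hact D c v) n0)) => //.
  by lin.
by swn.
Qed.

(** A one-sided inverse of the invertible braiding is two-sided. Concretely, m_(-1) S^-1(m_(-2)) is
    inserted as an action on n, and [braid_sym_inv] is applied to the pair formed by the remaining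
    part of m and S^-1(m_(-2)) . n. *)
Lemma braid_symC : braid_sym D E -> braid_sym E D.
Proof.
move=> sDE n m.
have lS := lin_Sinv SK SinvK.
transitivity (\sw_(b, n0 <- hcoact D m) \sw_(a, m0 <- hcoact D n0)
  \sw_(c, u <- hcoact E (hact E (a * Sinv b) n)) (hact D c m0 ⊗ u)).
  by symmetry; sw antip_coact; swn.
apply: eq_sw => b n0; rewrite -(braid_sym_inv (F := @tns k M N) _ _ sDE); last by lin.
by apply: eq_sw => a m0; rewrite (yd_actM yE).
Qed.
End Symmetric.

(** * The Radford biproduct *)

Section Biproduct.
Variables (k : fieldType) (H : hopfAlg k) (B : lmodType k) (D : hydData H B).
Variables (mul : B -> B -> B) (one : B) (Delta : B -> tensor B B).
Variables (eps : B -> k) (S : B -> B).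
Hypothesis hmap_id : forall b, hmap D b = b.
Hypothesis hinv_id : forall b, hinv D b = b.
Hypothesis hB : is_hyd_hopf D mul one Delta eps S.
Implicit Types (P : lmodType k) (a b : B) (h g : H).

Lemma hopf_yd : is_yd D. Proof. exact: yd_of_hyd (hh_hyd hB). Qed.
Let yD := hopf_yd.

Lemma bilin_mul : bilin mul. Proof. exact: homalg_bilin (hh_alg hB). Qed.
Lemma mul_assoc a b c : mul (mul a b) c = mul a (mul b c).
Proof. by have := homalg_assoc (hh_alg hB) a b c; rewrite !hmap_id. Qed.
Lemma mul_oner a : mul a one = a.
Proof. by rewrite (homalg_mulr1 (hh_alg hB)) hmap_id. Qed.
Lemma mul_onel a : mul one a = a.
Proof. by rewrite (homalg_mul1r (hh_alg hB)) hmap_id. Qed.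

Lemma lin_Delta : lin Delta. Proof. exact: homcoalg_lin (hh_coalg hB). Qed.
Lemma lin_eps : @lin k B k^o eps. Proof. exact: homcoalg_eps_lin (hh_coalg hB). Qed.
Lemma lin_S : lin S. Proof. exact: hh_S_lin hB. Qed.

Let bm := bilin_mul.
Let lD := lin_Delta.
Let le := lin_eps.
Let lS := lin_S.

Lemma sw_DeltaA P (F : B -> B -> B -> P) a : trilin F ->
  \sw_(a1, a2 <- Delta a) \sw_(b1, b2 <- Delta a1) F b1 b2 a2 =
  \sw_(a1, a2 <- Delta a) \sw_(b1, b2 <- Delta a2) F a1 b1 b2.
Proof.
apply: sw_assoc; have := homcoalg_coassoc (hh_coalg hB) a.
under eq_sw do under eq_sw do rewrite hinv_id.
by under [RHS]eq_sw do under eq_sw do rewrite hinv_id.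
Qed.

Lemma Delta_counitr_by P (G : B -> B -> P) (F : B -> P) a :
  (forall x y, G x y = eps y *: F x) -> lin F -> sweedler (Delta a) G = F a.
Proof.
move=> E lF; rewrite -[in RHS](hinv_id a) -(homcoalg_counitr (hh_coalg hB)).
by rewrite (sw_map _ _ lF); apply: eq_sw => x y; rewrite E (lin_Z _ lF).
Qed.
Lemma Delta_counitl_by P (G : B -> B -> P) (F : B -> P) a :
  (forall x y, G x y = eps x *: F y) -> lin F -> sweedler (Delta a) G = F a.
Proof.
move=> E lF; rewrite -[in RHS](hinv_id a) -(homcoalg_counitl (hh_coalg hB)).
by rewrite (sw_map _ _ lF); apply: eq_sw => x y; rewrite E (lin_Z _ lF).
Qed.

Lemma sw_coact_mul P (F : H -> B -> P) a b : bilin F ->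
  sweedler (hcoact D (mul a b)) F =
  \sw_(x, a0 <- hcoact D a) \sw_(y, b0 <- hcoact D b) F (x * y) (mul a0 b0).
Proof.
move=> bF; rewrite (hh_mul_coact hB); do 2![rewrite sw_bind //; apply: eq_sw => ? ?].
exact: sw_tns.
Qed.
Lemma sw_coact_one P (F : H -> B -> P) : bilin F ->
  sweedler (hcoact D one) F = F 1 one.
Proof. by move=> bF; rewrite (hh_one_coact hB) sw_tns. Qed.
Lemma sw_coact_S P (F : H -> B -> P) a : bilin F ->
  sweedler (hcoact D (S a)) F = \sw_(x, a0 <- hcoact D a) F x (S a0).
Proof.
move=> bF; rewrite (hh_S_coact hB) sw_bind //; apply: eq_sw => ? ?.
exact: sw_tns.
Qed.
Lemma sw_Delta_act P (F : B -> B -> P) h a : bilin F ->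
  sweedler (Delta (hact D h a)) F =
  \sw_(h1, h2 <- comul H h) \sw_(a1, a2 <- Delta a) F (hact D h1 a1) (hact D h2 a2).
Proof.
move=> bF; rewrite (hh_comul_act hB); do 2![rewrite sw_bind //; apply: eq_sw => ? ?].
exact: sw_tns.
Qed.
Lemma sw_Delta_mul P (F : B -> B -> P) a b : bilin F ->
  sweedler (Delta (mul a b)) F =
  \sw_(a1, a2 <- Delta a) \sw_(b1, b2 <- Delta b) \sw_(x, a20 <- hcoact D a2)
    F (mul a1 (hact D x b1)) (mul a20 b2).
Proof.
move=> bF; rewrite (hh_comulM hB); do 3![rewrite sw_bind //; apply: eq_sw => ? ?].
by rewrite sw_tns // hmap_id hinv_id.
Qed.
Lemma sw_Delta_one P (F : B -> B -> P) : bilin F ->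
  sweedler (Delta one) F = F one one.
Proof. by move=> bF; rewrite (hh_comul1 hB) sw_tns. Qed.

Lemma sw_coact_Delta P (F : H -> B -> B -> P) a : trilin F ->
  \sw_(x, a0 <- hcoact D a) \sw_(p, q <- Delta a0) F x p q =
  \sw_(a1, a2 <- Delta a) \sw_(x, a10 <- hcoact D a1)
    \sw_(y, a20 <- hcoact D a2) F (x * y) a10 a20.
Proof.
exact: (sw_codiag (m := fun x y : H => x * y) (hh_comul_coact hB a)).
Qed.

Lemma sw_antil P (G : B -> B -> P) (F : B -> P) a :
  (forall x y, G x y = F (mul (S x) y)) -> lin F -> sweedler (Delta a) G = eps a *: F one.
Proof.
move=> E lF; rewrite -(lin_Z _ lF) -(hh_Sl hB) (sw_map _ _ lF).
by apply: eq_sw => x y; rewrite E.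
Qed.
Lemma sw_antir P (G : B -> B -> P) (F : B -> P) a :
  (forall x y, G x y = F (mul x (S y))) -> lin F -> sweedler (Delta a) G = eps a *: F one.
Proof.
move=> E lF; rewrite -(lin_Z _ lF) -(hh_Sr hB) (sw_map _ _ lF).
by apply: eq_sw => x y; rewrite E.
Qed.
Lemma sw_coact_eps P (G : H -> B -> P) (F : H -> P) a :
  (forall x y, G x y = eps y *: F x) -> lin F ->
  sweedler (hcoact D a) G = eps a *: F 1.
Proof.
move=> E lF; rewrite -(lin_Z _ lF) -(hh_eps_coact hB) (sw_map _ _ lF).
by apply: eq_sw => x y; rewrite E (lin_Z _ lF).
Qed.

Ltac lin_B := match goal with
  | |- lin (fun z_ => mul _ ?c) => apply (linI_bil c bm)
  | |- lin (fun z_ => mul ?c _) => apply (linI_bir c bm)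
  | |- lin (fun z_ => Delta _) => apply (linI_comp lD)
  | |- lin (fun z_ => eps _) => apply (linI_comp le)
  | |- lin (fun z_ => S _) => apply (linI_comp lS)
  | |- _ => match goal with
    | |- lin (fun z_ => hact D _ ?m) => apply (lin_actl yD m)
    | |- lin (fun z_ => hact D ?m _) => apply (lin_actr yD m)
    | |- lin (fun z_ => hcoact D _) => apply (lin_coact yD)
    end
  end.
Ltac lin_db ::= lin_B.

Ltac Delta_of a := idtac; lazymatch goal with |- sweedler (Delta a) _ = _ => idtac end.
(** Orientation of the rules on B: structure maps are expanded on products and on acted elements,
    coproducts of B become right combs, and a coproduct taken after a coaction is replaced by
    coactions of the legs of the coproduct. *)
Ltac B_rules := idtac; lazymatch goal with
  | |- sweedler (hcoact _ (mul _ _)) _ = _ => apply sw_coact_mul; lin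
  | |- sweedler (hcoact _ one) _ = _ => apply sw_coact_one; lin
  | |- sweedler (hcoact _ (S _)) _ = _ => apply sw_coact_S; lin
  | |- sweedler (hcoact _ (hact _ _ _)) _ = _ => apply (sw_coact_act yD); lin
  | |- sweedler (Delta (mul _ _)) _ = _ => apply sw_Delta_mul; lin
  | |- sweedler (Delta one) _ = _ => apply sw_Delta_one; lin
  | |- sweedler (Delta (hact _ _ _)) _ = _ => apply sw_Delta_act; lin
  | |- sweedler (Delta _) _ = _ => first
     [ etransitivity; [ apply eq_sw; let a := fresh "a" in let b := fresh "b" in
         intros a b; cbv beta; bring_by ltac:(Delta_of a) | apply sw_DeltaA; lin ]
     | push_in ltac:(first
         [ eapply Delta_counitl_by;
           [ intros; cbv beta; first [ reflexivity | apply scaler_swap ] | lin ]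
         | eapply Delta_counitr_by;
           [ intros; cbv beta; first [ reflexivity | apply scaler_swap ] | lin ] ]) ]
  | |- sweedler (hcoact _ _) _ = _ => first
     [ etransitivity; [ apply eq_sw; let a := fresh "a" in let b := fresh "b" in
         intros a b; cbv beta; bring_by ltac:(Delta_of b) | apply sw_coact_Delta; lin ]
     | push_in ltac:(eapply sw_coact_eps;
           [ intros; cbv beta; first [ reflexivity | apply scaler_swap ] | lin ]) ]
  end.
Ltac sw_rules ::= B_rules.
Ltac leaf_hyp ::= progress rewrite ?(yd_actM yD) ?(yd_act1 yD) ?mul_assoc ?mul_oner
  ?mul_onel ?(hh_mul_act hB) ?(hh_one_act hB) ?(hh_S_act hB) ?(hh_epsM hB) ?(hh_eps1 hB)
  ?(hh_eps_act hB).

Let hmapE : hmap D = (fun b => b). Proof. exact/funext. Qed.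
Let hinvE : hinv D = (fun b => b). Proof. exact/funext. Qed.

Local Notation A := (tensor B H).
Local Notation mulA := (bi_mul D mul).
Local Notation comulA := (bi_comul D Delta).
Local Notation counitA := (bi_counit eps).
Local Notation SA := (bi_antipode D mul one S).

Lemma bi_mapE x : bi_map D x = x.
Proof. by rewrite /bi_map hmapE [RHS]tensor_tns. Qed.
Lemma bi_invE x : bi_inv D x = x.
Proof. by rewrite /bi_inv hinvE [RHS]tensor_tns. Qed.

Lemma bilin_bi_mul : bilin mulA.
Proof. by rewrite /bi_mul hinvE; cbv beta; lin. Qed.
Lemma lin_bi_comul : lin comulA.
Proof. by rewrite /bi_comul hmapE; cbv beta; lin. Qed.
Lemma lin_bi_counit : @lin k A k^o counitA.
Proof.
apply: linI_sweedler; first by lin.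
split=> [f|h] a u v /=; first by rewrite linearP mulrDr mulrCA.
by rewrite le mulrDl; congr (_ + _); exact: esym (mulrA _ _ _).
Qed.
Lemma lin_bi_antipode : lin SA.
Proof. by rewrite /bi_antipode /bi_mul hinvE; cbv beta; lin. Qed.

Lemma bi_mul_tns f h f' h' : mulA (f ⊗ h) (f' ⊗ h') =
  \sw_(h1, h2 <- comul H h) (mul f (hact D h1 f') ⊗ (h2 * h')).
Proof. by rewrite /bi_mul hinvE; cbv beta; swn. Qed.

Lemma bi_mulA x y z : mulA (mulA x y) z = mulA x (mulA y z).
Proof.
rewrite /bi_mul hinvE; cbv beta.
tensor_ind x; tensor_ind y; tensor_ind z.
by sw_solve.
Qed.

Lemma bi_mulr1 x : mulA x (bi_one H one) = x.
Proof.
rewrite /bi_mul /bi_one hinvE; cbv beta; tensor_ind x.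
by sw_solve.
Qed.
Lemma bi_mul1r x : mulA (bi_one H one) x = x.
Proof.
rewrite /bi_mul /bi_one hinvE; cbv beta; tensor_ind x.
by sw_solve.
Qed.

Lemma bi_comulA x :
  \sw_(a1, a2 <- comulA x) \sw_(b1, b2 <- comulA a2) (a1 ⊗ (b1 ⊗ b2)) =
  \sw_(a1, a2 <- comulA x) \sw_(b1, b2 <- comulA a1) (b1 ⊗ (b2 ⊗ a2)).
Proof.
rewrite /bi_comul hmapE; cbv beta; tensor_ind x.
by sw_solve.
Qed.

Lemma bi_counit_tns f h : counitA (f ⊗ h) = eps f * counit H h.
Proof.
rewrite /bi_counit sw_tns //; split=> [f'|h'] a u v /=.
  by rewrite linearP mulrDr mulrCA.
by rewrite le mulrDl; congr (_ + _); exact: esym (mulrA _ _ _).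
Qed.

Ltac leaf_hyp ::= progress rewrite ?(yd_actM yD) ?(yd_act1 yD) ?mul_assoc ?mul_oner
  ?mul_onel ?(hh_mul_act hB) ?(hh_one_act hB) ?(hh_S_act hB) ?(hh_epsM hB) ?(hh_eps1 hB)
  ?(hh_eps_act hB) ?bi_counit_tns.

Lemma bi_counitr x : \sw_(a1, a2 <- comulA x) (counitA a2 *: a1) = x.
Proof.
have lc := lin_bi_counit.
rewrite /bi_comul hmapE; cbv beta; tensor_ind x.
by sw_solve.
Qed.
Lemma bi_counitl x : \sw_(a1, a2 <- comulA x) (counitA a1 *: a2) = x.
Proof.
have lc := lin_bi_counit.
rewrite /bi_comul hmapE; cbv beta; tensor_ind x.
by sw_solve.
Qed.

Lemma bi_comulM x y :
  comulA (mulA x y) =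
  \sw_(x1, x2 <- comulA x) \sw_(y1, y2 <- comulA y) (mulA x1 y1 ⊗ mulA x2 y2).
Proof.
rewrite /bi_comul /bi_mul hmapE hinvE; cbv beta.
tensor_ind x; tensor_ind y.
by sw_solve.
Qed.

Lemma bi_comul1 : comulA (bi_one H one) = bi_one H one ⊗ bi_one H one.
Proof.
rewrite /bi_comul /bi_one hmapE; cbv beta.
by sw_solve.
Qed.

Lemma bi_counitM x y : counitA (mulA x y) = counitA x * counitA y.
Proof.
have lc := lin_bi_counit; have bA := bilin_bi_mul.
move: x; apply: (@tensor_ext _ _ _ k^o (fun x => counitA (mulA x y))
  (fun x => counitA x *: (counitA y : k^o))); [lin|lin|move=> a b].
move: y; apply: (@tensor_ext _ _ _ k^o (fun y => counitA (mulA (a ⊗ b) y))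
  (fun y => counitA (a ⊗ b) *: (counitA y : k^o))); [lin|lin|move=> a0 b0].
rewrite bi_mul_tns (sw_map _ _ lc).
transitivity (\sw_(h1, h2 <- comul H b)
  (counit H h1 *: (counit H h2 *: (eps a * eps a0 * counit H b0 : k^o)))).
  apply: (@eq_sw _ _ _ k^o) => h1 h2.
  rewrite bi_counit_tns (hh_epsM hB) (hh_eps_act hB) counitM.
  by rewrite -![_ *: _]/(_ * _); ring.
swn.
by rewrite !bi_counit_tns -![_ *: _]/(_ * _); ring.
Qed.

(** Since (S(f_0) × 1)(b × g) = S(f_0) b × g, reassociating exposes the product S(f_0) b, to which
    the antipode axiom of B can be applied before the smash product is expanded. *)
Lemma bi_mul_antipode f h g b :
  mulA (SA (f ⊗ h)) (b ⊗ g) =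
  \sw_(a, f0 <- hcoact D f)
     mulA (one ⊗ antipode H (a * h)) (mul (S f0) b ⊗ g).
Proof.
have bA := bilin_bi_mul; have lA := lin_bi_antipode.
rewrite /bi_antipode sw_tns; last by lin.
sw pull; apply: eq_sw => a f0; rewrite bi_mulA; congr (mulA _ _).
by rewrite bi_mul_tns; swn.
Qed.

Lemma bi_antipodel x :
  \sw_(a1, a2 <- comulA x) mulA (SA a1) a2 = counitA x *: bi_one H one.
Proof.
have bA := bilin_bi_mul; have lA := lin_bi_antipode; have lc := lin_bi_counit.
have lcA := lin_bi_comul.
tensor_ind x; rewrite /bi_comul hmapE; cbv beta.
swn.
(* Colinearity of Δ merges the two coaction legs: f_1(-1) f_2(-1) ⊗ f_1(0) ⊗ f_2(0) becomes f_(-1) ⊗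
   Δ(f_0), so S meets both legs of one coproduct of B. *)
transitivity (\sw_(h1, h2 <- comul H b) \sw_(z, f0 <- hcoact D a)
  \sw_(p, q <- Delta f0)
     mulA (one ⊗ antipode H (z * h1)) (mul (S p) q ⊗ h2)).
  under eq_sw do under eq_sw do under eq_sw do rewrite bi_mul_antipode.
  by sw_solve.
sw (idtac; lazymatch goal with |- sweedler (Delta _) _ = _ =>
  eapply sw_antil; [intros p q; cbv beta; abstract_term (mul (S p) q) | lin] end).
by swn; rewrite /bi_mul hinvE; cbv beta; swn; rewrite /bi_one bi_counit_tns -scalerA.
Qed.

Lemma bi_antipoder x :
  \sw_(a1, a2 <- comulA x) mulA a1 (SA a2) = counitA x *: bi_one H one.
Proof.
have bA := bilin_bi_mul; have lA := lin_bi_antipode; have lc := lin_bi_counit.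
have lcA := lin_bi_comul.
tensor_ind x; rewrite /bi_comul hmapE; cbv beta.
swn; rewrite /bi_antipode; swn.
have E f h g z : mulA (f ⊗ h) (mulA (one ⊗ g) z) = mulA (f ⊗ (h * g)) z.
  by rewrite -bi_mulA bi_mul_tns; congr (mulA _ _); swn.
(* With the H-factors gathered by [E], first h_1 S(h_2) cancels, and then so do the consecutive
   coaction legs in x S(y); what is left is f_1 S(f_2). *)
transitivity (\sw_(f1, f2 <- Delta a) \sw_(x, f <- hcoact D f2)
  \sw_(h1, h2 <- comul H b) \sw_(y, f' <- hcoact D f)
     mulA (f1 ⊗ (x * h1 * (antipode H h2 * antipode H y))) (S f' ⊗ 1)).
  by do 4![apply: eq_sw => ? ?]; rewrite E.
swn.
transitivity (counit H b *: \sw_(f1, f2 <- Delta a) (mul f1 (S f2) ⊗ (1 : H))).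
  congr (_ *: _); apply: eq_sw => f1 f2.
  by rewrite bi_mul_tns; swn.
sw (idtac; lazymatch goal with |- sweedler (Delta _) _ = _ =>
  eapply sw_antir; [intros p q; cbv beta; abstract_term (mul p (S q)) | lin] end).
by rewrite /bi_one bi_counit_tns mulrC scalerA.
Qed.

Lemma lin_autom_id (M : lmodType k) (f g : M -> M) :
  (forall x, f x = x) -> (forall x, g x = x) -> lin_autom f g.
Proof. by move=> E F; split=> x; rewrite ?E ?F // => y z; rewrite !E. Qed.

Theorem radford_biproduct : is_biproduct_hom_hopf D mul one Delta eps S.
Proof.
have E := bi_mapE; have Ei := bi_invE.
split.
- split=> //; first exact: lin_autom_id.
  + exact: bilin_bi_mul.
  + by move=> x y z; rewrite !E bi_mulA.
  + by move=> x y; rewrite !E.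
  + by move=> x; rewrite E bi_mulr1.
  + by move=> x; rewrite E bi_mul1r.
- split; first exact: lin_autom_id.
  + exact: lin_bi_comul.
  + exact: lin_bi_counit.
  + move=> x; under eq_sw do under eq_sw do rewrite Ei.
    by under [RHS]eq_sw do under eq_sw do rewrite Ei; exact: bi_comulA.
  + move=> x; under [RHS]eq_sw do rewrite !E.
    by rewrite E -tensor_tns.
  + by move=> x; rewrite Ei bi_counitr.
  + by move=> x; rewrite Ei bi_counitl.
  + by move=> x; rewrite E.
- exact: bi_comulM.
- exact: bi_comul1.
- exact: bi_counitM.
- by rewrite bi_counit_tns (hh_eps1 hB) counit1 mulr1.
- exact: lin_bi_antipode.
- by move=> x; rewrite !E.
- exact: bi_antipodel.
- exact: bi_antipoder.
Qed.
End Biproduct.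

(** * Hopf structures on algebras generated by a subobject *)

Lemma lin_eq_comb (k : fieldType) (M N : lmodType k) (f g : M -> N) a x y :
  lin f -> lin g -> f x = g x -> f y = g y -> f (a *: x + y) = g (a *: x + y).
Proof. by move=> lf lg Ex Ey; rewrite lf lg Ex Ey. Qed.

(** Discharges the linear-combination case of an induction along [gen_ind] or a similar principle:
    both sides are abstracted over [c *: u + v] and shown linear. *)
Ltac eq_comb :=
  let c := fresh "c" in let u := fresh "u" in let v := fresh "v" in
  let E1 := fresh "E" in let E2 := fresh "E" in
  intros c u v E1 E2; intros;
  lazymatch goal with |- ?l = ?r =>
    let l' := eval pattern (c *: u + v) in l in
    let r' := eval pattern (c *: u + v) in r in
    lazymatch l' with ?f _ => lazymatch r' with ?g _ =>
      apply (@lin_eq_comb _ _ _ f g c u v); [ lin | lin | apply E1 | apply E2 ] end end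
  end.

(* An associative algebra B in the category of Yetter-Drinfeld modules, generated
   by the image of a subobject L; a word in L is written as an iterated left
   multiplication by letters. *)
Record is_generated (k : fieldType) (H : hopfAlg k) (L B : lmodType k)
    (DL : hydData H L) (D : hydData H B) (mul : B -> B -> B) (one : B)
    (i : L -> B) : Prop := IsGenerated {
  gen_bilin : bilin mul;
  gen_mulA : forall a b c, mul (mul a b) c = mul a (mul b c);
  gen_mulr1 : forall a, mul a one = a;
  gen_mul1r : forall a, mul one a = a;
  gen_lin : lin i;
  gen_ind : forall Q : B -> Prop,
    (forall a x y, Q x -> Q y -> Q (a *: x + y)) -> Q one ->
    (forall x u, Q u -> Q (mul (i x) u)) -> forall u, Q u;
  gen_act_bilin : bilin (hact D);
  gen_coact_lin : lin (hcoact D);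
  gen_act_one : forall h, hact D h one = counit H h *: one;
  gen_act_cons : forall h x u, hact D h (mul (i x) u) =
    \sw_(h1, h2 <- comul H h) mul (i (hact DL h1 x)) (hact D h2 u);
  gen_coact_one : hcoact D one = 1 ⊗ one;
  gen_coact_cons : forall x u, hcoact D (mul (i x) u) =
    \sw_(a, x0 <- hcoact DL x) \sw_(b, u0 <- hcoact D u) ((a * b) ⊗ mul (i x0) u0);
  gen_hmap : forall u, hmap D u = u;
  gen_hinv : forall u, hinv D u = u
}.

Section Generated.
Variables (k : fieldType) (H : hopfAlg k).
Variables (L B : lmodType k) (DL : hydData H L) (D : hydData H B).
Variables (mul : B -> B -> B) (one : B) (i : L -> B).
Hypothesis yL : is_yd DL.
Hypothesis gB : is_generated DL D mul one i.
Let bm := gen_bilin gB.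
Let mul_assoc := gen_mulA gB.
Let mul_oner := gen_mulr1 gB.
Let mul_onel := gen_mul1r gB.
Let li := gen_lin gB.
Let bact := gen_act_bilin gB.
Let lcoact := gen_coact_lin gB.
Let act_one := gen_act_one gB.
Let act_cons := gen_act_cons gB.
Let coact_one := gen_coact_one gB.
Let coact_cons := gen_coact_cons gB.
Let hmap_id := gen_hmap gB.
Let hinv_id := gen_hinv gB.
Implicit Types (P : lmodType k) (a b u : B) (x : L) (h g : H).

Ltac lin_B := match goal with
  | |- lin (fun z_ => mul _ ?c) => apply (linI_bil c bm)
  | |- lin (fun z_ => mul ?c _) => apply (linI_bir c bm)
  | |- lin (fun z_ => i _) => apply (linI_comp li)
  | |- lin (fun z_ => hact D _ ?c) => apply (linI_bil c bact)
  | |- lin (fun z_ => hact D ?c _) => apply (linI_bir c bact)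
  | |- lin (fun z_ => hcoact D _) => apply (linI_comp lcoact)
  | |- lin (fun z_ => hact DL _ ?m) => apply (lin_actl yL m)
  | |- lin (fun z_ => hact DL ?m _) => apply (lin_actr yL m)
  | |- lin (fun z_ => hcoact DL _) => apply (lin_coact yL)
  end.
Ltac lin_db ::= lin_B.

Ltac leaf_hyp ::= progress rewrite ?mul_assoc ?mul_oner ?mul_onel ?act_one ?act_cons
  ?coact_one ?coact_cons ?(yd_actM yL) ?(yd_act1 yL).
Ltac sw_solve ::= swn; swnr; sw_match; rewrite ?mulrA ?mul_assoc;
  try first [ reflexivity | apply: scaler_swap ].

(** Compatibility is assumed only for a letter on the left; associativity of [mul] and
    coassociativity of H propagate it along the words of the first factor. *)
Lemma act_mul h a b : hact D h (mul a b) =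
  \sw_(h1, h2 <- comul H h) mul (hact D h1 a) (hact D h2 b).
Proof.
move: a h; apply: (gen_ind gB); first by eq_comb.
  by move=> h; symmetry; swn; rewrite mul_onel.
move=> x u IH h; rewrite mul_assoc act_cons; sw (use IH).
by sw_solve.
Qed.

Lemma act_i h x : hact D h (i x) = i (hact DL h x).
Proof. by rewrite -[i x]mul_oner act_cons; sw_solve. Qed.

Lemma coact_mul a b : hcoact D (mul a b) =
  \sw_(x, a0 <- hcoact D a) \sw_(y, b0 <- hcoact D b) ((x * y) ⊗ mul a0 b0).
Proof.
move: a; apply: (gen_ind gB); first by eq_comb.
  by swnr; rewrite mul_onel; exact: tensor_tns.
move=> x u IH; rewrite mul_assoc coact_cons; sw (use IH).
by sw_solve.
Qed.

Lemma coact_i x : hcoact D (i x) = \sw_(a, x0 <- hcoact DL x) (a ⊗ i x0).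
Proof. by rewrite -[i x]mul_oner coact_cons; sw_solve. Qed.

Lemma yd_B : is_yd D.
Proof.
split=> //.
- move=> h g m; move: m h g; apply: (gen_ind gB); first by eq_comb.
    by move=> h g; sw_solve.
  move=> x u IH h g; swn; sw (use IH).
  by sw_solve.
- move=> m; move: m; apply: (gen_ind gB); first by eq_comb.
    by sw_solve.
  by move=> x u IH; swn; sw (use IH).
- apply: (gen_ind gB); [by eq_comb|by swn; swnr|move=> x u IH].
  swn; sw (idtac; apply: (sw_assoc IH); lin); swnr; sw_match.
- apply: (gen_ind gB); [by eq_comb|by sw_solve|move=> x u IH].
  have lx : lin (fun u => mul (i x) u) by lin.
  swn; rewrite -[in RHS]IH (sw_map _ _ lx).
  by apply: eq_sw => a m0; rewrite (lin_Z _ lx).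
- move=> h m; move: m h; apply: (gen_ind gB); first by eq_comb.
    by move=> h; sw_solve.
  by move=> x u IH h; swn; sw (use IH); sw_solve.
Qed.

Let yD := yd_B.

(** * Coproduct, counit and antipode prescribed letter by letter *)

Variables (Delta : B -> tensor B B) (eps : B -> k) (S : B -> B).
Hypothesis lD : lin Delta.
Hypothesis le : @lin k B k^o eps.
Hypothesis lS : lin S.
Hypothesis Delta_one : Delta one = one ⊗ one.
Hypothesis Delta_cons : forall x u, Delta (mul (i x) u) =
  \sw_(u1, u2 <- Delta u) (mul (i x) u1 ⊗ u2) +
  \sw_(u1, u2 <- Delta u) \sw_(a, x0 <- hcoact DL x) (hact D a u1 ⊗ mul (i x0) u2).
Hypothesis eps_one : eps one = 1.
Hypothesis eps_cons : forall x u, eps (mul (i x) u) = 0.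
Hypothesis S_one : S one = one.
Hypothesis S_cons : forall x u, S (mul (i x) u) =
  - \sw_(a, x0 <- hcoact DL x) mul (hact D a (S u)) (i x0).

Ltac lin_db ::= first [ lin_B | match goal with
  | |- lin (fun z_ => Delta _) => apply (linI_comp lD)
  | |- lin (fun z_ => eps _) => apply (linI_comp le)
  | |- lin (fun z_ => S _) => apply (linI_comp lS)
  end ].
Ltac leaf_hyp ::= progress rewrite ?mul_assoc ?mul_oner ?mul_onel ?act_one ?act_i ?act_mul
  ?coact_one ?coact_i ?coact_mul ?(yd_actM yL) ?(yd_act1 yL) ?(yd_actM yD) ?(yd_act1 yD)
  ?Delta_one ?Delta_cons ?eps_one ?eps_cons ?S_one ?S_cons.

Lemma eps_act h a : eps (hact D h a) = counit H h * eps a.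
Proof.
move: a h; apply: (gen_ind gB).
- move=> c u v Eu Ev h.
  by apply: (@lin_eq_comb k B k^o (fun a => eps (hact D h a))
    (fun a => counit H h *: (eps a : k^o))); [lin|lin|exact: Eu|exact: Ev].
- by move=> h; rewrite act_one (lin_Z _ le) eps_one.
- move=> x u _ h; rewrite eps_cons mulr0 act_cons (sw_map _ _ le).
  by under eq_sw do rewrite eps_cons; rewrite sw_0.
Qed.

Lemma Delta_act h a : Delta (hact D h a) =
  \sw_(h1, h2 <- comul H h) \sw_(a1, a2 <- Delta a) (hact D h1 a1 ⊗ hact D h2 a2).
Proof.
move: a h; apply: (gen_ind gB); [by eq_comb|by move=> h; sw_solve|move=> x u IH h].
rewrite act_cons; swn; sw (use IH); swn; sw (use IH).
by sw_solve.
Qed.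

Lemma Delta_coact a : \sw_(x, a0 <- hcoact D a) (x ⊗ Delta a0) =
    \sw_(a1, a2 <- Delta a) \sw_(x, a10 <- hcoact D a1)
    \sw_(y, a20 <- hcoact D a2) ((x * y) ⊗ (a10 ⊗ a20)).
Proof.
move: a; apply: (gen_ind gB); [by eq_comb|by sw_solve|move=> x u IH].
rewrite coact_cons; swn.
do 2 sw (idtac; apply: (sw_codiag (m := fun x y : H => x * y) IH); lin).
by sw_solve.
Qed.

Lemma Delta_mul a b : Delta (mul a b) =
  \sw_(a1, a2 <- Delta a) \sw_(b1, b2 <- Delta b) \sw_(x, a20 <- hcoact D a2)
    (mul a1 (hact D x b1) ⊗ mul a20 b2).
Proof.
move: a; apply: (gen_ind gB); first by eq_comb.
  by swnr; rewrite mul_onel; exact: tensor_tns.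
move=> x u IH; rewrite mul_assoc Delta_cons; swn; sw (use IH).
by sw_solve.
Qed.

Lemma Delta_i x : Delta (i x) = i x ⊗ one + one ⊗ i x.
Proof. by rewrite -[in LHS](mul_oner (i x)) Delta_cons; sw_solve. Qed.

Lemma DeltaA a :
  \sw_(a1, a2 <- Delta a) \sw_(b1, b2 <- Delta a1) (b1 ⊗ (b2 ⊗ a2)) =
  \sw_(a1, a2 <- Delta a) \sw_(b1, b2 <- Delta a2) (a1 ⊗ (b1 ⊗ b2)).
Proof.
move: a; apply: (gen_ind gB); [by eq_comb|by sw_solve|move=> x u IH].
swn; sw (use Delta_act); swn.
(* A letter can land in any of the three tensor positions, and each of these terms uses
   coassociativity of u under its own trilinear map. *)
do 3 sw (idtac; lazymatch goal with |- sweedler (Delta u) _ = _ =>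
  etransitivity;
    [ apply eq_sw; let a := fresh in let b := fresh in
      intros a b; cbv beta; bring_by ltac:(sum_of (Delta a))
    | apply: (sw_assoc IH); lin ] end).
rewrite -addrA.
by sw_solve.
Qed.

Lemma Delta_counitl a : \sw_(a1, a2 <- Delta a) (eps a1 *: a2) = a.
Proof.
move: a; apply: (gen_ind gB); [by eq_comb|by sw_solve|move=> x u IH].
have lx : lin (fun u => mul (i x) u) by lin.
swn; rewrite -[in RHS]IH (sw_map _ _ lx); sw (use eps_act); swn.
by apply: eq_sw => a b; rewrite (lin_Z _ lx).
Qed.

Lemma Delta_counitr a : \sw_(a1, a2 <- Delta a) (eps a2 *: a1) = a.
Proof.
move: a; apply: (gen_ind gB); [by eq_comb|by sw_solve|move=> x u IH].
have lx : lin (fun u => mul (i x) u) by lin.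
swn; rewrite -[in RHS]IH (sw_map _ _ lx).
by apply: eq_sw => a b; rewrite (lin_Z _ lx).
Qed.

Lemma eps_mul a b : eps (mul a b) = eps a * eps b.
Proof.
move: a; apply: (gen_ind gB).
- move=> c u v Eu Ev.
  by apply: (@lin_eq_comb k B k^o (fun a => eps (mul a b))
    (fun a => eps a *: (eps b : k^o))); [lin|lin|exact: Eu|exact: Ev].
- by rewrite mul_onel eps_one mul1r.
- by move=> x u _; rewrite mul_assoc !eps_cons mul0r.
Qed.

Lemma eps_coact a : \sw_(x, a0 <- hcoact D a) (eps a0 *: x) = (eps a)%:A.
Proof.
move: a; apply: (gen_ind gB); [by eq_comb|by sw_solve|move=> x u _].
by rewrite coact_cons eps_cons scale0r; swn.
Qed.

Lemma S_act h a : S (hact D h a) = hact D h (S a).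
Proof.
move: a h; apply: (gen_ind gB); [by eq_comb|by move=> h; sw_solve|move=> x u IH h].
rewrite act_cons; swn; by sw (use IH); sw_solve.
Qed.

Lemma S_coact a : hcoact D (S a) = \sw_(x, a0 <- hcoact D a) (x ⊗ S a0).
Proof.
move: a; apply: (gen_ind gB); [by eq_comb|by sw_solve|move=> x u IH].
by rewrite coact_cons; swn; sw (use IH); sw_solve.
Qed.

Lemma S_mul a b : S (mul a b) =
    \sw_(x, a0 <- hcoact D a) mul (hact D x (S b)) (S a0).
Proof.
move: a; apply: (gen_ind gB); [by eq_comb|by sw_solve|move=> x u IH].
rewrite mul_assoc S_cons; swn; sw (use IH).
by sw_solve.
Qed.

(** The two summands of [Delta_cons] cancel against each other: S(x u_1) u_2 = - (x_(-1) . S(u_1))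
    x_0 u_2, while [S_act] identifies the other summand with (x_(-1) . S(u_1)) x_0 u_2. *)
Lemma S_antil a : \sw_(a1, a2 <- Delta a) mul (S a1) a2 = eps a *: one.
Proof.
move: a; apply: (gen_ind gB); [by eq_comb|by sw_solve|move=> x u _].
by rewrite eps_cons; swn; sw (use S_act); swn; rewrite addNr scale0r.
Qed.

Lemma S_antir a : \sw_(a1, a2 <- Delta a) mul a1 (S a2) = eps a *: one.
Proof.
move: a; apply: (gen_ind gB); [by eq_comb|by sw_solve|move=> x u IH].
rewrite eps_cons scale0r.
(* Both summands are rearranged around the sum u_1 S(u_2), which is ε(u) by induction; they become
   ε(u) x and - ε(u) x. *)
transitivity (mul (i x) (\sw_(a1, a2 <- Delta u) mul a1 (S a2)) -
  \sw_(c, x0 <- hcoact DL x)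
    mul (hact D c (\sw_(a1, a2 <- Delta u) mul a1 (S a2))) (i x0)).
  by sw_solve.
by rewrite IH; swn; rewrite scalerN subrr.
Qed.

Theorem generated_hyd_hopf : is_hyd_hopf D mul one Delta eps S.
Proof.
have autB : lin_autom (hmap D) (hinv D).
  by split=> u; rewrite ?hmap_id ?hinv_id // => x y; rewrite !hmap_id.
split=> //.
- exact: hyd_of_yd yD.
- by split=> //; move=> *; rewrite !hmap_id.
- split=> //.
  + move=> a; under eq_sw do under eq_sw do rewrite hinv_id.
    by under [RHS]eq_sw do under eq_sw do rewrite hinv_id; rewrite DeltaA.
  + move=> a; under [RHS]eq_sw do rewrite !hmap_id.
    by rewrite hmap_id -tensor_tns.
  + by move=> a; rewrite hinv_id Delta_counitr.
  + by move=> a; rewrite hinv_id Delta_counitl.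
  + by move=> a; rewrite hmap_id.
- exact: act_mul.
- exact: coact_mul.
- exact: Delta_act.
- exact: eps_act.
- exact: Delta_coact.
- exact: eps_coact.
- move=> a b; rewrite Delta_mul; do 3 apply: eq_sw => ? ?.
  by rewrite hmap_id hinv_id.
- exact: eps_mul.
- by move=> a; rewrite !hmap_id.
- exact: S_act.
- exact: S_coact.
- exact: S_antil.
- exact: S_antir.
Qed.

End Generated.

(** * The enveloping algebra *)

Section Subspaces.
Variables (k : fieldType) (T : lmodType k).
Implicit Types J X : T -> Prop.

Lemma subspace_sum J (I : Type) (r : seq I) (E : I -> T) :
  subspace J -> (forall i, J (E i)) -> J (\sum_(i <- r) E i).
Proof.
move=> [J0 JD] h; elim: r => [|i r IH]; first by rewrite big_nil.
by rewrite big_cons -[E i]scale1r; apply: JD.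
Qed.
Lemma subspaceZ J c x : subspace J -> J x -> J (c *: x).
Proof. by move=> [J0 JD] Jx; rewrite -[_ *: _]addr0; apply: JD. Qed.
Lemma subspace_sw (M N : lmodType k) J (t : tensor M N) (F : M -> N -> T) :
  subspace J -> (forall a b, J (F a b)) -> J (sweedler t F).
Proof.
by move=> sJ h; apply: subspace_sum => // p; apply: subspaceZ.
Qed.

Lemma lspan_gen X x : X x -> lspan X x.
Proof.
move=> Xx; exists [:: (1, x)]; last by rewrite big_seq1 scale1r.
by move=> p; rewrite inE => /eqP->.
Qed.
Lemma lspan_min X J x : subspace J -> (forall y, X y -> J y) -> lspan X x -> J x.
Proof.
move=> sJ h [s hs ->]; elim: s hs => [|p s IH] hs; first by rewrite big_nil; case: sJ.
rewrite big_cons; case: (sJ) => _; apply.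
  by apply/h/hs; rewrite mem_head.
by apply: IH => q qs; apply: hs; rewrite in_cons qs orbT.
Qed.
End Subspaces.

Lemma subspace_preim (k : fieldType) (M N : lmodType k) (f : M -> N) (J : N -> Prop) :
  lin f -> subspace J -> subspace (fun x => J (f x)).
Proof.
move=> lf [J0 JD]; split; first by rewrite lin_0.
by move=> a x y Jx Jy; rewrite lf; apply: JD.
Qed.
Lemma subspace_ker (k : fieldType) (M N : lmodType k) (f : M -> N) :
  lin f -> subspace (fun x => f x = 0).
Proof.
move=> lf; split; first exact: lin_0.
by move=> a x y Ex Ey; rewrite lf Ex Ey scaler0 addr0.
Qed.

(** * The tensor algebra *)

Section TensorAlgebra.
Variables (k : fieldType) (H : hopfAlg k) (L : lieData H).
Local Notation DL := (lie_hyd L).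
Local Notation T := (tensalg L).
Implicit Types (P Q : lmodType k) (x y : L) (s t : seq L) (a b c : T).

Lemma lin_tfold P (f : seq L -> P) : multilinear_map f -> lin (tfold f).
Proof. exact: tfold_linear. Qed.

Lemma lin_tfold_param P Q (F : Q -> seq L -> P) c :
  (forall s, lin (fun v => F v s)) -> lin (fun v : Q => tfold (F v) c).
Proof.
move=> lF r u v; rewrite /tfold /pfold /fsum scaler_sumr -big_split.
by apply: eq_bigr => p _; rewrite /= lF scalerDr !scalerA mulrC.
Qed.

Lemma tcons_tword x s : tcons x (tword s) = tword (x :: s).
Proof. by rewrite /tcons tfold_tword // => s1 s2; apply: (tword_multilinear (x :: s1)). Qed.

Lemma lin_tconsr x : lin (tcons x).
Proof. by apply: lin_tfold => s1 s2; apply: (tword_multilinear (x :: s1)). Qed.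
Lemma lin_tconsl c : lin (fun x => tcons x c).
Proof. by apply: lin_tfold_param => s; apply: (tword_multilinear [::]). Qed.
Lemma bilin_tcons : bilin (fun x c => tcons x c).
Proof. by split; [exact: lin_tconsr | exact: lin_tconsl]. Qed.

Lemma tensalg_ind (Q : T -> Prop) :
  (forall r a b, Q a -> Q b -> Q (r *: a + b)) -> Q (tword [::]) ->
  (forall x a, Q a -> Q (tcons x a)) -> forall a, Q a.
Proof.
move=> QD Q1 Qc a.
have Q0 : Q 0 by rewrite -[0](addNr (tword [::])) -scaleN1r; apply: QD.
rewrite [a]tensalg_tword; apply: subspace_sum => // p; apply: subspaceZ => //.
by elim: p.2 => // x s; rewrite -tcons_tword; apply: Qc.
Qed.

Hypothesis hmap_id : forall x, hmap DL x = x.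
Hypothesis hinv_id : forall x, hinv DL x = x.
Hypothesis yL : is_yd DL.
Let bt := bilin_tcons.

Ltac lin_T := match goal with
  | |- lin (fun z_ => tcons _ ?c) => apply (linI_bil c bt)
  | |- lin (fun z_ => tcons ?c _) => apply (linI_bir c bt)
  | |- lin (fun z_ => hact DL _ ?m) => apply (lin_actl yL m)
  | |- lin (fun z_ => hact DL ?m _) => apply (lin_actr yL m)
  | |- lin (fun z_ => hcoact DL _) => apply (lin_coact yL)
  end.
Ltac lin_db ::= lin_T.

Lemma map_idE (f : L -> L) s : (forall x, f x = x) -> map f s = s.
Proof. by move=> E; rewrite (eq_map E) map_id. Qed.

Lemma wmulE s t : @wmul _ _ L s t = s ++ t.
Proof.
have iterE n x : iter n (hmap DL) x = x by elim: n => //= n ->; rewrite hmap_id.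
case: s t => [|x s] [|y t] //=; rewrite ?hmap_id ?map_idE //.
  by rewrite cats0.
by rewrite iterE.
Qed.

Lemma tmulE a b : tmul a b = tfold (fun s => tfold (fun t => tword (s ++ t)) b) a.
Proof.
by rewrite /tmul; congr tfold; apply: funext => s; congr tfold; apply: funext => t;
  rewrite wmulE.
Qed.

Lemma multilinear_catr s : multilinear_map (fun t => tword (s ++ t)).
Proof.
move=> s1 s2; apply: lin_ext (tword_multilinear (s ++ s1) s2) => x.
by rewrite catA.
Qed.
Lemma multilinear_catl b : multilinear_map (fun s => tfold (fun t => tword (s ++ t)) b).
Proof.
move=> s1 s2; apply: lin_tfold_param => t.
by apply: lin_ext (tword_multilinear s1 (s2 ++ t)) => x; rewrite -catA.
Qed.

Lemma bilin_tmul : bilin (@tmul _ _ L).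
Proof.
split=> [a|b]; last first.
  by apply: (lin_ext (fun a => tmulE a b)); apply/lin_tfold/multilinear_catl.
apply: (lin_ext (tmulE a)).
by apply: lin_tfold_param => s; apply/lin_tfold/multilinear_catr.
Qed.

Lemma tmul_tword s t : tmul (tword s) (tword t) = tword (s ++ t) :> T.
Proof.
rewrite tmulE tfold_tword; last exact: multilinear_catl.
by rewrite tfold_tword //; apply: multilinear_catr.
Qed.

Let bm := bilin_tmul.
Ltac lin_Tmul := first [ lin_T | match goal with
  | |- lin (fun z_ => tmul _ ?c) => apply (linI_bil c bm)
  | |- lin (fun z_ => tmul ?c _) => apply (linI_bir c bm) end ].
Ltac lin_db ::= lin_Tmul.

Lemma tword_ext P (f g : T -> P) : lin f -> lin g ->
  (forall s, f (tword s) = g (tword s)) -> f =1 g.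
Proof.
move=> lf lg E a; rewrite [a]tensalg_tword /tfold /pfold /fsum !lin_sum //.
by apply: eq_bigr => p _; rewrite !lin_Z // E.
Qed.

Ltac tword_ind a := move: a;
  lazymatch goal with |- forall a, @?f a = @?g a =>
    apply (@tword_ext _ f g); [ lin | lin | intro; cbv beta ] end.

Lemma tmul1t a : tmul (tword [::]) a = a.
Proof. by tword_ind a; rewrite tmul_tword. Qed.
Lemma tmult1 a : tmul a (tword [::]) = a.
Proof. by tword_ind a; rewrite tmul_tword cats0. Qed.
Lemma tmulA a b c : tmul (tmul a b) c = tmul a (tmul b c).
Proof. by tword_ind a; tword_ind b; tword_ind c; rewrite !tmul_tword catA. Qed.
Lemma tconsE x a : tcons x a = tmul (tword [:: x]) a.
Proof. by tword_ind a; rewrite tmul_tword tcons_tword. Qed.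

Lemma lin_wact s : lin (fun h => wact h s).
Proof.
by elim: s => [|x s IH] /=; lin.
Qed.
Lemma multilinear_wact h : multilinear_map (wact h : seq L -> T).
Proof.
move=> s1 s2; elim: s1 h => [|y s1 IH] h; cbn [cat wact]; apply: linI_sw => h1 h2.
  by lin.
by apply: linI_bir => //; exact: IH.
Qed.

Lemma tact_tword h s : tact h (tword s) = wact h s :> T.
Proof. exact/tfold_tword/multilinear_wact. Qed.
Lemma bilin_tact : bilin (@tact _ _ L).
Proof.
split=> [h|a]; first exact/lin_tfold/multilinear_wact.
by apply: lin_tfold_param => s; apply: lin_wact.
Qed.
Let ba := bilin_tact.

Lemma tact_one h : tact h (tword [::]) = counit H h *: tword [::] :> T.
Proof. exact: tact_tword. Qed.

Ltac lin_Tact := first [ lin_Tmul | match goal with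
  | |- lin (fun z_ => tact _ ?c) => apply (linI_bil c ba)
  | |- lin (fun z_ => tact ?c _) => apply (linI_bir c ba) end ].
Ltac lin_db ::= lin_Tact.

Lemma tact_cons h x a : tact h (tcons x a) =
  \sw_(h1, h2 <- comul H h) tcons (hact DL h1 x) (tact h2 a).
Proof.
tword_ind a; rewrite tcons_tword tact_tword /=.
by apply: eq_sw => h1 h2; rewrite tact_tword.
Qed.

Lemma multilinear_wcoact : multilinear_map (@wcoact _ _ L).
Proof.
move=> s1 s2; elim: s1 => [|y s1 IH]; cbn [cat wcoact]; last first.
  apply: linI_sw => a y0; apply: linI_sweedler; first exact: IH.
  by lin.
by apply: linI_sweedler; lin.
Qed.
Lemma tcoact_tword s : tcoact (tword s) = wcoact s :> tensor H T.
Proof. exact/tfold_tword/multilinear_wcoact. Qed.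
Lemma lin_tcoact : lin (@tcoact _ _ L).
Proof. exact/lin_tfold/multilinear_wcoact. Qed.
Let lc := lin_tcoact.

Ltac lin_Tcoact := first [ lin_Tact | match goal with
  | |- lin (fun z_ => tcoact _) => apply (linI_comp lc) end ].
Ltac lin_db ::= lin_Tcoact.

Lemma tcoact_one : tcoact (tword [::]) = 1 ⊗ tword [::] :> tensor H T.
Proof. exact: tcoact_tword. Qed.
Lemma tcoact_cons x a : tcoact (tcons x a) =
  \sw_(u, x0 <- hcoact DL x) \sw_(v, a0 <- tcoact a) ((u * v) ⊗ tcons x0 a0).
Proof.
tword_ind a; rewrite tcons_tword tcoact_tword /=.
by apply: eq_sw => u x0; rewrite tcoact_tword.
Qed.

Lemma tmap_id a : tmap a = a.
Proof.
have -> : @tmap _ _ L = @tfold _ _ _ (@tword _ L).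
  by apply: funext => b; congr tfold; apply: funext => s; rewrite map_idE.
by rewrite -tensalg_tword.
Qed.
Lemma tinv_id a : tinv a = a.
Proof.
have -> : @tinv _ _ L = @tfold _ _ _ (@tword _ L).
  by apply: funext => b; congr tfold; apply: funext => s; rewrite map_idE.
by rewrite -tensalg_tword.
Qed.

Definition tens_hyd : hydData H T :=
  {| hmap := @tmap _ _ L; hinv := @tinv _ _ L;
     hact := @tact _ _ L; hcoact := @tcoact _ _ L |}.

(** Makes the results on generated algebras available for T(L): compatibility of the action and
    coaction with the product comes from there. *)
Lemma tensalg_generated :
  is_generated DL tens_hyd (@tmul _ _ L) (tword [::]) (fun x => tword [:: x]).
Proof.
split=> //=.
- exact: tmulA.
- exact: tmult1.
- exact: tmul1t.
- exact: (tword_multilinear [::]).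
- by move=> Q QD Q1 Qc; apply: tensalg_ind => // x a Qa; rewrite tconsE; apply: Qc.
- exact: tact_one.
- move=> h x u; rewrite -tconsE tact_cons.
  by apply: eq_sw => h1 h2; rewrite tconsE.
- exact: tcoact_one.
- move=> x u; rewrite -tconsE tcoact_cons.
  by do 2 apply: eq_sw => ? ?; rewrite tconsE.
- exact: tmap_id.
- exact: tinv_id.
Qed.
Let gT := tensalg_generated.

(** * The ideal of relations *)

Hypothesis braid_involutive : forall x y,
  \sw_(a, x0 <- hcoact DL x) \sw_(b, z <- hcoact DL (hact DL a y)) (hact DL b x0 ⊗ z)
  = x ⊗ y.
Local Notation br := (@lie_br _ _ L).
Hypothesis br_act : forall h x y,
  hact DL h (br x y) = \sw_(h1, h2 <- comul H h) br (hact DL h1 x) (hact DL h2 y).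
Hypothesis br_coact : forall x y, hcoact DL (br x y) =
  \sw_(a, x0 <- hcoact DL x) \sw_(b, y0 <- hcoact DL y) ((a * b) ⊗ br x0 y0).

Lemma lie_relE x y : lie_rel x y = tmul (tword [:: x]) (tword [:: y])
  - \sw_(a, x0 <- hcoact DL x) tmul (tword [:: hact DL a y]) (tword [:: x0])
  - tword [:: br x y].
Proof.
rewrite /lie_rel tmul_tword; congr (_ - _ - _).
by apply: eq_sw => a x0; rewrite tmul_tword !hmap_id.
Qed.

Lemma lin_tletter : lin (fun x => tword [:: x]).
Proof. exact: (tword_multilinear [::]). Qed.
Let ltl := lin_tletter.

Ltac lin_db ::= first [ lin_Tcoact | match goal with
  | |- lin (fun z_ => tword [:: _]) => apply (linI_comp ltl) end ].

Lemma tact_mul h a b : tact h (tmul a b) =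
  \sw_(h1, h2 <- comul H h) tmul (tact h1 a) (tact h2 b).
Proof. exact: (act_mul yL gT). Qed.
Lemma tcoact_mul a b : tcoact (tmul a b) =
  \sw_(u, a0 <- tcoact a) \sw_(v, b0 <- tcoact b) ((u * v) ⊗ tmul a0 b0).
Proof. exact: (coact_mul gT). Qed.
Lemma tact_letter h x : tact h (tword [:: x]) = tword [:: hact DL h x].
Proof. exact: (act_i yL gT). Qed.
Lemma tcoact_letter x : tcoact (tword [:: x]) =
  \sw_(a, x0 <- hcoact DL x) (a ⊗ tword [:: x0]).
Proof. exact: (coact_i gT). Qed.

Ltac leaf_hyp ::= progress rewrite ?tact_mul ?tcoact_mul ?tact_letter ?tcoact_letter
  ?br_act ?br_coact ?(yd_actM yL).

(** The three terms of a relation come from the product, the braiding and the bracket, all H-linear;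
    for the braiding this is the Yetter-Drinfeld condition. *)
Lemma tact_lie_rel h x y : tact h (lie_rel x y) =
  \sw_(h1, h2 <- comul H h) lie_rel (hact DL h1 x) (hact DL h2 y).
Proof.
under [RHS]eq_sw do rewrite lie_relE.
by rewrite lie_relE; sw_solve.
Qed.

Lemma tcoact_lie_rel x y : tcoact (lie_rel x y) =
  \sw_(a, x0 <- hcoact DL x) \sw_(b, y0 <- hcoact DL y) ((a * b) ⊗ lie_rel x0 y0).
Proof.
under [RHS]eq_sw do under eq_sw do rewrite lie_relE.
by rewrite lie_relE; sw_solve.
Qed.

Definition rel_ideal : T -> Prop :=
  lspan (fun c => exists a x y b, c = tmul a (tmul (lie_rel x y) b)).
Let J := rel_ideal.

Lemma rel_ideal_subspace : subspace J. Proof. exact: lspan_subspace. Qed.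
Let sJ := rel_ideal_subspace.

Lemma rel_ideal_gen a x y b : J (tmul a (tmul (lie_rel x y) b)).
Proof. by apply: lspan_gen; exists a, x, y, b. Qed.

Lemma rel_ideal_min (K : T -> Prop) : subspace K ->
  (forall a x y b, K (tmul a (tmul (lie_rel x y) b))) -> forall c, J c -> K c.
Proof. by move=> sK h c; apply: lspan_min => // _ [a [x [y [b ->]]]]. Qed.

Lemma rel_ideal_mull a c : J c -> J (tmul a c).
Proof.
move: c; apply: (@rel_ideal_min (fun c => J (tmul a c))).
  exact: (subspace_preim (bm.1 a) _).
by move=> b x y d; rewrite -tmulA; apply: rel_ideal_gen.
Qed.
Lemma rel_ideal_mulr c b : J c -> J (tmul c b).
Proof.
move: c; apply: (@rel_ideal_min (fun c => J (tmul c b))).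
  exact: (subspace_preim (bm.2 b) _).
by move=> a x y d; rewrite !tmulA; apply: rel_ideal_gen.
Qed.

Lemma rel_ideal_rel x y : J (lie_rel x y).
Proof. by rewrite -[lie_rel x y]tmult1 -[tmul _ _]tmul1t; apply: rel_ideal_gen. Qed.

Lemma rel_ideal_act h c : J c -> J (tact h c).
Proof.
move: c; apply: (@rel_ideal_min (fun c => J (tact h c))).
  exact: (subspace_preim (ba.1 h) _).
move=> a x y b; rewrite tact_mul; apply: subspace_sw => // h1 h2.
apply: rel_ideal_mull; rewrite tact_mul; apply: subspace_sw => // h3 h4.
apply: rel_ideal_mulr; rewrite tact_lie_rel; apply: subspace_sw => // h5 h6.
exact: rel_ideal_rel.
Qed.

Lemma rel_ideal_coact c : J c ->
  lspan (fun u => exists h c', J c' /\ u = h ⊗ c') (tcoact c).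
Proof.
pose K w := lspan (fun u : tensor H T => exists h c', J c' /\ u = h ⊗ c') w.
move: c; apply: (@rel_ideal_min (fun c => K (tcoact c))).
  exact: (subspace_preim lc (lspan_subspace _)).
move=> a x y b.
have -> : tcoact (tmul a (tmul (lie_rel x y) b)) =
  \sw_(u, a0 <- tcoact a) \sw_(u1, x0 <- hcoact DL x) \sw_(u2, y0 <- hcoact DL y)
  \sw_(v, b0 <- tcoact b)
    ((u * (u1 * u2 * v)) ⊗ tmul a0 (tmul (lie_rel x0 y0) b0)).
  rewrite tcoact_mul; apply: eq_sw => u a0.
  by rewrite tcoact_mul tcoact_lie_rel; swn; reflexivity.
have sK : subspace K by exact: lspan_subspace.
apply: (subspace_sw _ sK) => u a0.
apply: (subspace_sw _ sK) => u1 x0.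
apply: (subspace_sw _ sK) => u2 y0.
apply: (subspace_sw _ sK) => v b0.
by apply: lspan_gen; do 2 eexists; split; last by []; apply: rel_ideal_gen.
Qed.

Lemma prod_span_gen (A B : T -> Prop) a b : A a -> B b -> prod_span A B (tmul a b).
Proof. by move=> Aa Bb; apply: lspan_gen; exists a, b. Qed.
Lemma prod_span_min (A B K : T -> Prop) : subspace K ->
  (forall a b, A a -> B b -> K (tmul a b)) -> forall c, prod_span A B c -> K c.
Proof. by move=> sK h c; apply: lspan_min => // _ [a [b [Aa Bb ->]]]; apply: h. Qed.

Lemma rel_ideal_admissible : admissible_ideal J.
Proof.
have sP A B : subspace (@prod_span _ _ L A B) by exact: lspan_subspace.
split.
- exact: sJ.
- exact: rel_ideal_rel.
- exact: rel_ideal_act.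
- exact: rel_ideal_coact.
- by move=> c Jc; rewrite tmap_id tinv_id.
(* Both inclusions are checked on generators, where they reduce to (a j) b = a (j b). *)
- move=> c; split; apply: prod_span_min => //.
    move=> u b + _; move: u; pose K := prod_span (fun=> True) (prod_span J (fun=> True)).
    apply: (@prod_span_min _ _ (fun u => K (tmul u b))).
      exact: (subspace_preim (bm.2 b) (sP _ _)).
    move=> a j _ Jj; rewrite tmulA; apply: prod_span_gen => //.
    exact: prod_span_gen.
  move=> a u _; move: u; pose K := prod_span (prod_span (fun=> True) J) (fun=> True).
  apply: (@prod_span_min _ _ (fun u => K (tmul a u))).
    exact: (subspace_preim (bm.1 a) (sP _ _)).
  move=> j b Jj _; rewrite -tmulA; apply: prod_span_gen => //.
  exact: prod_span_gen.
- apply: prod_span_min => // u b + _; move: u.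
  apply: (@prod_span_min _ _ (fun u => J (tmul u b))).
    exact: (subspace_preim (bm.2 b) _).
  by move=> a j _ Jj; apply/rel_ideal_mulr/rel_ideal_mull.
Qed.

(** The span is itself admissible, hence contains the intersection; conversely [ideal_mul] puts
    every (a r) b into each admissible subspace. *)
Lemma lie_idealE c : lie_ideal c <-> J c.
Proof.
split; first by apply; apply: rel_ideal_admissible.
move=> Jc K aK; move: c Jc; apply: rel_ideal_min; first by case: aK.
move=> a x y b; apply: (ideal_mul aK); rewrite -tmulA.
by do 2 apply: prod_span_gen => //; apply: ideal_rel.
Qed.

Lemma lspan_lie_ideal c : lspan (@lie_ideal _ _ L) c <-> J c.
Proof.
split=> [|Jc]; last by apply: lspan_gen; apply/lie_idealE.
by apply: lspan_min => // d /lie_idealE.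
Qed.

(** * The quotient U(L) *)

Local Notation U := (envalg L).

Lemma uprojP a b : uproj a = uproj b <-> J (a - b).
Proof. by rewrite -lspan_lie_ideal; apply: vprojP. Qed.
Lemma lin_uproj : lin (@uproj _ _ L : T -> U).
Proof. exact: vproj_linear. Qed.
Lemma uprojK (u : U) : uproj (urepr u) = u.
Proof. exact: vproj_surj. Qed.
Lemma urepr_uproj a : J (urepr (uproj a) - a).
Proof. by apply/uprojP; rewrite uprojK. Qed.
Lemma uproj0 a : J a -> uproj a = 0 :> U.
Proof. by move=> Ja; rewrite -(lin_0 lin_uproj); apply/uprojP; rewrite subr0. Qed.

(** The structure maps of U(L) are computed on chosen representatives; this is what makes the choice
    immaterial for a linear map vanishing on the ideal. *)
Lemma urepr_factor P (f : T -> P) a : lin f -> (forall c, J c -> f c = 0) ->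
  f (urepr (uproj a)) = f a.
Proof.
move=> lf fJ; apply/eqP; rewrite -subr_eq0 -(lin_B lf); apply/eqP.
exact/fJ/urepr_uproj.
Qed.
Lemma lin_factor P (f : T -> P) : lin f -> (forall c, J c -> f c = 0) ->
  lin (fun u : U => f (urepr u)).
Proof.
move=> lf fJ r u v; rewrite -[in LHS](uprojK u) -[in LHS](uprojK v).
by rewrite -lin_uproj urepr_factor // lf.
Qed.

Lemma umulE a b : umul (uproj a) (uproj b) = uproj (tmul a b) :> U.
Proof.
rewrite /umul (urepr_factor (f := fun c => uproj (tmul c _))); last first.
- by move=> c Jc; apply/uproj0/rel_ideal_mulr.
- by have lu := lin_uproj; lin.
apply: (urepr_factor (f := fun c => uproj (tmul a c))).
- by have lu := lin_uproj; lin.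
- by move=> c Jc; apply/uproj0/rel_ideal_mull.
Qed.
Lemma uactE h a : hact (uhyd L) h (uproj a) = uproj (tact h a).
Proof.
apply: (urepr_factor (f := fun c => uproj (tact h c))).
- by have lu := lin_uproj; lin.
- by move=> c Jc; apply/uproj0/rel_ideal_act.
Qed.
Lemma ucoactE a : hcoact (uhyd L) (uproj a) = \sw_(u, c <- tcoact a) (u ⊗ uproj c).
Proof.
have lu := lin_uproj.
apply: (urepr_factor (f := fun c => \sw_(u, d <- tcoact c) (u ⊗ uproj d))).
- by lin.
- move=> c /rel_ideal_coact.
  apply: (@lspan_min _ _ _ (fun w => \sw_(u, d <- w) (u ⊗ uproj d) = 0)).
    by apply: (subspace_ker (f := fun w => \sw_(u, d <- w) (u ⊗ uproj d))); lin.
  move=> _ [h [c' [Jc' ->]]]; rewrite sw_tns; last by lin.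
  by rewrite uproj0 //; apply: (lin_0 (f := tns h)); lin.
Qed.

Lemma bilin_umul : bilin (@umul _ _ L).
Proof.
have lu := lin_uproj.
split=> [u|v].
  apply: (lin_factor (f := fun c => uproj (tmul (urepr u) c))); first by lin.
  by move=> c Jc; apply/uproj0/rel_ideal_mull.
apply: (lin_factor (f := fun c => uproj (tmul c (urepr v)))); first by lin.
by move=> c Jc; apply/uproj0/rel_ideal_mulr.
Qed.

Lemma envalg_generated :
  is_generated DL (uhyd L) (@umul _ _ L) (uone L) (@ulie _ _ L).
Proof.
have lu := lin_uproj.
split.
- exact: bilin_umul.
- by move=> u v w; rewrite -(uprojK u) -(uprojK v) -(uprojK w) !umulE tmulA.
- by move=> u; rewrite -(uprojK u) umulE tmult1.
- by move=> u; rewrite -(uprojK u) umulE tmul1t.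
- by rewrite /ulie; lin.
- move=> Q QD Q1 Qc u; rewrite -(uprojK u); move: (urepr u).
  apply: tensalg_ind => // [r a b Qa Qb|x a Qa]; first by rewrite lu; apply: QD.
  by rewrite tconsE -umulE; apply: Qc.
- split=> [h|u].
    apply: (lin_factor (f := fun c => uproj (tact h c))); first by lin.
    by move=> c Jc; apply/uproj0/rel_ideal_act.
  by rewrite /uhyd /=; lin.
- move=> r u v; rewrite -(uprojK u) -(uprojK v) -lu !ucoactE lc.
  have lsw : lin (fun w : tensor H T => \sw_(a, c <- w) (a ⊗ uproj c)) by lin.
  exact: lsw.
- by move=> h; rewrite /uone uactE tact_one (lin_Z _ lu).
- move=> h x u; rewrite -(uprojK u) umulE uactE tact_mul.
  rewrite (sw_map _ _ lu); apply: eq_sw => h1 h2.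
  by rewrite tact_letter -umulE uactE.
- by rewrite /uone ucoactE tcoact_one sw_tns //; lin.
- move=> x u; rewrite -(uprojK u) umulE !ucoactE tcoact_mul tcoact_letter.
  have bU := bilin_umul; swn; swnr.
  by do 2 apply: eq_sw => ? ?; rewrite -umulE.
- by move=> u; rewrite /= tmap_id uprojK.
- by move=> u; rewrite /= tinv_id uprojK.
Qed.
Let gU := envalg_generated.

(** * Linear maps out of U(L) by recursion on letters *)

Section Recursion.
Variables (P : lmodType k) (p0 : P) (op : L -> P -> P).
Hypothesis bop : bilin op.
Hypothesis op_rel : forall x y p, op x (op y p) =
  \sw_(a, x0 <- hcoact DL x) op (hact DL a y) (op x0 p) + op (br x y) p.

(** As T(L) is free, [op] makes P a left T(L)-module, and this is the map sending a to a . p0. The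
    hypothesis [op_rel] says that the module structure descends to U(L). *)
Definition trec : T -> P := tfold (foldr op p0).

Lemma multilinear_foldr : multilinear_map (foldr op p0 : seq L -> P).
Proof.
move=> s1 s2; elim: s1 => [|y s1 IH] /=; first exact: bop.2.
by apply: linI_bir.
Qed.
Lemma lin_trec : lin trec. Proof. exact/lin_tfold/multilinear_foldr. Qed.
Let ltr := lin_trec.
Lemma trec_one : trec (tword [::]) = p0.
Proof. exact/tfold_tword/multilinear_foldr. Qed.
Lemma trec_cons x a : trec (tcons x a) = op x (trec a).
Proof.
tword_ind a; rewrite tcons_tword /trec !tfold_tword //; exact: multilinear_foldr.
Qed.
Lemma trec_letter x a : trec (tmul (tword [:: x]) a) = op x (trec a).
Proof. by rewrite -tconsE trec_cons. Qed.

Lemma trec_rel_ideal c : J c -> trec c = 0.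
Proof.
(* Letters of the left factor a are applied last, so peeling them off reduces a r b to r b, which
   [op_rel] kills. *)
move: c; apply: (rel_ideal_min (subspace_ker ltr)) => a x y b; move: a.
apply: tensalg_ind => [r a a' Ea Ea'||z a Ea].
- by rewrite bm.2 ltr Ea Ea' scaler0 addr0.
- rewrite tmul1t lie_relE.
  have -> : forall u v w, tmul (u - v - w) b = tmul u b - tmul v b - tmul w b.
    by move=> u v w; rewrite !(lin_B (bm.2 b)).
  rewrite !(lin_B ltr) tmulA !trec_letter op_rel.
  rewrite (sw_map _ _ (bm.2 b)) (sw_map _ _ ltr).
  under [X in _ - X - _]eq_sw do rewrite tmulA !trec_letter.
  by rewrite addrAC addrK subrr.
- by rewrite tconsE tmulA trec_letter Ea (lin_0 (bop.1 z)).
Qed.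

Definition urec (u : U) : P := trec (urepr u).

Lemma lin_urec : lin urec.
Proof. by apply: lin_factor => // c; apply: trec_rel_ideal. Qed.
Lemma urec_uproj a : urec (uproj a) = trec a.
Proof. by apply: urepr_factor => // c; apply: trec_rel_ideal. Qed.
Lemma urec_one : urec (uone L) = p0.
Proof. by rewrite urec_uproj trec_one. Qed.
Lemma urec_cons x u : urec (umul (ulie x) u) = op x (urec u).
Proof. by rewrite -(uprojK u) umulE !urec_uproj trec_letter. Qed.

End Recursion.

(** * The structure maps of U(L) *)

Local Notation mul := (@umul _ _ L).
Local Notation one := (uone L).
Local Notation i := (@ulie _ _ L).
Local Notation D := (uhyd L).
Let bU := bilin_umul.
Let li := gen_lin gU.
Let bact := gen_act_bilin gU.
Let yU : is_yd D := yd_B yL gU.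

Ltac lin_db ::= match goal with
  | |- lin (fun z_ => mul _ ?c) => apply (linI_bil c bU)
  | |- lin (fun z_ => mul ?c _) => apply (linI_bir c bU)
  | |- lin (fun z_ => i _) => apply (linI_comp li)
  | |- lin (fun z_ => hact (uhyd L) _ ?c) => apply (linI_bil c bact)
  | |- lin (fun z_ => hact (uhyd L) ?c _) => apply (linI_bir c bact)
  | |- lin (fun z_ => hact (lie_hyd L) _ ?m) => apply (lin_actl yL m)
  | |- lin (fun z_ => hact (lie_hyd L) ?m _) => apply (lin_actr yL m)
  | |- lin (fun z_ => hcoact (lie_hyd L) _) => apply (lin_coact yL)
  end.

Lemma umul_rel x y u : mul (i x) (mul (i y) u) =
  \sw_(a, x0 <- hcoact DL x) mul (i (hact DL a y)) (mul (i x0) u) +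
  mul (i (br x y)) u.
Proof.
have lu := lin_uproj.
rewrite -(gen_mulA gU) umulE; have := uproj0 (rel_ideal_rel x y).
rewrite lie_relE !(lin_B lu) (sw_map _ _ lu) => /eqP.
rewrite !subr_eq add0r => /eqP->.
rewrite (lin_add (bU.2 u)) (sw_map _ _ (bU.2 u)) addrC; congr (_ + _).
by apply: eq_sw => a x0; rewrite -umulE (gen_mulA gU).
Qed.

(** Left multiplication by x ⊗ 1 + 1 ⊗ x in the braided product on U(L) ⊗ U(L), written out. *)
Definition ucomul_op x (w : tensor U U) : tensor U U :=
  \sw_(u1, u2 <- w) (mul (i x) u1 ⊗ u2) +
  \sw_(u1, u2 <- w) \sw_(a, x0 <- hcoact DL x) (hact D a u1 ⊗ mul (i x0) u2).
Definition uantipode_op x (w : U) : U :=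
  - \sw_(a, x0 <- hcoact DL x) mul (hact D a w) (i x0).

Lemma bilin_ucomul_op : bilin ucomul_op.
Proof. by rewrite /ucomul_op; lin. Qed.
Lemma bilin_uantipode_op : bilin uantipode_op.
Proof. by rewrite /uantipode_op; lin. Qed.

Ltac leaf_hyp ::= progress rewrite ?(gen_mulA gU) ?(gen_mulr1 gU) ?(gen_mul1r gU)
  ?(gen_act_one gU) ?(act_i yL gU) ?(act_mul yL gU)
  ?br_act ?br_coact ?(yd_actM yL) ?(yd_act1 yL) ?(yd_actM yU) ?(yd_act1 yU).
Ltac sw_solve ::= swn; swnr; sw_match; rewrite ?mulrA ?(gen_mulA gU); try reflexivity.

(** The mixed term (x ⊗ 1)(1 ⊗ y) must reappear as (1 ⊗ y')(x' ⊗ 1) with y' ⊗ x' = C(x ⊗ y). Moving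
    y' past x' braids once more, so the two agree by C^2 = id. *)
Lemma ucomul_op_cross x y u v :
  \sw_(a, x0 <- hcoact DL x) \sw_(b, z <- hcoact DL (hact DL a y))
    (hact D b (mul (i x0) u) ⊗ mul (i z) v) =
  \sw_(b, y0 <- hcoact DL y) (mul (i x) (hact D b u) ⊗ mul (i y0) v).
Proof.
pose F m n := \sw_(e, n0 <- hcoact DL n) (mul (i m) (hact D e u) ⊗ mul (i n0) v).
have bF : bilin F by rewrite /F; lin.
transitivity (\sw_(a, x0 <- hcoact DL x) \sw_(b, z <- hcoact DL (hact DL a y))
  F (hact DL b x0) z).
  by apply: eq_sw => a x0; rewrite /F; move: (hact DL a y) => y'; sw_solve.
transitivity (F x y); last by [].
transitivity (sweedler (x ⊗ y) F); last by rewrite sw_tns.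
rewrite -braid_involutive sw_bind //; apply: eq_sw => a x0.
by rewrite sw_bind //; apply: eq_sw => b z; rewrite sw_tns.
Qed.

Lemma ucomul_op_rel x y w : ucomul_op x (ucomul_op y w) =
  \sw_(a, x0 <- hcoact DL x) ucomul_op (hact DL a y) (ucomul_op x0 w) +
  ucomul_op (br x y) w.
Proof.
have bo := bilin_ucomul_op.
tensor_ind w; rewrite /ucomul_op.
swn; rewrite umul_rel -(ucomul_op_cross x y a b).
(* The defining relation again, now for the term in which both letters act on the second tensor
   factor. *)
sw (idtac; lazymatch goal with |- _ ⊗ umul (ulie ?p) (umul (ulie ?q) ?r) = _ =>
  rewrite (umul_rel p q r); reflexivity end).
swn; swnr.
(* Here [r] and [f] are the bracket terms of the two tensor factors, and [c] and [d] are the two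
   mixed terms. *)
have AC (V : zmodType) (t r c d e f : V) :
  t + r + c + (d + (e + f)) = t + d + (c + e) + (r + f).
  rewrite -!addrA; congr (_ + _); rewrite [RHS]addrCA [LHS]addrCA; congr (_ + _).
  by rewrite [LHS]addrCA; congr (_ + _); exact: addrCA.
by rewrite AC; sw_match.
Qed.

Lemma uantipode_op_rel x y w : uantipode_op x (uantipode_op y w) =
  \sw_(a, x0 <- hcoact DL x) uantipode_op (hact DL a y) (uantipode_op x0 w) +
  uantipode_op (br x y) w.
Proof.
have bo := bilin_uantipode_op.
have E p q : mul (i p) (i q) =
    \sw_(a, p0 <- hcoact DL p) mul (i (hact DL a q)) (i p0) + i (br p q).
  have := umul_rel p q one; rewrite !(gen_mulr1 gU) => ->; congr (_ + _).
  by apply: eq_sw => a p0; rewrite (gen_mulr1 gU).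
(* Composing the two operators multiplies the letters in braided order; by [E] this product is x_0
   y_0 - [x_0, y_0], and the bracket part accounts for the operator of [x, y]. *)
transitivity (\sw_(a, x0 <- hcoact DL x) \sw_(b, y0 <- hcoact DL y)
  mul (hact D (a * b) w) (mul (i x0) (i y0) - i (br x0 y0))).
  rewrite /uantipode_op.
  transitivity (\sw_(a, x0 <- hcoact DL x) \sw_(b, y0 <- hcoact DL y)
    mul (hact D (a * b) w) (\sw_(c, x1 <- hcoact DL x0) mul (i (hact DL c y0)) (i x1))).
    by swnr; swn; rewrite !opprK; sw_match.
  by do 2 apply: eq_sw => ? ?; rewrite E addrK.
rewrite /uantipode_op.
transitivity (\sw_(a, x0 <- hcoact DL x) \sw_(b, y0 <- hcoact DL y)
  mul (hact D (a * b) w) (mul (i x0) (i y0)) -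
  \sw_(a, x0 <- hcoact DL (br x y)) mul (hact D a w) (i x0)).
  by swn; swnr; sw_match.
congr (_ + _).
(* The remaining sum is [F] at x ⊗ y. Evaluating [F] on C^2(x ⊗ y) instead supplies the braided pair
   on which the nested operators of the goal act. *)
pose F m n := \sw_(a, m0 <- hcoact DL m) \sw_(b, n0 <- hcoact DL n)
  mul (hact D (a * b) w) (mul (i m0) (i n0)).
have bF : bilin F by rewrite /F; lin.
transitivity (F x y); first by [].
transitivity (sweedler (x ⊗ y) F); first by rewrite sw_tns.
rewrite -braid_involutive sw_bind //; apply: eq_sw => a x0.
rewrite sw_bind //.
transitivity (\sw_(b, z <- hcoact DL (hact DL a y)) F (hact DL b x0) z).
  by apply: eq_sw => b z; rewrite sw_tns.
by rewrite /F; move: (hact DL a y) => y'; swn; swnr; rewrite !opprK; sw_match.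
Qed.

Lemma ucounit_op_rel x y (c : k^o) : (0 : k^o) = \sw_(a, x0 <- hcoact DL x) 0 + 0.
Proof. by rewrite sw_0 addr0. Qed.

Theorem enveloping_uhopf : exists E : uhopfMaps L, is_uhopf E.
Proof.
pose Delta := urec (one ⊗ one) ucomul_op.
pose eps : U -> k := urec (P := k^o) 1 (fun _ _ => 0).
pose S := urec one uantipode_op.
have b0 : @bilin k L k^o k^o (fun _ _ => 0) by split=> ?; lin.
have e0 := ucounit_op_rel.
have lD : lin Delta := lin_urec _ bilin_ucomul_op ucomul_op_rel.
have le : @lin k U k^o eps := lin_urec _ b0 e0.
have lS : lin S := lin_urec _ bilin_uantipode_op uantipode_op_rel.
have D1 : Delta one = one ⊗ one := urec_one _ bilin_ucomul_op ucomul_op_rel.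
have Dc x u : Delta (mul (i x) u) = ucomul_op x (Delta u) :=
  urec_cons _ bilin_ucomul_op ucomul_op_rel x u.
have eps1 : eps one = 1 := urec_one _ b0 e0.
have epsc x u : eps (mul (i x) u) = 0 := urec_cons _ b0 e0 x u.
have S1 : S one = one := urec_one _ bilin_uantipode_op uantipode_op_rel.
have Sc x u : S (mul (i x) u) = uantipode_op x (S u) :=
  urec_cons _ bilin_uantipode_op uantipode_op_rel x u.
exists (UHopfMaps Delta eps S); split=> /=.
- exact: (generated_hyd_hopf yL gU lD le lS D1 Dc eps1 epsc S1 Sc).
- move=> x; rewrite tmap_id uprojK.
  exact: (Delta_i yL gU D1 Dc).
- by move=> x; rewrite -[i x](gen_mulr1 gU).
- move=> x; rewrite -[i x](gen_mulr1 gU) Sc S1 /uantipode_op.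
  by swn; rewrite (gen_mulr1 gU).
- move=> u v; rewrite (S_mul yL gU lS S1 Sc).
  by apply: eq_sw => a u0; rewrite tinv_id tmap_id !uprojK.
Qed.

End TensorAlgebra.

(** * Endomorphisms of an involutive module *)

Section Evaluation.
Variables (k : fieldType) (V : vectType k) (E : lmodType k) (ev : E -> V -> V).
Variables (n : nat) (e : 'I_n -> V) (q : 'I_n -> V -> E).
Hypothesis lev : forall v, lin (ev^~ v).
Hypothesis lq : forall j, lin (q j).
(* Tensors with a space of operators on V are determined by their values at the
   vectors of a basis, as soon as operators can be recovered linearly from them. *)
Hypothesis evK : forall g, g = \sum_j q j (ev g (e j)).
Implicit Types (M N : lmodType k).

Lemma lin_bigsum M N (I : Type) (r : seq I) (f : I -> M -> N) :
  (forall j, lin (f j)) -> lin (fun x => \sum_(j <- r) f j x).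
Proof.
move=> lf a x y; rewrite scaler_sumr -big_split; apply: eq_bigr => j _.
exact: lf.
Qed.

Lemma linI_ev M (F : M -> E) v : lin F -> lin (fun z => ev (F z) v).
Proof. exact: (linI_comp (lev v)). Qed.
Lemma linI_q M (F : M -> V) j : lin F -> lin (fun z => q j (F z)).
Proof. exact: (linI_comp (lq j)). Qed.
Ltac lin_db ::= match goal with
  | |- lin (fun z_ => ev _ ?v) => apply (linI_ev v)
  | |- lin (fun z_ => q ?j _) => apply (linI_q j)
  end.

Lemma eval_ext M (s t : tensor M E) :
  (forall v, \sw_(a, g <- s) (a ⊗ ev g v) = \sw_(a, g <- t) (a ⊗ ev g v)) -> s = t.
Proof.
move=> st.
(* Each tensor is rebuilt from its values at the vectors [e j] by applying [q j] to the second
   leg. *)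
have K : forall w : tensor M E,
    w = \sum_j \sw_(a, u <- \sw_(a, g <- w) (a ⊗ ev g (e j))) (a ⊗ q j u).
  apply: tensor_ext; first by lin.
    by apply: lin_bigsum => j; lin.
  move=> a g; rewrite [in LHS](evK g) (lin_sum _ _ (f := tns a)); last by lin.
  by apply: eq_bigr => j _; rewrite !sw_tns //; lin.
by rewrite (K s) (K t); apply: eq_bigr => j _; rewrite st.
Qed.

Lemma eval_ext3 M N (s t : tensor M (tensor N E)) :
  (forall v, \sw_(a, u <- s) \sw_(b, g <- u) (a ⊗ (b ⊗ ev g v)) =
             \sw_(a, u <- t) \sw_(b, g <- u) (a ⊗ (b ⊗ ev g v))) -> s = t.
Proof.
move=> st.
pose K (w : tensor M (tensor N V)) j :=
  \sw_(a, u <- w) \sw_(b, v <- u) (a ⊗ (b ⊗ q j v)).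
have lK j : lin (fun w => K w j) by rewrite /K; lin.
have EK : forall w : tensor M (tensor N E),
    w = \sum_j K (\sw_(a, u <- w) \sw_(b, g <- u) (a ⊗ (b ⊗ ev g (e j)))) j.
  apply: tensor_ext; first by lin.
    apply: lin_bigsum => j; apply: (linI_comp (lK j)); lin.
  move=> a; apply: tensor_ext; first by lin.
    apply: lin_bigsum => j; apply: (linI_comp (lK j)); lin.
  move=> b g; rewrite [in LHS](evK g).
  rewrite (lin_sum _ _ (f := fun g => a ⊗ (b ⊗ g))); last by lin.
  by apply: eq_bigr => j _; rewrite /K; do !(rewrite sw_tns; last by lin).
by rewrite (EK s) (EK t); apply: eq_bigr => j _; rewrite st.
Qed.

End Evaluation.

(** * Action, coaction, bracket and braiding of End(V) *)

Section Endomorphisms.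
Variables (k : fieldType) (H : hopfAlg k) (Sinv : H -> H).
Hypothesis (SK : cancel (antipode H) Sinv) (SinvK : cancel Sinv (antipode H)).
Variables (V : vectType k) (Y : hyd H V).
Hypothesis invol : forall v : V, hmap Y (hmap Y v) = v.
Local Notation ν := (hmap Y).
Local Notation E := (endo Y).
Let lS : lin Sinv := lin_Sinv SK SinvK.
Let lν : lin ν := hmap_linear Y.

Lemma hinv_invol v : hinv Y v = ν v.
Proof. by case: (hyd_autom (hydP Y)) => _ K _; rewrite -[v in LHS]invol K. Qed.

(* Twisting by the involution turns V into an ordinary Yetter-Drinfeld module. *)
Definition untwist : hydData H V := {|
  hmap := id; hinv := id;
  hact := fun h v => hact Y h (ν v);
  hcoact := fun v => \sw_(a, v0 <- hcoact Y v) (a ⊗ ν v0)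
|}.
Local Notation X := untwist.

Lemma untwist_actE h v : hact X h v = hact Y h (ν v). Proof. by []. Qed.
Lemma untwist_coactE v : hcoact X v = \sw_(a, v0 <- hcoact Y v) (a ⊗ ν v0).
Proof. by []. Qed.

Lemma untwist_yd : is_yd X.
Proof.
have hY := hydP Y.
have ba : bilin (hact Y) := hyd_act_bilin hY.
have lc : lin (hcoact Y) := hyd_coact_lin hY.
split.
- by rewrite /=; lin.
- by move=> h g m; rewrite /= (hyd_act_map hY) invol (hyd_actM hY).
- by move=> m; rewrite /= (hyd_act1 hY) invol.
- by rewrite /=; lin.
- move=> m; rewrite untwist_coactE; swn; swnr.
  swr (use untwist_coactE); swnr; swr (use (hyd_coact_map hY)); swnr.
  under [RHS]eq_sw do under eq_sw do rewrite invol.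
  rewrite -(hyd_coact_coassoc hY).
  by do 2 apply: eq_sw => ? ?; rewrite hinv_invol.
- move=> m; rewrite untwist_coactE; swn.
  transitivity (ν (hinv Y m)); last by rewrite hinv_invol invol.
  rewrite -(hyd_coact_counit hY) (sw_map _ _ lν).
  by apply: eq_sw => a b; rewrite (lin_Z _ lν).
- move=> h m; rewrite untwist_actE !untwist_coactE (hyd_compat hY) (hyd_coact_map hY).
  swn; swr (use untwist_actE); swnr; do 3 apply: eq_sw => ? ?.
  by rewrite (hyd_act_map hY).
Qed.

Lemma untwist_sym : symmetric_braiding Sinv Y -> braid_sym Sinv X X.
Proof.
have hY := hydP Y.
have ba : bilin (hact Y) := hyd_act_bilin hY.
have lc : lin (hcoact Y) := hyd_coact_lin hY.
move=> sY m n; rewrite !untwist_coactE.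
sw (use untwist_actE); swn; swr (use untwist_actE); swnr.
have := sY m n.
under eq_sw do rewrite hinv_invol.
by under [X in _ = X -> _]eq_sw do rewrite hinv_invol.
Qed.

Let yX := untwist_yd.

Lemma lin_endo (f : E) : lin f.
Proof. exact: linearP. Qed.
Lemma lin_endo_eval v : lin (fun f : E => f v).
Proof. by move=> a f g; rewrite /= !lfunE /= !lfunE. Qed.

Ltac lin_V := match goal with
  | |- lin (fun z_ => fun_of_lfun (endo_val ?f) _) => apply (linI_comp (lin_endo f))
  | |- lin (fun z_ => fun_of_lfun (endo_val _) ?v) => apply (linI_comp (lin_endo_eval v))
  | h : is_yd ?D |- lin (fun z_ => hact ?D _ ?m) => apply (lin_actl h m)
  | h : is_yd ?D |- lin (fun z_ => hact ?D ?m _) => apply (lin_actr h m)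
  | h : is_yd ?D |- lin (fun z_ => hcoact ?D _) => apply (lin_coact h)
  end.
Ltac lin_db ::= lin_V.

Lemma endo_actE h (f : E) v : endo_act h f v =
  \sw_(h1, h2 <- comul H h) hact X h1 (f (hact X (antipode H h2) v)).
Proof.
rewrite endo_ofE; apply: (@eq_sw k H H V) => h1 h2; rewrite !untwist_actE -endo_comm.
by rewrite (hyd_act_map (hydP Y)) invol.
Qed.

Definition endo_coact_eval (f : V -> V) v : tensor H V :=
  \sw_(a, v0 <- hcoact X v) \sw_(b, w <- hcoact X (f v0)) ((b * Sinv a) ⊗ w).

(** Untwisting inserts ν once in each of the two coactions; as f commutes with ν, the two meet and
    cancel. *)
Lemma endo_coact_evalE (f : E) v : endo_coact_eval f v =
  \sw_(a, v0 <- hcoact Y v) \sw_(b, w <- hcoact Y (f v0)) ((b * Sinv a) ⊗ w).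
Proof.
have lc : lin (hcoact Y) := hyd_coact_lin (hydP Y).
rewrite /endo_coact_eval untwist_coactE; swn; apply: eq_sw => a v0.
rewrite untwist_coactE endo_comm (hyd_coact_map (hydP Y)); swn.
by apply: eq_sw => ? ?; rewrite invol.
Qed.

Let n := \dim {:V}.
Let e (j : 'I_n) : V := (vbasis {:V})`_j.
Let cf (j : 'I_n) (v : V) : k := coord (vbasis {:V}) j v.

Definition rank1 (j : 'I_n) (w : V) : 'End(V) := linfun (fun v => cf j v *: w).
Lemma rank1E j w v : rank1 j w v = cf j v *: w.
Proof.
by rewrite /rank1 linfunE_linear // => a x y; rewrite /cf linearP scalerDl scalerA.
Qed.
Lemma vbasisE v : v = \sum_j cf j v *: e j.
Proof. exact: coord_vbasis (memvf v). Qed.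

Lemma lin_rank1 j : lin (rank1 j).
Proof.
move=> a x y; apply/lfunP => v; rewrite !lfunE /= !lfunE /= !rank1E.
by rewrite scalerDr !scalerA mulrC.
Qed.

(** The commutator of g with ν, whose kernel is [endo]. Projecting onto this kernel through a
    section, rather than averaging g with ν g ν, avoids a division by 2 and so covers characteristic
    2. *)
Definition comm_end (g : 'End(V)) : 'End(V) := linfun (fun v => g (ν v) - ν (g v)).
Lemma comm_endE g v : comm_end g v = g (ν v) - ν (g v).
Proof.
rewrite /comm_end linfunE_linear // => a x y.
by rewrite !linearP /= scalerBr scalerN addrACA.
Qed.

Lemma lin_comm_end : lin comm_end.
Proof.
move=> a f g; apply/lfunP => v; rewrite !lfunE /= !lfunE /= !comm_endE.
by rewrite !lfunE /= !lfunE /= scalerBr linearP opprD addrACA.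
Qed.

Let ad : 'End('End(V)) := linfun comm_end.
Lemma adE g : ad g = comm_end g.
Proof. by rewrite /ad linfunE_linear //; apply: lin_comm_end. Qed.

(* (ad^-1)%VF is a linear section of ad over its image, so this is a linear
   projection of End(V) onto the endomorphisms commuting with ν. *)
Definition comm_part (g : 'End(V)) : 'End(V) := g - (ad^-1)%VF (ad g).

Lemma comm_part_endo g : comm_part g \in hom_endo Y.
Proof.
apply/asboolP => v; apply/eqP; rewrite -subr_eq0 -comm_endE -adE.
rewrite /comm_part linearB /= limg_lfunVK; last exact/memv_img/memvf.
by rewrite subrr lfunE.
Qed.

Lemma comm_part_id (f : E) : comm_part f = f.
Proof.
rewrite /comm_part (_ : ad f = 0) ?linear0; first by rewrite ?oppr0 addr0.
by apply/lfunP => v; rewrite adE comm_endE endo_comm subrr lfunE.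
Qed.

Lemma lin_comm_part : lin comm_part.
Proof. by move=> a f g; rewrite /comm_part !linearP /= scalerBr scalerN addrACA. Qed.

Definition endo_part (g : 'End(V)) : E := Endo (comm_part_endo g).
Lemma lin_endo_part : lin endo_part.
Proof. by move=> a f g; apply: val_inj; rewrite /= lin_comm_part. Qed.

Lemma lin_endo_rank1 j : lin (fun w => endo_part (rank1 j w)).
Proof. exact: linI_comp lin_endo_part (lin_rank1 j). Qed.

Lemma rank1_sum (g : 'End(V)) : g = \sum_j rank1 j (g (e j)).
Proof.
apply/lfunP => v; rewrite sum_lfunE [in LHS](vbasisE v) linear_sum.
by apply: eq_bigr => j _; rewrite rank1E linearZ.
Qed.

Lemma endo_rank1_sum (f : E) : f = \sum_j endo_part (rank1 j (f (e j))).
Proof.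
rewrite -(lin_sum _ _ lin_endo_part) -rank1_sum; apply: val_inj => /=.
by rewrite comm_part_id.
Qed.

Lemma endo_ext (M : lmodType k) (s t : tensor M E) :
  (forall v, \sw_(a, g <- s) (a ⊗ g v) = \sw_(a, g <- t) (a ⊗ g v)) -> s = t.
Proof.
exact: (@eval_ext k V E (fun f v => f v) n e (fun j w => endo_part (rank1 j w))
  lin_endo_eval lin_endo_rank1 endo_rank1_sum).
Qed.

Lemma endo_ext3 (M N : lmodType k) (s t : tensor M (tensor N E)) :
  (forall v, \sw_(a, u <- s) \sw_(b, g <- u) (a ⊗ (b ⊗ g v)) =
             \sw_(a, u <- t) \sw_(b, g <- u) (a ⊗ (b ⊗ g v))) -> s = t.
Proof.
exact: (@eval_ext3 k V E (fun f v => f v) n e (fun j w => endo_part (rank1 j w))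
  lin_endo_eval lin_endo_rank1 endo_rank1_sum).
Qed.

Lemma lin_End_eval v : lin (fun g : 'End(V) => g v).
Proof. by move=> a f g; rewrite !lfunE /= !lfunE. Qed.

Lemma End_ext (M : lmodType k) (s t : tensor M 'End(V)) :
  (forall v, \sw_(a, g <- s) (a ⊗ g v) = \sw_(a, g <- t) (a ⊗ g v)) -> s = t.
Proof.
exact: (@eval_ext k V 'End(V) (fun f v => f v) n e rank1
  lin_End_eval lin_rank1 rank1_sum).
Qed.

Lemma lin_lfun (g : 'End(V)) : lin g.
Proof. exact: linearP. Qed.

Ltac lin_db ::= first [ lin_V | match goal with
  | |- lin (fun z_ => fun_of_lfun ?f _) => apply (linI_comp (lin_lfun f))
  | |- lin (fun z_ => fun_of_lfun _ ?v) => apply (linI_comp (lin_End_eval v))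
  end ].

Lemma lin_endo_coact_eval f : lin f -> lin (endo_coact_eval f).
Proof. by move=> lf; rewrite /endo_coact_eval; lin. Qed.

Lemma sw_basis_expand (P : lmodType k) (R : V -> tensor H V) (F : H -> V -> P) u :
  lin R -> bilin F ->
  \sum_j \sw_(a, w <- R (e j)) (cf j u *: F a w) = \sw_(a, w <- R u) F a w.
Proof.
move=> lR bF; have lRF : lin (fun v => sweedler (R v) F) by lin.
rewrite [in RHS](vbasisE u) (lin_sum _ _ lRF); apply: eq_bigr => j _.
by rewrite sw_scale (lin_Z _ lRF).
Qed.

(** This equivariance is what allows the coaction to land in H ⊗ [endo] and not merely in H ⊗
    'End(V). *)
Lemma endo_coact_eval_map (f : E) v :
  endo_coact_eval f (ν v) = \sw_(a, w <- endo_coact_eval f v) (a ⊗ ν w).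
Proof.
have lc : lin (hcoact Y) := hyd_coact_lin (hydP Y).
rewrite !endo_coact_evalE (hyd_coact_map (hydP Y)).
swn; swnr; apply: eq_sw => a v0.
by rewrite endo_comm (hyd_coact_map (hydP Y)); swn; reflexivity.
Qed.

Lemma endo_coact_exists (f : E) : exists t : tensor H E,
  forall v, \sw_(a, g <- t) (a ⊗ g v) = endo_coact_eval f v.
Proof.
have lR := lin_endo_coact_eval (lin_endo f).
have lr := lin_rank1; have lp := lin_endo_part.
(* Dual basis expansion: an operator is the sum of the elementary operators sending e_j to its value
   there, here projected into [endo]. *)
exists (\sum_j \sw_(a, w <- endo_coact_eval f (e j)) (a ⊗ endo_part (rank1 j w))) => v.
have lev : lin (fun t : tensor H E => \sw_(a, g <- t) (a ⊗ g v)) by lin.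
(* The total correction made by the projections is ad^-1 applied to the second leg of [Z]. It is
   zero because the unprojected sum already commutes with ν. *)
pose Z := \sum_j \sw_(a, w <- endo_coact_eval f (e j)) (a ⊗ ad (rank1 j w)).
have Z0 : Z = 0.
  apply: End_ext => u.
  have lZ : lin (fun t : tensor H 'End(V) => \sw_(a, g <- t) (a ⊗ g u)) by lin.
  rewrite (lin_0 lZ) (lin_sum _ _ lZ) /=.
  transitivity (\sum_j \sw_(a, w <- endo_coact_eval f (e j)) (cf j (ν u) *: (a ⊗ w))
    - \sum_j \sw_(a, w <- endo_coact_eval f (e j)) (cf j u *: (a ⊗ ν w))).
    rewrite -sumrB; apply: eq_bigr => j _.
    rewrite (sw_map _ _ lZ) -sw_opp -sw_add; apply: eq_sw => a w.
    rewrite sw_tns; last by lin.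
    rewrite adE comm_endE !rank1E (lin_Z _ lν).
    rewrite (lin_B (f := tns a)); last by lin.
    by rewrite !(lin_Z _ (f := tns a)) //; lin.
  rewrite !sw_basis_expand //; [|by lin|by lin].
  by rewrite endo_coact_eval_map -tensor_tns subrr.
rewrite (lin_sum _ _ lev).
have bA : bilin (fun (a : H) (g : 'End(V)) => a ⊗ (ad^-1)%VF g v).
  have la : lin (fun g => (ad^-1)%VF g) by move=> ? ? ?; rewrite linearP.
  by split=> [a|g]; [apply: linI_tnsr; apply: (linI_comp (lin_End_eval v)) | lin].
have lA : lin (fun t : tensor H 'End(V) => \sw_(a, g <- t) (a ⊗ (ad^-1)%VF g v)).
  by apply: linI_sweedler => //; lin.
transitivity (\sum_j \sw_(a, w <- endo_coact_eval f (e j)) (cf j v *: (a ⊗ w))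
    - \sw_(a, g <- Z) (a ⊗ (ad^-1)%VF g v)).
  rewrite (lin_sum _ _ lA) -sumrB; apply: eq_bigr => j _.
  rewrite (sw_map _ _ lev) (sw_map _ _ lA) -sw_opp -sw_add; apply: eq_sw => a w.
  rewrite [in X in _ - X](sw_tns _ _ bA) sw_tns; last by lin.
  rewrite /= /comm_part lfunE /= lfunE /= rank1E.
  rewrite (lin_B (f := tns a)); last by lin.
  by rewrite !(lin_Z _ (f := tns a)) //; lin.
by rewrite Z0 (lin_0 lA) subr0 sw_basis_expand -?tensor_tns //; lin.
Qed.

Lemma endo_coactE (f : E) v :
  \sw_(a, g <- endo_coact Sinv f) (a ⊗ g v) = endo_coact_eval f v.
Proof.
have [t tE] := endo_coact_exists f; rewrite endo_coact_evalE.
move: v; apply: (@theP _ 0 (fun t : tensor H E => forall v : V,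
  \sw_(a, g <- t) (a ⊗ g v) =
  \sw_(a, v0 <- hcoact Y v) \sw_(b, w <- hcoact Y (f v0)) ((b * Sinv a) ⊗ w))).
by exists t => u; rewrite tE endo_coact_evalE.
Qed.

Local Notation DL := (endo_hyd Y Sinv).

(** The coaction is a choice, but an element of H ⊗ End(V) is determined by its values on V, and
    these are linear in f. *)
Lemma lin_endo_coact : lin (hcoact DL).
Proof.
move=> r f g; apply: endo_ext => v.
have lev : lin (fun t : tensor H E => \sw_(a, g <- t) (a ⊗ g v)) by lin.
rewrite lev !endo_coactE.
have lR : lin (fun f : E => endo_coact_eval f v) by rewrite /endo_coact_eval; lin.
exact: lR.
Qed.

Lemma bilin_endo_act : bilin (hact DL).
Proof.
split=> [h|f] r x y; apply: endo_eqP => v; rewrite [RHS]lin_endo_eval !endo_actE.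
  have lR : lin (fun f : E =>
    \sw_(h1, h2 <- comul H h) hact X h1 (f (hact X (antipode H h2) v))) by lin.
  exact: lR.
have lR : lin (fun h : H =>
  \sw_(h1, h2 <- comul H h) hact X h1 (f (hact X (antipode H h2) v))) by lin.
exact: lR.
Qed.

Let bact := bilin_endo_act.
Let lcoact := lin_endo_coact.

Ltac lin_db ::= first [ lin_V | match goal with
  | |- lin (fun z_ => hact (endo_hyd _ _) _ ?m) => apply (linI_bil m bact)
  | |- lin (fun z_ => hact (endo_hyd _ _) ?m _) => apply (linI_bir m bact)
  | |- lin (fun z_ => hcoact (endo_hyd _ _) _) => apply (linI_comp lcoact)
  end ].

Lemma endo_hactE h (f : E) v : hact DL h f v =
  \sw_(h1, h2 <- comul H h) hact X h1 (f (hact X (antipode H h2) v)).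
Proof. exact: endo_actE. Qed.

Lemma sw_endo_coact (P : lmodType k) (G : H -> E -> P) (F : H -> V -> P) (f : E) v :
  (forall a g, G a g = F a (g v)) -> bilin F ->
  sweedler (hcoact DL f) G =
  \sw_(a, v0 <- hcoact X v) \sw_(b, w <- hcoact X (f v0)) F (b * Sinv a) w.
Proof.
move=> EG bF; transitivity (sweedler (endo_coact_eval f v) F).
  rewrite -endo_coactE sw_bind //; apply: eq_sw => a g.
  by rewrite EG sw_tns.
rewrite /endo_coact_eval sw_bind //; apply: eq_sw => a v0.
by rewrite sw_bind //; apply: eq_sw => b w; rewrite sw_tns.
Qed.

(* Expands the coaction of f under a sum in which f_0 occurs only through a
   value f_0(v). *)
Ltac eval_coact := idtac; lazymatch goal with
  | |- sweedler (hcoact (endo_hyd _ _) ?f) _ = _ =>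
    push_in ltac:(eapply sw_endo_coact;
      [ let a := fresh "a" in let g := fresh "g" in intros a g; cbv beta;
        match goal with |- context [@fun_of_lfun ?R ?A ?B (endo_val g) ?v] =>
          let F := match goal with |- _ = ?F _ _ => F end in
          match goal with |- ?l = _ =>
            let l' := eval pattern a, (@fun_of_lfun R A B (endo_val g) v) in l in
            lazymatch l' with ?f _ _ => unify F f; reflexivity end end end
      | lin ])
  end.
Ltac sw_rules ::= first [ eval_coact | match goal with
  | h : is_yd ?D |- sweedler (hcoact ?D (hact ?D _ _)) _ = _ =>
    apply (sw_coact_act h); lin
  | h : is_yd ?D |- sweedler (hcoact ?D (sweedler _ _)) _ = _ =>
    rewrite (sw_map _ _ (yd_coact_lin h)); reflexivity
  end ].
Ltac leaf_hyp ::= progress rewrite ?(yd_actM yX) ?(yd_act1 yX) ?endo_hactE.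

Lemma endo_eqL (f g : (E : lmodType k)) :
  (forall v, @eq (GRing.Lmodule.sort (V : lmodType k)) ((f : E) v) ((g : E) v)) -> f = g.
Proof. exact: endo_eqP. Qed.

Lemma endo_yd : is_yd DL.
Proof.
split; [exact: bact| | |exact: lcoact| | |].
- move=> h g f; apply: (@endo_eqL (hact DL h (hact DL g f)) (hact DL (h * g) f)) => v.
  by rewrite !endo_hactE; sw_solve.
- move=> f; apply: (@endo_eqL (hact DL 1 f) f) => v.
  by rewrite endo_hactE; sw_solve.
- by move=> f; apply: endo_ext3 => v; sw_solve.
- by move=> f; apply: endo_eqL => v; swn.
- by move=> h f; apply: endo_ext => v; sw_solve.
Qed.

Lemma endo_map_id (f : E) : endo_map f = f.
Proof. by apply: endo_eqP => v; rewrite endo_ofE invol. Qed.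
Lemma endo_inv_id (f : E) : endo_inv f = f.
Proof. by apply: endo_eqP => v; rewrite endo_ofE !hinv_invol invol. Qed.

Local Notation "f ∘ g" := (endo_mul f g) (at level 40, left associativity).

Lemma endo_mulE (f g : E) v : (f ∘ g) v = f (g v).
Proof. exact: endo_ofE. Qed.

Lemma bilin_endo_mul : bilin (@endo_mul _ _ _ Y).
Proof.
split=> [f|g] a x y; apply: endo_eqP => v; rewrite [RHS]lin_endo_eval !endo_mulE.
  by rewrite lin_endo_eval lin_endo.
by rewrite lin_endo_eval.
Qed.

Let bmul := bilin_endo_mul.
Let yL := endo_yd.

Ltac lin_db ::= first [ lin_V | match goal with
  | |- lin (fun z_ => endo_mul _ ?m) => apply (linI_bil m bmul)
  | |- lin (fun z_ => endo_mul ?m _) => apply (linI_bir m bmul)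
  end ].
Ltac leaf_hyp ::= progress rewrite ?(yd_actM yX) ?(yd_act1 yX) ?(yd_actM yL)
  ?(yd_act1 yL) ?endo_hactE ?endo_mulE.

Lemma endo_act_mul h (f g : E) :
  hact DL h (f ∘ g) = \sw_(h1, h2 <- comul H h) (hact DL h1 f ∘ hact DL h2 g).
Proof.
by apply: endo_eqL => v; rewrite endo_hactE; sw_solve.
Qed.

Lemma endo_coact_mul (f g : E) : hcoact DL (f ∘ g) =
  \sw_(a, f0 <- hcoact DL f) \sw_(b, g0 <- hcoact DL g) ((a * b) ⊗ (f0 ∘ g0)).
Proof.
by apply: endo_ext => v; sw_solve.
Qed.

Lemma endo_brE (f g : E) : endo_br Sinv f g =
  f ∘ g - \sw_(a, f0 <- hcoact DL f) (hact DL a g ∘ f0).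
Proof.
rewrite /endo_br; congr (_ - _); apply: (@eq_sw _ _ _ E) => a f0.
by rewrite endo_inv_id endo_map_id.
Qed.

Ltac leaf_hyp ::= progress rewrite ?(yd_actM yX) ?(yd_act1 yX) ?(yd_actM yL)
  ?(yd_act1 yL) ?endo_hactE ?endo_mulE ?endo_act_mul ?endo_coact_mul.

Lemma endo_br_act h (f g : E) : hact DL h (endo_br Sinv f g) =
  \sw_(h1, h2 <- comul H h) endo_br Sinv (hact DL h1 f) (hact DL h2 g).
Proof.
by rewrite endo_brE; swr (use endo_brE); sw_solve.
Qed.

Lemma endo_br_coact (f g : E) : hcoact DL (endo_br Sinv f g) =
  \sw_(a, f0 <- hcoact DL f) \sw_(b, g0 <- hcoact DL g)
    ((a * b) ⊗ endo_br Sinv f0 g0).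
Proof.
by rewrite endo_brE; swr (use endo_brE); sw_solve.
Qed.

(** Evaluated at w, crossing f with u becomes crossing f(w_0) with S^-1(w_(-1)) . u. Symmetry for X
    and D reverses this crossing; symmetry in the other order then trades S^-1(w_(-1)) for an action
    on the argument of f, and the result is the action of S^-1(u_(-1)) on f. *)
Lemma endo_braid_sym (N : lmodType k) (D : hydData H N) :
  is_yd D -> braid_sym Sinv X D -> braid_sym Sinv DL D.
Proof.
move=> yD sXD f u; apply: endo_ext => w; swn; swnr.
transitivity (\sw_(a, w0 <- hcoact X w) \sw_(b, z <- hcoact X (f w0))
  (hact D b (hact D (Sinv a) u) ⊗ z)).
  by do 2 apply: eq_sw => ? ?; rewrite (yd_actM yD).
etransitivity.
  apply: eq_sw => a w0. apply: (sw_sym _ _ sXD); lin.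
have sDX := braid_symC SK SinvK yX yD sXD.
etransitivity.
  symmetry; apply: (sw_sym u w sDX (F := fun v m =>
    \sw_(b, n0 <- hcoact D m) (n0 ⊗ hact X (Sinv b) (f v)))).
  by lin.
by [].
Qed.

Lemma endo_braid_involutive : symmetric_braiding Sinv Y -> forall f g : E,
  \sw_(a, f0 <- hcoact DL f) \sw_(b, g0 <- hcoact DL (hact DL a g))
    (hact DL b f0 ⊗ g0) = f ⊗ g.
Proof.
move=> sY f g.
have sLX := endo_braid_sym yX (untwist_sym sY).
have sLL := endo_braid_sym yL (braid_symC SK SinvK yL yX sLX).
by apply: (braid_sym_inv SK SinvK yL yL f g sLL (F := fun x y => x ⊗ y)); lin.
Qed.

End Endomorphisms.

Theorem proposition4p10 (k : fieldType) (H : hopfAlg k)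
    (Sinv : H -> H) (SK : cancel (antipode H) Sinv) (SinvK : cancel Sinv (antipode H))
    (V : vectType k) (Y : hyd H V)
    (involutive_V : forall v : V, hmap Y (hmap Y v) = v)
    (symmetric_V : symmetric_braiding Sinv Y) :
  let L := endo_lie Y Sinv in
  is_biproduct_hom_hopf (uhyd L) (umul (L := L)) (uone L)
    (ucomul (uhopf L)) (ucounit (uhopf L)) (uantipode (uhopf L)).
Proof.
move=> L.
have hmL x : hmap (lie_hyd L) x = x := endo_map_id involutive_V x.
have hiL x : hinv (lie_hyd L) x = x := endo_inv_id involutive_V x.
have yL : is_yd (lie_hyd L) := endo_yd SK SinvK involutive_V.
(* Existence of a Hopf structure ensures that the choice in [uhopf] does not return its zero
   default. *)
have uhopfP : is_uhopf (uhopf L).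
  apply: theP; apply: enveloping_uhopf hmL hiL yL _ _ _.
  - exact: endo_braid_involutive.
  - exact: endo_br_act.
  - exact: endo_br_coact.
apply: radford_biproduct (uhopf_hopf uhopfP) => u /=.
- by rewrite tmap_id // uprojK.
- by rewrite tinv_id // uprojK.
Qed.
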